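(* Let $\mathbb{F}\in\{\mathbb{R},\mathbb{C}\}$, let $\boldsymbol x_0\in\mathbb{F}^n$ be a fixed vector, and let $\boldsymbol A\in\mathbb{F}^{m\times n}$ be a standard Gaussian random matrix. There are universal positive constants $C,\widetilde c_1,\widetilde c_2,\widetilde c_3,C'$ such that for every integer $k\in\{1,\dots,n\}$ with $Ck\log(en/k)\le m$, with probability at least \[ 1-\widetilde c_3\exp(-\widetilde c_2m)-\exp(-\sqrt{mn})-2m\exp\!\Big(-\frac{\widetilde c_1m}{\log(en/m)}\Big), \] every $\boldsymbol x^\#\in\Delta_1(|\boldsymbol A\boldsymbol x_0|)$ satisfies $\mathrm{dist}(\boldsymbol x^\#,\boldsymbol x_0)\le C'\,\sigma_k(\boldsymbol x_0)_2$.
   Context: A standard Gaussian random matrix $\boldsymbol A\in\mathbb{F}^{m\times n}$ has i.i.d. entries $\mathcal N(0,1)$ if $\mathbb F=\mathbb R$, and $\mathcal N(0,1/2)+\mathrm i\,\mathcal N(0,1/2)$ if $\mathbb F=\mathbb C$. $|\boldsymbol u|$ is the entrywise modulus. $\mathrm{dist}(\boldsymbol x,\boldsymbol y)=\min_{c\in\mathbb F,|c|=1}\|\boldsymbol x-c\boldsymbol y\|_2$. $\Sigma_k=\{\boldsymbol z:\|\boldsymbol z\|_0\le k\}$, $\sigma_k(\boldsymbol x)_2=\min_{\boldsymbol z\in\Sigma_k}\mathrm{dist}(\boldsymbol x,\boldsymbol z)$. $\Delta_1(|\boldsymbol A\boldsymbol x|)=\operatorname{argmin}_{\boldsymbol z\in\mathbb{F}^n}\{\|\boldsymbol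 z\|_1:|\boldsymbol A\boldsymbol z|=|\boldsymbol A\boldsymbol x|\}$. *)

(* Defs.v *)
From HB Require Import structures.
From mathcomp Require Import all_boot all_order all_algebra.
From mathcomp Require Import all_classical all_reals all_analysis.
From mathcomp Require Import complex.

Set Implicit Arguments.
Unset Strict Implicit.
Unset Printing Implicit Defensive.

Import Order.TTheory GRing.Theory Num.Theory.
Local Open Scope classical_set_scope.
Local Open Scope ring_scope.

(* The field F in {R, C} is encoded by a boolean [isR]:
   isR = true  <-> F = R,  isR = false <-> F = C.
   Scalars are always represented in R[i]; F is the subset of R[i] given by
   [inF isR] (real numbers = zero imaginary part when isR). *)

Definition inF (R : realType) (isR : bool) (z : R[i]) : Prop :=
  isR -> Im z = 0.

Definition vecF (R : realType) (isR : bool) (n : nat) (x : 'cV[R[i]]_n) : Prop :=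
  forall i, inF isR (x i 0).

Definition cmod (R : realType) (z : R[i]) : R := Normc.normc z.

Definition absv (R : realType) (m : nat) (u : 'cV[R[i]]_m) : 'cV[R]_m :=
  map_mx (@cmod R) u.

Definition norm1 (R : realType) (n : nat) (x : 'cV[R[i]]_n) : R :=
  \sum_(i < n) cmod (x i 0).

Definition norm2 (R : realType) (n : nat) (x : 'cV[R[i]]_n) : R :=
  Num.sqrt (\sum_(i < n) cmod (x i 0) ^+ 2).

Definition norm0 (R : realType) (n : nat) (x : 'cV[R[i]]_n) : nat :=
  #|[set i : 'I_n | x i 0 != 0]|.

(* dist(x,y) = min_{c in F, |c| = 1} ||x - c y||_2  (the minimum exists; we
   write it as the infimum) *)
Definition dist (R : realType) (isR : bool) (n : nat) (x y : 'cV[R[i]]_n) : R :=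
  inf [set norm2 (x - c *: y) | c in [set c : R[i] | inF isR c /\ cmod c = 1]].

Definition sigma_k (R : realType) (isR : bool) (n k : nat) (x : 'cV[R[i]]_n) : R :=
  inf [set dist isR x z | z in [set z : 'cV[R[i]]_n | vecF isR z /\ (norm0 z <= k)%N]].

Definition Delta1 (R : realType) (isR : bool) (m n : nat)
    (A : 'M[R[i]]_(m, n)) (y : 'cV[R]_m) : set 'cV[R[i]]_n :=
  [set z | vecF isR z /\ absv (A *m z) = y /\
           (forall w, vecF isR w -> absv (A *m w) = y -> norm1 z <= norm1 w)].

Definition mutually_independent (d : measure_display) (T : measurableType d)
    (R : realType) (P : probability T R) (I : finType) (X : I -> T -> R) : Prop :=
  forall B : I -> set R, (forall i, measurable (B i)) ->
    P (\bigcap_(i in [set: I]) (X i @^-1` B i)) =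
    (\big[*%E/1%E]_(i : I) P (X i @^-1` B i))%E.

(* X has law N(0, s^2) (s = standard deviation) *)
Definition has_normal_law (d : measure_display) (T : measurableType d)
    (R : realType) (P : probability T R) (s : R) (X : T -> R) : Prop :=
  measurable_fun [set: T] X /\
  forall B : set R, measurable B -> P (X @^-1` B) = normal_prob 0 s B.

Definition gauss_mx (R : realType) (T : Type) (m n : nat)
    (Are Aim : 'I_m -> 'I_n -> T -> R) (w : T) : 'M[R[i]]_(m, n) :=
  \matrix_(i, j) (Are i j w +i* Aim i j w)%C.

Definition std_gaussian (d : measure_display) (T : measurableType d)
    (R : realType) (P : probability T R) (isR : bool) (m n : nat)
    (Are Aim : 'I_m -> 'I_n -> T -> R) : Prop :=
  if isR then
    (forall i j, has_normal_law P 1 (Are i j)) /\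
    (forall i j w, Aim i j w = 0) /\
    mutually_independent P (fun ij : 'I_m * 'I_n => Are ij.1 ij.2)
  else
    (forall i j, has_normal_law P (Num.sqrt (2^-1)) (Are i j)) /\
    (forall i j, has_normal_law P (Num.sqrt (2^-1)) (Aim i j)) /\
    mutually_independent P
      (fun ijb : 'I_m * 'I_n * bool =>
         if ijb.2 then Are ijb.1.1 ijb.1.2 else Aim ijb.1.1 ijb.1.2).

(* Main.v *)
(* Let x_T be a best k-term approximation of x0 and w = x0 - x_T. With high
   probability A w = A u for some u with |u|_1 <= C sqrt(s) |w|_2, where s is of
   order m / log(e n / m): every vector of F^m is well correlated with some
   column of A, so greedy pursuit builds u. As x_T + u has the measurements of
   x0, a minimizer z satisfies |z|_1 <= |x_T|_1 + |u|_1, which puts z - x_T and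
   z + x_T into a cone of effectively s-sparse vectors unless z is already close
   to x_T. Rotate z by a phase making <x_T, z> nonnegative. The identity
     Re(A(z - x_T) conj(A(z + x_T))) = |Az|^2 - |A x_T|^2 = |A x0|^2 - |A x_T|^2
   holds in every row. Summing absolute values over the rows, the right-hand
   side is at most C m |w| (|w| + 2 |x_T|), whereas on the cone the left-hand
   side is at least c m |z - x_T| |z + x_T| by a small ball estimate for each
   row and a union bound over a net. *)

Require Import Defs.
From HB Require Import structures.
From mathcomp Require Import all_boot all_order all_algebra.
From mathcomp Require Import all_classical all_reals all_analysis.
From mathcomp Require Import complex.
From mathcomp Require Import measurable_realfun ring lra.

Set Implicit Arguments.
Unset Strict Implicit.
Unset Printing Implicit Defensive.

Import Order.TTheory GRing.Theory Num.Theory.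
Local Open Scope classical_set_scope.
Local Open Scope ring_scope.

(** * Norms on finite index sets *)

(** The vector [x0] is fixed before [A] is drawn, so its tail w is one fixed vector: although w is
    not sparse, |A w| <= C sqrt(m) |w| holds with high probability without a net over its
    coordinates. This is what allows the error to be measured by the l2-tail. The product Re(A x
    conj(A y)) vanishes identically when y is an imaginary multiple of x. Aligning the phases of x_T
    and z makes z - x_T and z + x_T orthogonal in the imaginary direction, which excludes this
    degeneracy. A net of s-sparse vectors has about exp(s log(n/s)) points and must be beaten by a
    failure probability exp(-c m); this fixes s at order m / log(e n / m). The same s is large
    enough to pay for the l1-norm of u. All probability bounds come from moment generating functions
    of linear forms: upper tails by exponential Markov, lower bounds for small balls by exponential
    tilting. Products of correlated Gaussian forms are thus treated without joint densities, and a
    degenerate form of variance 0 is allowed, so that both fields are handled together. *)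

Section Euclid.
Variables (R : realType) (J : finType).
Implicit Types x y z : J -> R.

Definition dot x y : R := \sum_j x j * y j.
Definition l2 x : R := Num.sqrt (\sum_j x j ^+ 2).
Definition l1 x : R := \sum_j `|x j|.
Definition supp x : {set J} := [set j | x j != 0]%SET.
Definition restr (A : {set J}) x : J -> R := fun j => if j \in A then x j else 0.

Lemma sumsq_ge0 x : 0 <= \sum_j x j ^+ 2.
Proof. by apply: sumr_ge0 => j _; apply: sqr_ge0. Qed.

Lemma l2_ge0 x : 0 <= l2 x. Proof. exact: sqrtr_ge0. Qed.

Lemma sqr_l2 x : l2 x ^+ 2 = \sum_j x j ^+ 2.
Proof. by rewrite sqr_sqrtr // sumsq_ge0. Qed.

Lemma l2_le x (c : R) : 0 <= c -> \sum_j x j ^+ 2 <= c ^+ 2 -> l2 x <= c.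
Proof. by move=> c0 h; rewrite -(ler_pXn2r (n := 2)) ?nnegrE ?l2_ge0 // sqr_l2. Qed.

Lemma dotC x y : dot x y = dot y x.
Proof. by apply: eq_bigr => j _; rewrite mulrC. Qed.

Lemma dotDl x y z : dot (fun j => x j + y j) z = dot x z + dot y z.
Proof. by rewrite -big_split; apply: eq_bigr => j _; rewrite mulrDl. Qed.

Lemma dotBl x y z : dot (fun j => x j - y j) z = dot x z - dot y z.
Proof. by rewrite -sumrB; apply: eq_bigr => j _; rewrite mulrBl. Qed.

Lemma dotZl a x z : dot (fun j => a * x j) z = a * dot x z.
Proof. by rewrite mulr_sumr; apply: eq_bigr => j _; rewrite mulrA. Qed.

Lemma dotDr x y z : dot z (fun j => x j + y j) = dot z x + dot z y.
Proof. by rewrite dotC dotDl !(dotC z). Qed.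

Lemma dotBr x y z : dot z (fun j => x j - y j) = dot z x - dot z y.
Proof. by rewrite dotC dotBl !(dotC z). Qed.

Lemma dotZr a x z : dot z (fun j => a * x j) = a * dot z x.
Proof. by rewrite dotC dotZl (dotC z). Qed.

Lemma dot_self x : dot x x = l2 x ^+ 2.
Proof. by rewrite sqr_l2; apply: eq_bigr => j _; rewrite expr2. Qed.

Lemma l2_0E x : l2 x = 0 -> forall j, x j = 0.
Proof.
move=> /(congr1 (fun a => a ^+ 2)); rewrite sqr_l2 expr0n /= => h j.
have := @psumr_eq0P _ _ predT (fun j => x j ^+ 2) (fun j _ => sqr_ge0 (x j)) h j isT.
by move=> /eqP; rewrite sqrf_eq0 => /eqP.
Qed.

(** Expanding the nonnegative sum of squares of [l2 y * x - l2 x * y] gives the claim multiplied by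
    a positive multiple of [l2 x * l2 y]; the zero cases are split off to allow the cancellation. *)
Lemma dot_le x y : dot x y <= l2 x * l2 y.
Proof.
have [x0|x0] := eqVneq (l2 x) 0.
  rewrite x0 mul0r /dot big1 // => j _; by rewrite (l2_0E x0) mul0r.
have [y0|y0] := eqVneq (l2 y) 0.
  rewrite y0 mulr0 /dot big1 // => j _; by rewrite (l2_0E y0) mulr0.
have xp : 0 < l2 x by rewrite lt_neqAle eq_sym x0 l2_ge0.
have yp : 0 < l2 y by rewrite lt_neqAle eq_sym y0 l2_ge0.
have : 0 <= \sum_j (l2 y * x j - l2 x * y j) ^+ 2 by apply: sumsq_ge0.
have -> : \sum_j (l2 y * x j - l2 x * y j) ^+ 2 =
  l2 y ^+ 2 * (l2 x ^+ 2) + l2 x ^+ 2 * l2 y ^+ 2 - 2 * l2 x * l2 y * dot x y.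
  rewrite {1}(sqr_l2 x) {2}(sqr_l2 y) /dot !mulr_sumr -big_split -sumrB /=.
  by apply: eq_bigr => j _; ring.
have pp : 0 < l2 x * l2 y by rewrite mulr_gt0.
move=> h; rewrite -(ler_pM2l pp).
have -> : l2 x * l2 y * (l2 x * l2 y) = l2 x ^+ 2 * l2 y ^+ 2 by ring.
nra.
Qed.

Lemma l2N x : l2 (fun j => - x j) = l2 x.
Proof. by rewrite /l2; congr Num.sqrt; apply: eq_bigr => j _; rewrite sqrrN. Qed.

Lemma dot_abs x y : `|dot x y| <= l2 x * l2 y.
Proof.
rewrite ler_norml dot_le andbT lerNl.
have -> : - dot x y = dot (fun j => - x j) y.
  by rewrite /dot -sumrN; apply: eq_bigr => j _; rewrite mulNr.
by rewrite -(l2N x) dot_le.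
Qed.

Lemma l2D x y : l2 (fun j => x j + y j) <= l2 x + l2 y.
Proof.
apply: l2_le; first by rewrite addr_ge0 ?l2_ge0.
have -> : \sum_j (x j + y j) ^+ 2 = l2 x ^+ 2 + l2 y ^+ 2 + 2 * dot x y.
  rewrite !sqr_l2 /dot mulr_sumr -!big_split /=; apply: eq_bigr => j _; ring.
have := dot_le x y; nra.
Qed.

Lemma l2B x y : l2 (fun j => x j - y j) <= l2 x + l2 y.
Proof. by rewrite -(l2N y); exact: l2D. Qed.

Lemma l2_subr x y : l2 x - l2 y <= l2 (fun j => x j - y j).
Proof.
rewrite lerBlDr; apply: le_trans (l2D _ _).
by rewrite le_eqVlt; apply/orP; left; apply/eqP; congr Num.sqrt; apply: eq_bigr => j _; rewrite subrK.
Qed.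

Lemma l2Z a x : l2 (fun j => a * x j) = `|a| * l2 x.
Proof.
rewrite /l2 -sqrtr_sqr -sqrtrM ?sqr_ge0 //; congr Num.sqrt.
by rewrite mulr_sumr; apply: eq_bigr => j _; rewrite exprMn.
Qed.

Lemma eq_l2 x y : x =1 y -> l2 x = l2 y.
Proof. by move=> h; rewrite /l2; congr Num.sqrt; apply: eq_bigr => j _; rewrite h. Qed.

Lemma eq_dot x y x' y' : x =1 x' -> y =1 y' -> dot x y = dot x' y'.
Proof. by move=> h h'; apply: eq_bigr => j _; rewrite h h'. Qed.

Lemma le_l2 x y : (forall j, `|x j| <= `|y j|) -> l2 x <= l2 y.
Proof.
move=> h; rewrite /l2 ler_sqrt ?sumsq_ge0 //; apply: ler_sum => j _.
by rewrite -(real_normK (num_real (x j))) -(real_normK (num_real (y j))) lerXn2r ?nnegrE ?h.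
Qed.

Lemma coord_l2 x j : `|x j| <= l2 x.
Proof.
rewrite -sqrtr_sqr /l2 ler_sqrt ?sumsq_ge0 // (bigD1 j) //= lerDl.
by apply: sumr_ge0 => i _; apply: sqr_ge0.
Qed.

Lemma l1_ge0 x : 0 <= l1 x. Proof. by apply: sumr_ge0. Qed.

Lemma l1D x y : l1 (fun j => x j + y j) <= l1 x + l1 y.
Proof. by rewrite -big_split; apply: ler_sum => j _; apply: ler_normD. Qed.

Lemma sum_le_l2 (A : {set J}) x : \sum_(j in A) `|x j| <= Num.sqrt #|A|%:R * l2 x.
Proof.
have := dot_le (fun j => if j \in A then 1 else 0) (fun j => `|x j|).
have -> : dot (fun j => if j \in A then 1 else 0) (fun j => `|x j|) = \sum_(j in A) `|x j|.
  rewrite /dot [RHS]big_mkcond; apply: eq_bigr => j _ /=; case: ifP; by rewrite ?mul1r ?mul0r.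
have -> : l2 (fun j => if j \in A then 1 else 0) = Num.sqrt #|A|%:R.
  congr Num.sqrt; rewrite -sum1_card natr_sum [RHS]big_mkcond.
  by apply: eq_bigr => j _; case: ifP => _; rewrite ?expr1n ?expr0n.
have -> // : l2 (fun j => `|x j|) = l2 x.
by congr Num.sqrt; apply: eq_bigr => j _; rewrite real_normK ?num_real.
Qed.

Lemma l1_supp x : l1 x = \sum_(j in supp x) `|x j|.
Proof.
rewrite [RHS]big_mkcond; apply: eq_bigr => j _; rewrite inE.
by case: eqP => //= ->; rewrite normr0.
Qed.

Lemma l1_le_supp x (s : nat) : (#|supp x| <= s)%N -> l1 x <= Num.sqrt s%:R * l2 x.
Proof.
move=> h; rewrite l1_supp; apply: le_trans (sum_le_l2 _ _) _.
by rewrite ler_wpM2r ?l2_ge0 // ler_sqrt ?ler_nat.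
Qed.

Lemma l2_le_inf x (s : nat) (M : R) : (#|supp x| <= s)%N -> (forall j, `|x j| <= M) ->
  0 <= M -> l2 x <= Num.sqrt s%:R * M.
Proof.
move=> hs hM M0; apply: l2_le; first by rewrite mulr_ge0 ?sqrtr_ge0.
rewrite exprMn sqr_sqrtr ?ler0n //.
apply: (@le_trans _ _ (\sum_(j in supp x) M ^+ 2)).
  rewrite [leRHS]big_mkcond; apply: ler_sum => j _; rewrite inE.
  case: eqP => [->|_] /=; first by rewrite expr0n.
  by rewrite -(real_normK (num_real (x j))) lerXn2r ?nnegrE.
by rewrite sumr_const -[leLHS]mulr_natl ler_wpM2r ?sqr_ge0 // ler_nat.
Qed.

Lemma l2_restr A x : l2 (restr A x) <= l2 x.
Proof. by apply: le_l2 => j; rewrite /restr; case: ifP => //; rewrite normr0. Qed.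

Lemma supp_restr A x : supp (restr A x) \subset A.
Proof. by apply/fintype.subsetP => j; rewrite inE /restr; case: ifP => //; rewrite eqxx. Qed.

Lemma l1_restr A x : l1 (restr A x) = \sum_(j in A) `|x j|.
Proof.
rewrite [RHS]big_mkcond; apply: eq_bigr => j _; rewrite /restr.
by case: ifP => //; rewrite normr0.
Qed.

Lemma l1_split A x : l1 x = l1 (restr A x) + l1 (restr (~: A)%SET x).
Proof.
rewrite !l1_restr /l1 (bigID (fun j => j \in A)) /=; congr (_ + _).
by apply: eq_bigl => j; rewrite inE.
Qed.

Lemma restr_split A x j : x j = restr A x j + restr (~: A)%SET x j.
Proof. by rewrite /restr inE; case: (j \in A); rewrite ?addr0 ?add0r. Qed.

(** A set of maximal sum among those of size [s] works: exchanging a member for an outsider cannot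
    increase the sum. *)
Lemma top_set x (s : nat) : (s <= #|J|)%N ->
  exists2 T : {set J}, #|T| = s & forall i j, i \in T -> j \notin T -> x j <= x i.
Proof.
move=> hs.
have [T0 T0s] : exists T0 : {set J}, #|T0| == s.
  by exists [set j in take s (enum J)]%SET; rewrite cardsE;
    rewrite -[X in _ == X](size_takel (s := enum J)) -?cardE //; apply/eqP/card_uniqP/take_uniq/enum_uniq.
pose F (T : {set J}) := \sum_(j in T) x j.
case: (@Order.TotalTheory.arg_maxP _ R {set J} T0 (fun T => #|T| == s) F T0s) => T /eqP Ts Tmax.
exists T => // i j iT jT.
have := Tmax (j |: (T :\ i))%SET.
have jTi : j \notin (T :\ i)%SET by rewrite !inE negb_and jT orbT.
have cT := cardsD1 i T; rewrite iT Ts in cT.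
rewrite cardsU1 jTi -cT eqxx => /(_ isT).
by rewrite /F big_setU1 //= (big_setD1 i (A := T)) //= lerD2r.
Qed.

End Euclid.

(** * Nets of sparse vectors *)

Section Net.
Variable R : realType.

(* [code D] encodes the integers of absolute value at most [D]. *)
Definition code (D : nat) : finType := option ('I_D * bool).
Definition cval D (c : code D) : R :=
  if c is Some (q, b) then (if b then 1 else - 1) * q.+1%:R else 0.
Definition cwt D (c : code D) : nat := if c is Some (q, _) then q.+1 else 0%N.
(** Integer points with at most [S] nonzero entries and l1-norm at most [D]. The budget on the
    l1-norm, instead of a range for each entry, keeps the cardinality exponential in [D] and in the
    entropy of the supports. *)
Definition net (J : finType) (S D : nat) : {set {ffun J -> code D}} :=
  [set f : {ffun J -> code D} |
    (#|[set j | f j != None]%SET| <= S)%N && (\sum_j cwt (f j) <= D)%N]%SET.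
Definition pt (J : finType) (D : nat) (h : R) (f : {ffun J -> code D}) : J -> R :=
  fun j => h * cval (f j).

(** Truncation toward zero: moduli and supports cannot grow, and the integer obtained is paid for by
    [|a|], which keeps the rounded vector within the l1 budget of [net]. *)
Lemma round_coord (h a : R) (D : nat) : 0 < h -> `|a| <= h * D%:R ->
  exists c : code D, [/\ `|h * cval c| <= `|a|, `|a - h * cval c| <= h,
     (a = 0 -> c = None) & h * (cwt c)%:R <= `|a|].
Proof.
move=> h0 aD.
have ah0 : 0 <= `|a| / h by rewrite divr_ge0 // ltW.
have := truncn_itv ah0; set q0 := Num.truncn _ => /andP[q1 q2].
have {}q1 : h * q0%:R <= `|a| by rewrite mulrC -ler_pdivlMr.
have {}q2 : `|a| < h * q0%:R + h.
  by move: q2; rewrite ltr_pdivrMr // -natr1 mulrC mulrDr mulr1.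
have q0D : (q0 <= D)%N.
  by rewrite -(ler_nat R) -(ler_pM2l h0); apply: le_trans aD.
case: (posnP q0) => [q00|q0p].
  exists None; split => //=; rewrite ?mulr0 ?normr0 ?subr0 //.
  by move: q2; rewrite q00 mulr0 add0r => /ltW.
have lt : (q0.-1 < D)%N by rewrite prednK.
exists (Some (Ordinal lt, 0 <= a)); rewrite /= prednK //.
have q0r : 0 <= h * q0%:R by rewrite mulr_ge0 ?ler0n // ltW.
have [a0|a0] := leP 0 a; split => //.
- by rewrite mul1r ger0_norm.
- by rewrite mul1r; rewrite ger0_norm // in q1 q2; rewrite ler_norml; apply/andP; split; lra.
- by move=> e; move: q1; rewrite e normr0 leNgt mulr_gt0 // ltr0n.
- by rewrite mulN1r mulrN normrN ger0_norm.
- rewrite mulN1r; rewrite ltr0_norm // in q1 q2; rewrite ler_norml; apply/andP; split; lra.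
- by move=> e; rewrite e ltxx in a0.
Qed.

(** With grid step [eps / sqrt S], at most [S] coordinates each err by one step, which adds up to
    [eps] in l2; the l1 budget holds because a unit vector with [S] entries has l1-norm at most
    [sqrt S]. The rounding error is itself sparse, so the approximation can be iterated. *)
Lemma net_approx (J : finType) (S D : nat) (eps : R) (x : J -> R) :
  (0 < S)%N -> 0 < eps -> S%:R <= eps * D%:R -> l2 x <= 1 -> (#|supp x| <= S)%N ->
  exists2 f, f \in net J S D & let y := pt (eps / Num.sqrt S%:R) f in
    [/\ l2 (fun j => x j - y j) <= eps, l2 y <= l2 x, (forall j, x j = 0 -> y j = 0) &
      (#|supp (fun j => (x j - y j)%R)| <= S)%N].
Proof.
move=> S0 e0 SD x1 sx; set h := eps / _.
have s0 : 0 < Num.sqrt S%:R :> R by rewrite sqrtr_gt0 ltr0n.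
have h0 : 0 < h by rewrite divr_gt0.
have hD : Num.sqrt S%:R <= h * D%:R.
  by rewrite /h mulrAC ler_pdivlMr // -expr2 sqr_sqrtr ?ler0n.
have l1x : l1 x <= Num.sqrt S%:R.
  apply: le_trans (l1_le_supp sx) _; rewrite ler_piMr ?sqrtr_ge0 //.
have H j : exists c : code D, [/\ `|h * cval c| <= `|x j|, `|x j - h * cval c| <= h,
     (x j = 0 -> c = None) & h * (cwt c)%:R <= `|x j|].
  apply: round_coord => //; apply: le_trans hD; apply: le_trans l1x.
  by rewrite /l1 (bigD1 j) //= lerDl sumr_ge0.
pose f : {ffun J -> code D} := [ffun j => projT1 (cid (H j))].
have fP j : [/\ `|h * cval (f j)| <= `|x j|, `|x j - h * cval (f j)| <= h,
     (x j = 0 -> f j = None) & h * (cwt (f j))%:R <= `|x j|].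
  by rewrite ffunE; case: (cid _).
have sub : (#|[set j | f j != None]%SET| <= S)%N.
  apply: leq_trans sx; apply: subset_leq_card; apply/fintype.subsetP => j; rewrite !inE.
  by apply: contra => /eqP x0; case: (fP j) => _ _ /(_ x0) -> _.
exists f.
  rewrite inE sub /= -(ler_nat R) -(ler_pM2l h0) natr_sum mulr_sumr.
  apply: le_trans hD; apply: le_trans l1x; apply: ler_sum => j _.
  by case: (fP j).
have sd : (#|supp (fun j => (x j - pt h f j)%R)| <= S)%N.
  apply: leq_trans sx; apply: subset_leq_card; apply/fintype.subsetP => j; rewrite !inE.
  apply: contra => /eqP x0; case: (fP j) => _ _ /(_ x0) fj _.
  by rewrite x0 /pt fj /= mulr0 subr0.
split => //.
- have -> : eps = Num.sqrt S%:R * h by rewrite /h mulrC divfK // gt_eqF.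
  by apply: l2_le_inf => //; [move=> j; case: (fP j)|exact: ltW].
- by apply: le_l2 => j; case: (fP j).
- by move=> j x0; case: (fP j) => _ _ /(_ x0) fj _; rewrite /pt fj /= mulr0.
Qed.

(* The net is counted by giving [f] the weight [th ^ #supp f / 2 ^ sum |f|],
   whose total mass is a product over the coordinates. *)
Lemma card_net (J : finType) (S D : nat) (th : R) : 0 < th -> th <= 1 ->
  #|net J S D|%:R <= (th^-1) ^+ S * 2 ^+ D * (1 + 2 * th) ^+ #|J|.
Proof.
move=> t0 t1.
pose w (c : code D) : R := (if c is Some _ then th else 1) * (2^-1) ^+ cwt c.
have w0 c : 0 <= w c by rewrite mulr_ge0 ?exprn_ge0 ?invr_ge0 //; case: c => // a; exact: ltW.
have sw : \sum_c w c <= 1 + 2 * th.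
  rewrite (bigD1 None) //= {1}/w /= expr0 mulr1 lerD2l.
  have -> : \sum_(i | i != None) w i = \sum_(i : 'I_D * bool) w (Some i).
    have -> : \sum_(i : 'I_D * bool) w (Some i) = \sum_(c <- [seq Some i | i : 'I_D * bool]) w c.
      by rewrite big_map big_enum.
    rewrite -big_filter; apply: perm_big; apply: uniq_perm.
    - by rewrite filter_uniq // index_enum_uniq.
    - by rewrite map_inj_uniq ?enum_uniq // => a b [].
    - move=> c; rewrite mem_filter mem_index_enum andbT; apply/idP/mapP.
        by case: c => // a _; exists a => //; rewrite mem_enum.
      by case=> a _ ->.
  have -> : \sum_(i : 'I_D * bool) w (Some i) = \sum_(i < D) \sum_b w (Some (i, b)).
    by rewrite pair_big /=; apply: eq_bigr => -[].
  have -> : \sum_(i < D) \sum_b w (Some (i, b)) = 2 * th * \sum_(i < D) (2^-1) ^+ i.+1.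
    rewrite mulr_sumr; apply: eq_bigr => i _; rewrite big_bool /= /w /=; ring.
  rewrite ler_piMr ?mulr_ge0 ?(ltW t0) //.
  have -> : \sum_(i < D) (2^-1 : R) ^+ i.+1 = 1 - (2^-1) ^+ D.
    elim: D {w w0} => [|n IH]; first by rewrite big_ord0 expr0 subrr.
    rewrite big_ord_recr /= IH !exprS; by field.
  by rewrite lerBlDr lerDl exprn_ge0 // invr_ge0.
have le1 : \sum_(f in net J S D) th ^+ S * (2^-1) ^+ D <= (1 + 2 * th) ^+ #|J|.
  apply: (@le_trans _ _ (\sum_(f : {ffun J -> code D}) \prod_j w (f j))).
    rewrite big_mkcond; apply: ler_sum => f _; case: ifP => [|_]; last first.
      by rewrite prodr_ge0.
    rewrite inE => /andP[f1 f2].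
    rewrite big_split /= ler_pM ?exprn_ge0 ?invr_ge0 ?(ltW t0) //.
      have -> : \prod_i (if f i is Some _ then th else 1) =
          th ^+ #|[set j | f j != None]%SET|.
        by rewrite -prodr_const [RHS]big_mkcond; apply: eq_bigr => j _; rewrite inE; case: (f j).
      by rewrite ler_wiXn2l // ltW.
    by rewrite prodrXr ler_wiXn2l ?invr_ge0 // invf_le1 // ler1n.
  rewrite -(bigA_distr_bigA (fun _ c => w c)) /= prodr_const cardE -cardT.
  by rewrite lerXn2r ?nnegrE ?sumr_ge0 // addr_ge0 // mulr_ge0 // ltW.
move: le1; rewrite sumr_const -[leLHS]mulr_natl => le1.
have p0 : 0 < th ^+ S * (2^-1) ^+ D by rewrite mulr_gt0 ?exprn_gt0 // invr_gt0.
rewrite -(ler_pM2r p0); apply: le_trans le1 _.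
have -> : th^-1 ^+ S * 2 ^+ D * (1 + 2 * th) ^+ #|J| * (th ^+ S * 2^-1 ^+ D) =
  (th^-1 * th) ^+ S * (2 * 2^-1) ^+ D * (1 + 2 * th) ^+ #|J| by rewrite !exprMn; ring.
by rewrite mulVf ?gt_eqF // mulfV // !expr1n !mul1r.
Qed.

End Net.

(** * Independence and Gaussian forms *)

Section LevelSets.
Context d (T : sigmaRingType d) (R : realType) (f : T -> R) (a : R).
Hypothesis mf : measurable_fun setT f.

Lemma measurable_set_le : measurable (setT : set T) -> measurable [set w | f w <= a].
Proof.
move=> mT; rewrite -[X in measurable X]setTI (_ : [set w | _] = f @^-1` `]-oo, a]).
  exact: mf.
by apply/seteqP; split => w /=; rewrite in_itv.
Qed.

Lemma measurable_set_gt : measurable (setT : set T) -> measurable [set w | a < f w].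
Proof.
move=> mT; rewrite -[X in measurable X]setTI (_ : [set w | _] = f @^-1` `]a, +oo[).
  exact: mf.
by apply/seteqP; split => w /=; rewrite in_itv /= andbT.
Qed.

Lemma measurable_set_ge : measurable (setT : set T) -> measurable [set w | a <= f w].
Proof.
move=> mT; rewrite -[X in measurable X]setTI (_ : [set w | _] = f @^-1` `[a, +oo[).
  exact: mf.
by apply/seteqP; split => w /=; rewrite in_itv /= andbT.
Qed.

End LevelSets.

Section Prob.
Context d (T : measurableType d) (R : realType) (P : probability T R).

(** Real-valued probability, so that estimates are closed by linear arithmetic. *)
Definition Pr (A : set T) : R := fine (P A).

Lemma PrE A : measurable A -> P A = (Pr A)%:E.
Proof. by move=> mA; rewrite /Pr fineK // fin_num_measure. Qed.

Lemma Pr_ge0 A : 0 <= Pr A.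
Proof. exact: fine_ge0. Qed.

Lemma Pr_le1 A : measurable A -> Pr A <= 1.
Proof. by move=> mA; rewrite -lee_fin -PrE // probability_le1. Qed.

Lemma PrT : Pr setT = 1.
Proof. by rewrite /Pr probability_setT. Qed.

Lemma PrC A : measurable A -> Pr (~` A) = 1 - Pr A.
Proof.
move=> mA; apply: EFin_inj; rewrite -PrE; last exact: measurableC.
by rewrite probability_setC // PrE.
Qed.

Lemma le_Pr A B : measurable A -> measurable B -> A `<=` B -> Pr A <= Pr B.
Proof. by move=> mA mB AB; rewrite -lee_fin -!PrE // le_measure // inE. Qed.

Lemma PrU A B : measurable A -> measurable B -> Pr (A `|` B) <= Pr A + Pr B.
Proof.
move=> mA mB; rewrite -lee_fin EFinD -!PrE //; last exact: measurableU.
exact: measureU2.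
Qed.

Lemma measurable_bigcup_fin (I : finType) (Q : pred I) (A : I -> set T) :
  (forall i, measurable (A i)) -> measurable (\bigcup_(i in [set i | Q i]) A i).
Proof. by move=> mA; apply: fin_bigcup_measurable => //; exact: finite_finset. Qed.

Lemma measurable_bigcap_fin (I : finType) (Q : pred I) (A : I -> set T) :
  (forall i, measurable (A i)) -> measurable (\bigcap_(i in [set i | Q i]) A i).
Proof. by move=> mA; apply: fin_bigcap_measurable => //; exact: finite_finset. Qed.

Lemma Pr_bigcup (I : finType) (Q : pred I) (A : I -> set T) :
  (forall i, measurable (A i)) ->
  Pr (\bigcup_(i in [set i | Q i]) A i) <= \sum_(i | Q i) Pr (A i).
Proof.
move=> mA.
have -> : \bigcup_(i in [set i | Q i]) A i = \big[setU/set0]_(i <- enum I | Q i) A i.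
  rewrite -bigcup_seq_cond; apply: eq_bigcupl; split => i /=; rewrite mem_enum //.
have -> : \sum_(i | Q i) Pr (A i) = \sum_(i <- enum I | Q i) Pr (A i).
  by rewrite [RHS]big_enum_cond.
elim: (enum I) => [|i s IH]; first by rewrite !big_nil /Pr measure0.
rewrite !big_cons; case: ifP => // Qi.
apply: le_trans (PrU _ _) _ => //; last by rewrite lerD2l.
by apply: bigsetU_measurable.
Qed.

End Prob.

Section Blocks.
Context d (T : measurableType d) (R : realType) (P : probability T R).
Variables (I : finType) (G : I -> T -> R).
Hypothesis mG : forall i, measurable_fun setT (G i).
Hypothesis indep : mutually_independent P G.

(** Cylinder events constraining only the coordinates in [A]: a pi-system on which independence is
    given by the hypothesis, generating the sigma-algebra [sig A]. *)
Definition boxes (A : pred I) : set (set T) := [set E | exists B : I -> set R,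
  [/\ forall i, measurable (B i), forall i, ~~ A i -> B i = setT &
      E = \bigcap_i (G i @^-1` B i)]].

Definition sig (A : pred I) : set (set T) := <<s boxes A >>.

Lemma mpre i (B : set R) : measurable B -> measurable (G i @^-1` B).
Proof. by move=> mB; rewrite -[X in measurable X]setTI; exact: mG. Qed.

Lemma boxes_measurable A : boxes A `<=` measurable.
Proof.
move=> E [B [mB _ ->]]; rewrite -set_true; apply: measurable_bigcap_fin => i.
exact: mpre.
Qed.

Lemma sig_measurable A : sig A `<=` measurable.
Proof. apply: smallest_sub; [exact: sigma_algebra_measurable|exact: boxes_measurable]. Qed.

Lemma boxes_setI A : setI_closed (boxes A).
Proof.
move=> E F [B [mB BT ->]] [C [mC CT ->]]; exists (fun i => B i `&` C i); split.
- by move=> i; exact: measurableI.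
- by move=> i Ai; rewrite BT // CT // setIT.
- by rewrite -bigcapI; apply: eq_bigcapr => i _; rewrite preimage_setI.
Qed.

Lemma boxesT A : boxes A setT.
Proof.
exists (fun=> setT); split => //; apply/esym; rewrite -subTset => t _ i _ //.
Qed.

Lemma Pr_box (B : I -> set R) : (forall i, measurable (B i)) ->
  Pr P (\bigcap_i (G i @^-1` B i)) = \prod_i Pr P (G i @^-1` B i).
Proof.
move=> mB; rewrite /Pr indep //.
rewrite (eq_bigr (fun i => (Pr P (G i @^-1` B i))%:E)); last first.
  by move=> i _; rewrite PrE //; exact: mpre.
by rewrite -(big_morph (op1 := *%E) (op2 := *%R) EFin (@EFinM R) (erefl 1%:E)).
Qed.

(* The product rule is extended from boxes to sigma-algebras one block at a
   time, by uniqueness of measures on a pi-system. *)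
Lemma block_indep (K : finType) (beta : I -> K) (E : K -> set T) :
  (forall k, sig (fun i => beta i == k) (E k)) ->
  Pr P (\bigcap_k E k) = \prod_k Pr P (E k).
Proof.
move=> sE.
(* Induction on the list of blocks whose event is general; outside the list the events are still
   boxes. *)
suff H : forall s : seq K, forall E : K -> set T,
   (forall k, sig (fun i => beta i == k) (E k)) ->
   (forall k, k \notin s -> boxes (fun i => beta i == k) (E k)) ->
   Pr P (\bigcap_k E k) = \prod_k Pr P (E k).
  by apply: (H (enum K)) => // k; rewrite mem_enum.
move=> {E sE}; elim => [|k0 s IH] E sE bE.
  have /choice [B HB] : forall k, exists B : I -> set R,
      [/\ forall i, measurable (B i), forall i, beta i != k -> B i = setT &
      E k = \bigcap_i (G i @^-1` B i)] by move=> k; exact: bE.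
  have -> : \bigcap_k E k = \bigcap_i (G i @^-1` B (beta i) i).
    apply/seteqP; split => t h.
      by move=> i _; have := h (beta i) Logic.I; case: (HB (beta i)) => _ _ ->; apply.
    move=> k _; case: (HB k) => _ BT -> i _.
    have [<-|ne] := eqVneq (beta i) k; first exact: h.
    by rewrite BT.
  rewrite Pr_box; last by move=> i; case: (HB (beta i)).
  rewrite (partition_big beta predT) //=; apply: eq_bigr => k _.
  case: (HB k) => mB BT ->; rewrite Pr_box // [RHS](bigID (fun i => beta i == k)) /=.
  rewrite [X in _ = _ * X]big1 ?mulr1; last by move=> i ik; rewrite BT // preimage_setT PrT.
  by apply: eq_bigr => i /eqP ->.
have mE k : measurable (E k) by apply: sig_measurable (sE k).
pose H := \bigcap_(k in [set k | k != k0]) E k.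
have mH : measurable H by apply: measurable_bigcap_fin.
have EH (A : set T) : \bigcap_k (if k == k0 then A else E k) = A `&` H.
  apply/seteqP; split => t h.
    split; first by have := h k0 Logic.I; rewrite eqxx.
    by move=> k /= kk; have := h k Logic.I; rewrite (negPf kk).
  by move=> k _; case: eqP => [_|/eqP kk]; [exact: h.1|exact: h.2].
pose c := \prod_(k | k != k0) Pr P (E k).
have c0 : 0 <= c by apply: prodr_ge0 => k _; exact: Pr_ge0.
(* The restriction of [P] to [H] and the multiple [c] of [P] are finite measures that agree on boxes
   by the induction hypothesis, hence on the sigma-algebra of the block [k0]. *)
have key A : sig (fun i => beta i == k0) A -> P (A `&` H) = (c%:E * P A)%E.
  apply: (@g_sigma_algebra_measure_unique _ R T (boxes (fun i => beta i == k0))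
    (@boxes_measurable _) (fun=> setT) (fun=> @boxesT _) _ (mrestr P mH) (mscale (NngNum c0) P)).
  - by rewrite bigcup_const.
  - exact: boxes_setI.
  - move=> {}A bA; rewrite /= /mrestr /mscale /= -EH.
    have mA : measurable A by apply: boxes_measurable bA.
    pose E' k := if k == k0 then A else E k.
    have sE' k : sig (fun i => beta i == k) (E' k).
      by rewrite /E'; case: eqP => [->|//]; exact: sub_sigma_algebra.
    have mE' k : measurable (E' k) by apply: sig_measurable (sE' k).
    rewrite PrE; last by rewrite -set_true; apply: measurable_bigcap_fin.
    rewrite [P A]PrE // -EFinM; congr EFin.
    rewrite IH //.
      rewrite (bigD1 k0) //= eqxx mulrC; congr (_ * _).
      by apply: eq_bigr => k /negPf ->.
    move=> k ks; rewrite /E'; case: (eqVneq k k0) => [->|kk] //.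
    by apply: bE; rewrite inE negb_or kk.
  - by move=> k; rewrite /= /mrestr setTI; apply: le_lt_trans (probability_le1 P mH) _; rewrite ltry.
have -> : \bigcap_k E k = E k0 `&` H.
  by rewrite -EH; apply: eq_bigcapr => k _; case: eqP => [->|].
by rewrite /Pr key // [P (E k0)]PrE // -EFinM /= (bigD1 k0) //= mulrC.
Qed.

End Blocks.

(** * Integration against a density *)

Section Density.
Context d (T : measurableType d) (R : realType).
Variables (mu nu : {measure set T -> \bar R}) (p : T -> R).
Hypothesis p0 : forall x, 0 <= p x.
Hypothesis mp : measurable_fun setT p.
Hypothesis nuE : forall B, measurable B -> nu B = (\int[mu]_(x in B) (p x)%:E)%E.

Let integral_density_indic E : measurable E ->
  (\int[nu]_x (\1_E x)%:E = \int[mu]_x ((\1_E x)%:E * (p x)%:E))%E.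
Proof.
move=> mE; rewrite integral_indic//= setIT nuE // integral_mkcond.
apply: eq_integral => x _; rewrite patchE indicE.
by case: ifP => _; rewrite ?mul1e ?mul0e.
Qed.

Import HBNNSimple.

Let integral_density_nnsfun (f : {nnsfun T >-> R}) :
  (\int[nu]_x (f x)%:E = \int[mu]_x ((f x)%:E * (p x)%:E))%E.
Proof.
under [LHS]eq_integral do rewrite fimfunE -fsumEFin//.
rewrite [LHS]ge0_integral_fsum//; last 2 first.
  - by move=> r; exact/measurable_EFinP/measurableT_comp.
  - by move=> n x _; rewrite EFinM nnfun_muleindic_ge0.
under [RHS]eq_integral.
  move=> x xD; rewrite fimfunE -fsumEFin// muleC ge0_mule_fsumr; last first.
    by move=> r; rewrite EFinM nnfun_muleindic_ge0.
  over.
rewrite [RHS]ge0_integral_fsum//; last 2 first.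
  - move=> r; apply: emeasurable_funM; first exact/measurable_EFinP.
    by apply/measurable_EFinP; do 2 apply/measurableT_comp => //.
  - move=> n x _; rewrite EFinM mule_ge0//; first by rewrite lee_fin.
    by rewrite nnfun_muleindic_ge0.
apply: eq_fsbigr => r _.
rewrite integralZl_indic_nnsfun// integral_density_indic//.
have [r0|r0] := leP 0 r; last first.
  rewrite preimage_nnfun0 // [X in (_ * X)%E]integral0_eq => [|x _]; last by rewrite indic0 mul0e.
  by rewrite mule0; apply/esym; apply: integral0_eq => x _; rewrite indic0 mulr0 mule0.
rewrite -ge0_integralZl //.
- by apply: eq_integral => x _; rewrite EFinM muleA muleC.
- apply: emeasurable_funM; last exact/measurable_EFinP.
  by apply/measurable_EFinP.
- by move=> x _; rewrite mule_ge0 ?lee_fin.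
Qed.

(** The hypothesis [nuE] settles indicators; simple functions follow by linearity and the general
    case by monotone convergence on both sides. *)
Lemma ge0_integral_density (f : T -> \bar R) : measurable_fun setT f ->
  (forall x, 0 <= f x)%E -> (\int[nu]_x f x = \int[mu]_x (f x * (p x)%:E))%E.
Proof.
move=> mf f0; pose f_ := nnsfun_approx measurableT mf.
transitivity (lim (\int[nu]_x (f_ n x)%:E @[n --> \oo])%E).
  rewrite -monotone_convergence//=.
  - apply: eq_integral => ? /[!inE] xD; apply/esym/cvg_lim => //=.
    exact: cvg_nnsfun_approx.
  - by move=> n; exact/measurable_EFinP/measurable_funTS.
  - by move=> n ? _; rewrite lee_fin.
  - by move=> ? _ ? ? mn; rewrite lee_fin; exact/lefP/nd_nnsfun_approx.
transitivity (lim (\int[mu]_x ((f_ n x)%:E * (p x)%:E) @[n --> \oo])%E).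
  by apply: congr_lim; apply/funext => n /=; exact: integral_density_nnsfun.
rewrite -monotone_convergence//=.
- apply: eq_integral => x _; apply/cvg_lim => //.
  under eq_fun do rewrite muleC.
  rewrite muleC; apply: cvgeZl => //; exact: cvg_nnsfun_approx.
- by move=> n; apply: emeasurable_funM; exact/measurable_EFinP.
- by move=> n x _; rewrite mule_ge0 ?lee_fin.
- by move=> x _ a b ab; rewrite lee_pmul ?lee_fin //; exact/lefP/nd_nnsfun_approx.
Qed.

End Density.

(** Completing the square turns [expR (t * x)] times the density of mean 0 into a constant times the
    density of mean [t * s ^ 2], whose integral is 1. *)
Lemma normal_mgf (R : realType) (s t : R) : s != 0 ->
  (\int[normal_prob 0 s]_x (expR (t * x))%:E = (expR (t ^+ 2 * s ^+ 2 / 2))%:E)%E.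
Proof.
move=> s0.
have mexp : measurable_fun setT (fun x : R => (expR (t * x))%:E).
  apply/measurable_EFinP; apply: measurableT_comp => //; exact: mulrl_measurable.
rewrite (@ge0_integral_density _ _ R lebesgue_measure (normal_prob 0 s) (normal_pdf 0 s)) //;
  last 2 first.
- by move=> x; exact: normal_pdf_ge0.
- exact: measurable_normal_pdf.
have -> : (\int[lebesgue_measure]_x ((expR (t * x))%:E * (normal_pdf 0 s x)%:E) =
  \int[lebesgue_measure]_x ((expR (t ^+ 2 * s ^+ 2 / 2))%:E * (normal_pdf (t * s ^+ 2) s x)%:E))%E.
  apply: eq_integral => x _; rewrite -!EFinM !normal_pdfE // mulrCA [in RHS]mulrCA; congr (_ * _)%:E.
  rewrite /normal_fun -!expRD; congr expR; field.
  by rewrite s0.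
rewrite ge0_integralZl //; last 2 first.
- by apply/measurable_EFinP; exact: measurable_normal_pdf.
- by move=> x _; rewrite lee_fin normal_pdf_ge0.
by rewrite integral_normal_pdf mule1.
Qed.
Section Gauss.
Context d (T : measurableType d) (R : realType) (P : probability T R).
Variables (I : finType) (G : I -> T -> R) (v : I -> R).
Hypothesis mG : forall i, measurable_fun setT (G i).
Hypothesis indep : mutually_independent P G.
Hypothesis mgf : forall i t,
  (\int[P]_w (expR (t * G i w))%:E = (expR (t ^+ 2 * v i / 2))%:E)%E.

Definition smeas (A : pred I) (f : T -> R) :=
  @measurable_fun _ _ (g_sigma_algebraType (boxes G A)) R setT f.

Lemma smeas_sig A f (B : set R) : smeas A f -> measurable B -> sig G A (f @^-1` B).
Proof. by move=> mf mB; rewrite -[X in sig _ _ X]setTI; exact: mf. Qed.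

Lemma smeas_measurable A f : smeas A f -> measurable_fun setT f.
Proof.
move=> mf _ B mB; rewrite setTI; apply: (sig_measurable mG (A := A)).
exact: smeas_sig.
Qed.

Lemma smeas_G (A : pred I) i : A i -> smeas A (G i).
Proof.
move=> Ai _ B mB; rewrite setTI; apply: sub_sigma_algebra.
exists (fun j => if j == i then B else setT); split.
- by move=> j; case: ifP.
- by move=> j; case: eqP => // ->; rewrite Ai.
- apply/seteqP; split => w h.
    by move=> j _; case: eqP => // ->.
  by have := h i Logic.I; rewrite eqxx.
Qed.

Lemma smeas_lin (A : pred I) (c : I -> R) : (forall i, ~~ A i -> c i = 0) ->
  smeas A (fun w => \sum_i c i * G i w).
Proof.
move=> cA; apply: measurable_sum => i.
have [Ai|Ai] := boolP (A i).
  by apply: measurable_funM => //; exact: smeas_G.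
rewrite cA //; under eq_fun do rewrite mul0r; exact: measurable_cst.
Qed.

(** [X] and [Y] depend on complementary coordinates, so by [block_indep] their joint law is the
    product of the marginal laws, and Tonelli applies. *)
Lemma indep_integral (A : pred I) (X Y : T -> R) :
  smeas (fun i => A i == true) X -> smeas (fun i => A i == false) Y ->
  (forall w, 0 <= X w) -> (forall w, 0 <= Y w) ->
  (\int[P]_w (X w * Y w)%:E = (\int[P]_w (X w)%:E) * (\int[P]_w (Y w)%:E))%E.
Proof.
move=> sX sY X0 Y0.
have mX := smeas_measurable sX; have mY := smeas_measurable sY.
have mXY : measurable_fun setT (fun w => (X w, Y w)) by exact: measurable_fun_pair.
have iX (B C : set R) : measurable B -> measurable C ->
    P (X @^-1` B `&` Y @^-1` C) = (P (X @^-1` B) * P (Y @^-1` C))%E.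
  move=> mB mC.
  have sE b : sig G (fun i => A i == b) (if b then X @^-1` B else Y @^-1` C).
    by case: b; exact: smeas_sig.
  have := block_indep mG indep sE.
  rewrite /index_enum; rewrite big_bool /= => h.
  have mB' : measurable (X @^-1` B) by rewrite -[X in measurable X]setTI; exact: mX.
  have mC' : measurable (Y @^-1` C) by rewrite -[X in measurable X]setTI; exact: mY.
  rewrite [P (X @^-1` B)]PrE // [P (Y @^-1` C)]PrE // -EFinM -h -PrE; last first.
    by rewrite -set_true; apply: measurable_bigcap_fin; case.
  congr (P _); apply/seteqP; split => w hw; first by case => _; case: hw.
  by split; [exact: (hw true)|exact: (hw false)].
pose X' : {mfun T >-> R} := HB.pack X (isMeasurableFun.Build _ _ _ _ X mX).
pose Y' : {mfun T >-> R} := HB.pack Y (isMeasurableFun.Build _ _ _ _ Y mY).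
pose XY' : {mfun T >-> (R * R)%type} := HB.pack (fun w => (X w, Y w))
  (isMeasurableFun.Build _ _ _ _ (fun w => (X w, Y w)) mXY).
(* The absolute values make the integrand nonnegative on the whole plane; they disappear on the
   values of [X] and [Y]. *)
pose f (z : R * R) : \bar R := (`|z.1| * `|z.2|)%:E.
have mf : measurable_fun setT f.
  apply/measurable_EFinP; apply: measurable_funM; exact: measurableT_comp.
have f0 z : (0 <= f z)%E by rewrite lee_fin mulr_ge0.
transitivity (\int[distribution P XY']_z f z)%E.
  rewrite ge0_integral_distribution //; apply: eq_integral => w _ /=.
  by rewrite /f /= !ger0_norm.
transitivity (\int[distribution P X' \x distribution P Y']_z f z)%E.
  apply: eq_measure_integral => E mE _; apply/esym.
  apply: (product_measure_unique (m' := distribution P XY')) => //.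
rewrite fubini_tonelli1 // /fubini_F.
have -> : (\int[P]_w (X w)%:E = \int[distribution P X']_x (`|x|)%:E)%E.
  rewrite ge0_integral_distribution //; last by apply/measurable_EFinP; exact: normr_measurable.
  by apply: eq_integral => w _ /=; rewrite ger0_norm.
have -> : (\int[P]_w (Y w)%:E = \int[distribution P Y']_y (`|y|)%:E)%E.
  rewrite ge0_integral_distribution //; last by apply/measurable_EFinP; exact: normr_measurable.
  by apply: eq_integral => w _ /=; rewrite ger0_norm.
under eq_integral => x _.
  rewrite /f /=; under eq_integral => y _ do rewrite EFinM.
  rewrite ge0_integralZl //; last by apply/measurable_EFinP; exact: normr_measurable.
  over.
rewrite /= ge0_integralZr //.
- by apply/measurable_EFinP; exact: normr_measurable.
- by apply: integral_ge0 => y _; rewrite lee_fin.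
Qed.

Definition lin (c : I -> R) (w : T) : R := \sum_i c i * G i w.

Lemma measurable_lin c : measurable_fun setT (lin c).
Proof. by apply: measurable_sum => i; apply: measurable_funM. Qed.

Lemma measurable_expR_lin c : measurable_fun setT (fun w => (expR (lin c w))%:E).
Proof. by apply/measurable_EFinP; apply: measurableT_comp => //; exact: measurable_lin. Qed.

(** Variables are split off one at a time: the induction is on a list containing the support of the
    coefficients, and [c'] removes the coordinate [i0]. *)
Lemma lin_mgf (c : I -> R) :
  (\int[P]_w (expR (lin c w))%:E = (expR (2^-1 * \sum_i v i * c i ^+ 2))%:E)%E.
Proof.
suff H (s : seq I) : uniq s -> forall c : I -> R, (forall i, i \notin s -> c i = 0) ->
    (\int[P]_w (expR (lin c w))%:E = (expR (2^-1 * \sum_i v i * c i ^+ 2))%:E)%E.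
  by apply: (H (enum I)) => [|i]; rewrite ?enum_uniq // mem_enum.
elim: s => [|i0 s IH] /=.
  move=> _ {}c c0; rewrite big1 => [|i _]; last by rewrite c0 // expr0n mulr0.
  rewrite mulr0 expR0 (eq_integral (fun=> 1%E)) => [|w _]; last first.
    by rewrite /lin big1 ?expR0 // => i _; rewrite c0 // mul0r.
  rewrite integral_cst // mul1e; exact: probability_setT.
case/andP=> i0s us {}c c0.
pose c' i := if i == i0 then 0 else c i.
have E w : lin c w = c i0 * G i0 w + lin c' w.
  rewrite /lin (bigD1 i0) //= [in RHS](bigD1 i0) //= /c' eqxx mul0r add0r; congr (_ + _).
  by apply: eq_bigr => i /negPf ->.
under eq_integral => w _ do rewrite E expRD.
rewrite (@indep_integral (fun i => i == i0)).
- rewrite mgf IH //; last first.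
    by move=> i si; rewrite /c'; case: eqP => // /eqP ii; apply: c0; rewrite inE negb_or ii.
  rewrite -EFinM -expRD; congr (expR _)%:E.
  rewrite (bigD1 i0) //= [in RHS](bigD1 i0) //= /c' eqxx expr0n mulr0 add0r mulrDr.
  congr (_ + _); first by field.
  by congr (_ * _); apply: eq_bigr => i /negPf ->.
- apply: measurableT_comp => //.
  by apply: measurable_funM => //; apply: smeas_G; rewrite eqxx.
- apply: measurableT_comp => //; apply: smeas_lin => i.
  by rewrite eqbF_neg negbK /c' => ->.
- by move=> w; exact: expR_ge0.
- by move=> w; exact: expR_ge0.
Qed.

End Gauss.

Lemma expR1_ge2 (R : realType) : 2 <= expR (1 : R).
Proof. by have := expR_ge1Dx (1 : R); rewrite -natr1 /=; lra. Qed.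

(** * Counts of independent events *)

Section Count.
Context d (T : measurableType d) (R : realType) (P : probability T R).
Variables (I : finType) (G : I -> T -> R).
Hypothesis mG : forall i, measurable_fun setT (G i).
Hypothesis indep : mutually_independent P G.
Variables (K : finType) (beta : I -> K) (E : K -> set T) (p : R).
Hypothesis sE : forall k, sig G (fun i => beta i == k) (E k).
Hypothesis pE : forall k, p <= Pr P (E k).

Definition atom (S : {set K}) : set T := \bigcap_k (if k \in S then E k else ~` E k).

(** Fewer than a quarter of the guaranteed mean number [p * #|K|] of events occur. Writing this as a
    finite union of atoms gives both measurability and a finite sum to estimate. *)
Definition few : set T :=
  \bigcup_(S in [set S : {set K} | #|S|%:R < p * #|K|%:R / 4]) atom S.

Lemma not_few w : (~` few) w ->
  p * #|K|%:R / 4 <= #|[set k | `[< E k w >]]%SET|%:R.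
Proof.
move=> nf; rewrite leNgt; apply/negP => lt; apply: nf.
exists [set k | `[< E k w >]]%SET => //= k _.
by rewrite inE; case: asboolP.
Qed.

Let sEC k (b : bool) : sig G (fun i => beta i == k) (if b then E k else ~` E k).
Proof.
case: b => //=; rewrite /sig -setTD.
by have [_ h _] := smallest_sigma_algebra setT (boxes G (fun i => beta i == k)); apply: h; exact: sE.
Qed.

Lemma measurable_atom S : measurable (atom S).
Proof.
rewrite /atom -set_true; apply: measurable_bigcap_fin => k.
exact: (sig_measurable mG (@sEC k (k \in S))).
Qed.

Lemma measurable_few : measurable few.
Proof. by apply: measurable_bigcup_fin => S; exact: measurable_atom. Qed.

(* Exponential Markov inequality: each atom with [#|S| < x] is weighted by
   [expR (x - #|S|)], after which the sum over all [S] factorizes. *)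
Lemma Pr_few : Pr P few <= expR (- (p * #|K|%:R / 4)).
Proof.
set x := p * _ / 4.
have mE k : measurable (E k) by exact: (sig_measurable mG (@sE k)).
apply: le_trans (Pr_bigcup P (fun S : {set K} => #|S|%:R < x) measurable_atom) _.
pose q k := Pr P (E k).
have atE S : Pr P (atom S) = \prod_k (if k \in S then q k else 1 - q k).
  rewrite /atom (block_indep mG indep (beta := beta)); last by move=> k; exact: (@sEC k (k \in S)).
  by apply: eq_bigr => k _; case: ifP => // _; rewrite PrC.
have q01 k : 0 <= q k <= 1 by rewrite Pr_ge0 Pr_le1.
have e0 : 0 < (expR (- (1 : R))) by exact: expR_gt0.
have e2 : expR (- (1 : R)) <= 2^-1 by rewrite expRN lef_pV2 ?posrE ?expR_gt0 // expR1_ge2.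
have term (S : {set K}) : #|S|%:R < x -> Pr P (atom S) <=
    expR x * \prod_k (if k \in S then expR (- 1) * q k else 1 - q k).
  move=> Sx; rewrite atE.
  have -> : \prod_k (if k \in S then expR (- 1) * q k else 1 - q k) =
     expR (- #|S|%:R) * \prod_k (if k \in S then q k else 1 - q k).
    have -> : expR (- #|S|%:R) = \prod_k (if k \in S then expR (-1) else 1) :> R.
      rewrite -big_mkcond /= prodr_const -expRM_natl; congr expR.
      by rewrite mulrN1.
    rewrite -big_split /=; apply: eq_bigr => k _.
    by case: ifP => // _; rewrite mul1r.
  rewrite mulrA -expRD ler_peMl //; last by apply: le_trans (expR_ge1Dx _); lra.
  by apply: prodr_ge0 => k _; have /andP[h1 h2] := q01 k; case: ifP => // _; rewrite subr_ge0.
apply: le_trans (ler_sum _ term) _.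
apply: (@le_trans _ _ (\sum_(S : {set K}) expR x * \prod_k (if k \in S then expR (- 1) * q k else 1 - q k))).
  rewrite [leLHS]big_mkcond; apply: ler_sum => S _; case: ifP => // _.
  rewrite mulr_ge0 ?expR_ge0 //; apply: prodr_ge0 => k _; have /andP[h1 h2] := q01 k.
  by case: ifP => _; rewrite ?subr_ge0 // mulr_ge0 ?expR_ge0.
rewrite -mulr_sumr.
have -> : \sum_(S : {set K}) \prod_k (if k \in S then expR (- 1) * q k else 1 - q k) =
    \prod_k (expR (-1) * q k + (1 - q k)).
  by rewrite bigA_distr; apply: eq_bigl => S; rewrite inE.
(* Each factor is at most [1 - q k / 2 <= expR (- (p / 2))]; together they give [expR (- 2 x)], of
   which the weight [expR x] consumes half the exponent. *)
have -> : expR (- x) = expR x * \prod_(k : K) expR (- (p / 2)).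
  rewrite prodr_const -expRM_natl -expRD; congr expR; rewrite /x cardE -cardT; by field.
rewrite ler_pM2l ?expR_gt0 //; apply: ler_prod => k _.
have /andP[h1 h2] := q01 k; have := pE k; rewrite -/(q k) => h3.
apply/andP; split; first by rewrite addr_ge0 ?subr_ge0 // mulr_ge0 // ltW.
apply: le_trans (expR_ge1Dx _); nra.
Qed.

End Count.

(** * Tails and tilting of Gaussian forms *)

Section Exponentials.
Context d (T : measurableType d) (R : realType) (P : probability T R).
Variables (I : finType) (G : I -> T -> R) (v : I -> R).
Hypothesis mG : forall i, measurable_fun setT (G i).
Hypothesis indep : mutually_independent P G.
Hypothesis mgf : forall i t,
  (\int[P]_w (expR (t * G i w))%:E = (expR (t ^+ 2 * v i / 2))%:E)%E.

Definition cov (x y : I -> R) : R := \sum_i v i * (x i * y i).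
(** Combinations of exponentials of linear forms have explicit expectations. A pointwise comparison
    of an indicator with such a combination therefore becomes a bound on a probability, from above
    in [Pr_upper] and from below in [Pr_lower]. *)
Definition expsum (s : seq (R * (I -> R))) (w : T) : R :=
  \sum_(k <- s) k.1 * expR (lin G k.2 w).
Definition expsumE (s : seq (R * (I -> R))) : R :=
  \sum_(k <- s) k.1 * expR (2^-1 * cov k.2 k.2).

Lemma lin_mgf_cov c : (\int[P]_w (expR (lin G c w))%:E = (expR (2^-1 * cov c c))%:E)%E.
Proof.
exact: (lin_mgf mG indep mgf).
Qed.

Lemma measurable_expsum s : measurable_fun setT (expsum s).
Proof.
by apply: measurable_sum => k; apply: measurable_funM => //; apply: measurableT_comp => //; exact: measurable_lin.
Qed.

Lemma integral_expsum s : (forall k, k \in map fst s -> 0 <= k) ->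
  (\int[P]_w (expsum s w)%:E = (expsumE s)%:E)%E.
Proof.
elim: s => [|[a c] s IH] h.
  rewrite /expsumE big_nil; apply: integral0_eq => w _; by rewrite /expsum big_nil.
have a0 : 0 <= a by apply: h; rewrite inE eqxx.
have s0 k : k \in map fst s -> 0 <= k by move=> ks; apply: h; rewrite inE ks orbT.
have pos w : 0 <= expsum s w.
  rewrite /expsum big_seq; apply: sumr_ge0 => k ks; rewrite mulr_ge0 ?expR_ge0 // s0 //.
  exact: map_f.
rewrite /expsumE big_cons -/(expsumE s) /= EFinD -IH // EFinM -lin_mgf_cov.
rewrite -ge0_integralZl //; last by exact: measurable_expR_lin.
rewrite -ge0_integralD //.
- by apply: eq_integral => w _; rewrite /expsum big_cons /= EFinD EFinM.
- by move=> w _; rewrite -EFinM lee_fin mulr_ge0 ?expR_ge0.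
- by apply: emeasurable_funM => //; exact: measurable_expR_lin.
- by move=> w _; rewrite lee_fin.
- by apply/measurable_EFinP; exact: measurable_expsum.
Qed.

Lemma Pr_indic (A : set T) : measurable A -> (\int[P]_w (\1_A w)%:E = (Pr P A)%:E)%E.
Proof. by move=> mA; rewrite integral_indic // setIT; exact: PrE. Qed.

Lemma Pr_upper A s : measurable A -> (forall k, k \in map fst s -> 0 <= k) ->
  (forall w, A w -> 1 <= expsum s w) -> Pr P A <= expsumE s.
Proof.
move=> mA s0 h.
have pos w : 0 <= expsum s w.
  rewrite /expsum big_seq; apply: sumr_ge0 => k ks; rewrite mulr_ge0 ?expR_ge0 // s0 //.
  exact: map_f.
rewrite -lee_fin -Pr_indic // -integral_expsum //; apply: ge0_le_integral => //.
- by apply/measurable_EFinP; exact: measurable_indic.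
- by apply/measurable_EFinP; exact: measurable_expsum.
- move=> w _; rewrite lee_fin indicE; have [|] := boolP (w \in A); last by [].
  by rewrite inE => /h.
Qed.

Lemma Pr_lower A (c : I -> R) (a : R) s : measurable A -> (forall k, k \in map fst s -> 0 <= k) ->
  0 <= a -> (forall w, a * expR (lin G c w) <= \1_A w + expsum s w) ->
  a * expR (2^-1 * cov c c) <= Pr P A + expsumE s.
Proof.
move=> mA s0 a0 h.
have pos w : 0 <= expsum s w.
  rewrite /expsum big_seq; apply: sumr_ge0 => k ks; rewrite mulr_ge0 ?expR_ge0 // s0 //.
  exact: map_f.
rewrite -lee_fin EFinD EFinM -lin_mgf_cov -Pr_indic // -integral_expsum //.
rewrite -ge0_integralZl //; last by exact: measurable_expR_lin.
rewrite -ge0_integralD //.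
- apply: ge0_le_integral => //.
  + by move=> w _; rewrite -EFinM lee_fin mulr_ge0 ?expR_ge0.
  + by apply: emeasurable_funM => //; exact: measurable_expR_lin.
  + apply: emeasurable_funD; apply/measurable_EFinP; first exact: measurable_indic.
    exact: measurable_expsum.
  + by move=> w _; rewrite -EFinM -EFinD lee_fin.
- by apply/measurable_EFinP; exact: measurable_indic.
- by move=> w _; rewrite lee_fin.
- by apply/measurable_EFinP; exact: measurable_expsum.
Qed.

Lemma covC x y : cov x y = cov y x.
Proof. by apply: eq_bigr => i _; rewrite (mulrC (x i)). Qed.

Lemma covDl x y z : cov (fun i => x i + y i) z = cov x z + cov y z.
Proof. by rewrite -big_split; apply: eq_bigr => i _; rewrite /=; ring. Qed.

Lemma covZl a x z : cov (fun i => a * x i) z = a * cov x z.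
Proof. by rewrite mulr_sumr; apply: eq_bigr => i _; rewrite /=; ring. Qed.

Lemma covDr x y z : cov z (fun i => x i + y i) = cov z x + cov z y.
Proof. by rewrite covC covDl !(covC z). Qed.

Lemma covZr a x z : cov z (fun i => a * x i) = a * cov z x.
Proof. by rewrite covC covZl (covC z). Qed.

Lemma linD x y w : lin G (fun i => x i + y i) w = lin G x w + lin G y w.
Proof. by rewrite -big_split; apply: eq_bigr => i _; rewrite mulrDl. Qed.

Lemma linZ a x w : lin G (fun i => a * x i) w = a * lin G x w.
Proof. by rewrite mulr_sumr; apply: eq_bigr => i _; rewrite mulrA. Qed.

Lemma lin_tail (c : I -> R) (t : R) : 0 <= t -> cov c c <= 1 ->
  Pr P [set w | t < lin G c w] <= expR (- (t ^+ 2 / 2)).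
Proof.
move=> t0 c1.
have mA : measurable [set w | t < lin G c w].
  by apply: measurable_set_gt => //; exact: measurable_lin.
pose s := [:: (expR (- t ^+ 2), fun i => t * c i)].
apply: le_trans (Pr_upper (s := s) mA _ _) _.
- by move=> k; rewrite !inE => /eqP ->; exact: expR_ge0.
- move=> w /= h; rewrite /expsum big_seq1 /= linZ -expRD -[leLHS]expR0 ler_expR; nra.
- rewrite /expsumE big_seq1 /= covZl covZr -expRD ler_expR; nra.
Qed.

(* Exponential tilting by [l] moves the mean of [lin x] to [cov l x]; the
   four tilted forms are simultaneously within 5 of their new means with
   probability at least 1/2, and Cauchy-Schwarz undoes the tilting. *)
Lemma tilt (l : I -> R) (xs : seq (I -> R)) : (size xs <= 4)%N ->
  all (fun x => `[< cov x x <= 1 >]) xs ->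
  4^-1 * expR (- cov l l) <=
    Pr P [set w | forall j, (j < size xs)%N ->
      `|lin G (nth (fun=> 0) xs j) w - cov l (nth (fun=> 0) xs j)| <= 5].
Proof.
move=> xs4 xs1; set A := [set w | _].
have mA : measurable A.
  have -> : A = \bigcap_(j : 'I_(size xs)) [set w |
      `|lin G (nth (fun=> 0) xs j) w - cov l (nth (fun=> 0) xs j)| <= 5].
    apply/seteqP; split => w h; first by move=> j _; exact: h.
    by move=> j js; exact: (h (Ordinal js)).
  rewrite -set_true; apply: measurable_bigcap_fin => j.
  apply: measurable_set_le => //.
  apply: measurableT_comp => //; apply: measurable_funB => //; exact: measurable_lin.
set q := cov l l.
(* On [A] the comparison is [2 th W <= 1 + th ^ 2 W ^ 2] with [W] the tilting exponential. This [th]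
   makes the left expectation [expR (- q)] and that of the square term [expR (- q) / 4]; the
   penalties take another half, leaving a quarter. *)
pose th := 2^-1 * expR (- (3 / 2 * q)).
have th0 : 0 < th by rewrite mulr_gt0 ?invr_gt0 ?expR_gt0.
(* Off [A] some form deviates from its shifted mean by more than 5, upward or downward, and then its
   [pl] or [mi] term alone dominates [2 th W]. *)
pose pl x := (2 * th * expR (- 5 - cov l x), fun i => l i + x i).
pose mi x := (2 * th * expR (- 5 + cov l x), fun i => l i + (-1) * x i).
pose s := (th ^+ 2, fun i => 2 * l i) :: (map pl xs ++ map mi xs).
have := @Pr_lower A l (2 * th) s mA.
have s0 : forall k, k \in map fst s -> 0 <= k.
  move=> k; rewrite /= inE map_cat mem_cat -!map_comp => /or3P[/eqP ->|/mapP[x _ ->]|/mapP[x _ ->]].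
  - exact: sqr_ge0.
  - by rewrite /= !mulr_ge0 ?expR_ge0 // ltW.
  - by rewrite /= !mulr_ge0 ?expR_ge0 // ltW.
move=> /(_ s0) H.
have th20 : 0 <= 2 * th by rewrite mulr_ge0 // ltW.
have {}H := H th20.
have posp w ys : 0 <= expsum (map pl ys) w.
  rewrite /expsum big_map; apply: sumr_ge0 => x _; by rewrite /= mulr_ge0 ?expR_ge0 // mulr_ge0 ?expR_ge0.
have posm w ys : 0 <= expsum (map mi ys) w.
  rewrite /expsum big_map; apply: sumr_ge0 => x _; by rewrite /= mulr_ge0 ?expR_ge0 // mulr_ge0 ?expR_ge0.
have pt w : 2 * th * expR (lin G l w) <= \1_A w + expsum s w.
  have sE : expsum s w = th ^+ 2 * expR (lin G l w) ^+ 2 + (expsum (map pl xs) w + expsum (map mi xs) w).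
    rewrite {1}/expsum /s big_cons big_cat /=; congr (_ + _).
    by rewrite linZ -expRM_natl.
  rewrite sE indicE; set W := expR (lin G l w).
  have W0 : 0 < W by exact: expR_gt0.
  have pp := posp w xs; have pm := posm w xs.
  have [wA|wA] := boolP (w \in A) => /=.
    have : 0 <= (1 - th * W) ^+ 2 by exact: sqr_ge0.
    nra.
  suff : 2 * th * W <= expsum (map pl xs) w + expsum (map mi xs) w.
    have : 0 <= (th * W) ^+ 2 by exact: sqr_ge0.
    by rewrite exprMn; lra.
  have [j [js jb]] : exists j, (j < size xs)%N /\
      5 < `|lin G (nth (fun=> 0) xs j) w - cov l (nth (fun=> 0) xs j)|.
    apply: contrapT => h; move/negP: wA; apply; rewrite inE /A /= => j js.
    by rewrite leNgt; apply/negP => h'; apply: h; exists j.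
  set x := nth _ xs j in jb.
  have splitp : 2 * th * expR (- 5 - cov l x) * expR (lin G l w + lin G x w) <= expsum (map pl xs) w.
    rewrite -(cat_take_drop j.+1 xs) (take_nth (fun=> 0)) // cat_rcons map_cat.
    rewrite /expsum big_cat big_cons /= linD.
    have := posp w (take j xs); have := posp w (drop j.+1 xs); rewrite /expsum /x; lra.
  have splitm : 2 * th * expR (- 5 + cov l x) * expR (lin G l w - lin G x w) <= expsum (map mi xs) w.
    rewrite -(cat_take_drop j.+1 xs) (take_nth (fun=> 0)) // cat_rcons map_cat.
    rewrite /expsum big_cat big_cons /= linD linZ mulN1r.
    have := posm w (take j xs); have := posm w (drop j.+1 xs); rewrite /expsum /x; lra.
  have t2 : 0 < 2 * th by rewrite mulr_gt0.
  have [h|h] : 5 <= lin G x w - cov l x \/ lin G x w - cov l x <= - 5.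
    move: jb; have [?|?] := leP 0 (lin G x w - cov l x); [rewrite ger0_norm|rewrite ltr0_norm] => //; lra.
  - have : 2 * th * W <= 2 * th * expR (- 5 - cov l x) * expR (lin G l w + lin G x w).
      by rewrite -[leRHS]mulrA -expRD ler_pM2l // ler_expR; lra.
    lra.
  - have : 2 * th * W <= 2 * th * expR (- 5 + cov l x) * expR (lin G l w - lin G x w).
      by rewrite -[leRHS]mulrA -expRD ler_pM2l // ler_expR; lra.
    lra.
have {}H := H pt.
have bnd : expsumE s <= th ^+ 2 * expR (2 * q) + th * expR (2^-1 * q).
  rewrite /expsumE /s big_cons big_cat /= !big_map /= covZl covZr.
  rewrite (_ : 2^-1 * (2 * (2 * cov l l)) = 2 * q); last by rewrite /q; field.
  rewrite lerD2l.
  have one x : x \in xs -> 2 * th * expR (- 5 - cov l x) *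
       expR (2^-1 * cov (fun i => l i + x i) (fun i => l i + x i)) <=
       8^-1 * (th * expR (2^-1 * q)) /\
       2 * th * expR (- 5 + cov l x) *
       expR (2^-1 * cov (fun i => l i + -1 * x i) (fun i => l i + -1 * x i)) <=
       8^-1 * (th * expR (2^-1 * q)).
    move=> /(allP xs1) /asboolP x1.
    (* The exponent of a penalty exceeds [q / 2] by at most [- 5 + 1 / 2]. With at most 8 penalties,
       the bound 1/16 keeps their total below [th * expR (q / 2)]. *)
    have e16 : expR (- 4) <= (16^-1 : R).
      rewrite expRN lef_pV2 ?posrE ?expR_gt0 //.
      have -> : expR (4 : R) = expR 1 ^+ 4 by rewrite -expRM_natl mulr1.
      have e2 := expR1_ge2 R; rewrite (_ : (16 : R) = 2 ^+ 4); last by ring.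
      by rewrite lerXn2r ?nnegrE ?expR_ge0.
    have E4 y z : y + z <= - 4 + 2^-1 * q ->
        2 * th * expR y * expR z <= 8^-1 * (th * expR (2^-1 * q)).
      rewrite -(ler_expR (y + z)) !expRD => h.
      have := expR_gt0 (2^-1 * q) => qq.
      have : expR y * expR z <= 16^-1 * expR (2^-1 * q).
        by apply: le_trans h _; rewrite ler_pM2r.
      have := th0; nra.
    by split; apply: E4; rewrite !covDl !covDr ?covZl ?covZr ?covZl (covC x l) /q; lra.
  apply: (@le_trans _ _ (\sum_(x <- xs) 8^-1 * (th * expR (2^-1 * q)) +
                         \sum_(x <- xs) 8^-1 * (th * expR (2^-1 * q)))).
    by apply: lerD; rewrite big_seq [leRHS]big_seq; apply: ler_sum => x /one [].
  rewrite big_const_seq count_predT iter_addr_0 -mulrnDr -mulr_natl.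
  have : (size xs + size xs)%:R <= (8 : R) by rewrite ler_nat; exact: (leq_add xs4 xs4).
  have : 0 < th * expR (2^-1 * q) by rewrite mulr_gt0 ?expR_gt0.
  nra.
have e1 : th * expR (2^-1 * q) = 2^-1 * expR (- q).
  by rewrite /th -[LHS]mulrA -expRD; congr (_ * expR _); field.
have e2 : th ^+ 2 * expR (2 * q) = 4^-1 * expR (- q).
  rewrite /th exprMn -expRM_natl -[LHS]mulrA -expRD.
  by rewrite (_ : _ + _ = - q); [congr (_ * _); field|field].
move: H bnd; rewrite e2 -mulrA e1.
lra.
Qed.

End Exponentials.

(** * Operator norm on sparse vectors *)

(** Gaussian families are recorded through their moment generating functions and not through their
    laws, so that variables identically 0 are members with variance 0. *)
Definition gfam d (T : measurableType d) (R : realType) (P : probability T R)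
  (I : finType) (G : I -> T -> R) (v : I -> R) : Prop :=
  [/\ forall i, measurable_fun setT (G i), mutually_independent P G,
      forall i t, (\int[P]_w (expR (t * G i w))%:E = (expR (t ^+ 2 * v i / 2))%:E)%E &
      forall i, 0 <= v i <= 1].

Lemma gfam_sub d (T : measurableType d) (R : realType) (P : probability T R)
  (I J : finType) (f : J -> I) (G : I -> T -> R) v : injective f ->
  gfam P G v -> gfam P (fun j => G (f j)) (fun j => v (f j)).
Proof.
move=> fi [mG iG gG vG]; split => //.
move=> B mB; pose B' i := if [pick j | f j == i] is Some j then B j else setT.
have B'f j : B' (f j) = B j.
  rewrite /B'; case: pickP => [j' /eqP /fi -> //|/(_ j)]; by rewrite eqxx.
have B'n i : i \notin codom f -> B' i = setT.
  move=> h; rewrite /B'; case: pickP => // j /eqP e; move: h; rewrite -e codom_f //.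
have := iG B'; rewrite (_ : \bigcap_i (G i @^-1` B' i) = \bigcap_j (G (f j) @^-1` B j)); last first.
  apply/seteqP; split => w h.
    by move=> j _; have := h (f j) Logic.I; rewrite B'f.
  move=> i _; have [/codomP [j ->]|nc] := boolP (i \in codom f).
    by rewrite B'f; exact: h.
  by rewrite B'n.
move=> ->; last first.
  by move=> i; rewrite /B'; case: pickP.
rewrite (bigID (fun i => i \in codom f)) /= [X in (_ * X)%E]big1 ?mule1; last first.
  by move=> i h; rewrite B'n // preimage_setT; exact: probability_setT.
have -> : \big[*%E/1%E]_(i in codom f) P (G i @^-1` B' i) =
   \big[*%E/1%E]_(i <- codom f) P (G i @^-1` B' i).
  rewrite [RHS]big_uniq //; last by rewrite map_inj_uniq ?enum_uniq.
rewrite big_map big_enum /=; apply: eq_bigr => j _; by rewrite B'f.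
Qed.

Section MatVec.
Variables (R : realType) (K N : finType).
Definition mv (M : K -> N -> R) (x : N -> R) : K -> R := fun k => \sum_j M k j * x j.
Definition tmv (M : K -> N -> R) (y : K -> R) : N -> R := fun j => \sum_k y k * M k j.

Lemma dot_mv M x y : dot y (mv M x) = dot (tmv M y) x.
Proof.
rewrite /dot /mv /tmv; under eq_bigr do rewrite mulr_sumr.
rewrite exchange_big /=; apply: eq_bigr => j _; rewrite mulr_suml.
by apply: eq_bigr => k _; rewrite mulrA.
Qed.

Lemma mvD M x y k : mv M (fun j => x j + y j) k = mv M x k + mv M y k.
Proof. by rewrite -big_split; apply: eq_bigr => j _; rewrite mulrDr. Qed.

Lemma mvB M x y k : mv M (fun j => x j - y j) k = mv M x k - mv M y k.
Proof. by rewrite -sumrB; apply: eq_bigr => j _; rewrite mulrBr. Qed.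

Lemma mvZ M a x k : mv M (fun j => a * x j) k = a * mv M x k.
Proof. by rewrite mulr_sumr; apply: eq_bigr => j _; ring. Qed.

Lemma tmvB M x y k : tmv M (fun j => x j - y j) k = tmv M x k - tmv M y k.
Proof. by rewrite -sumrB; apply: eq_bigr => j _; rewrite mulrBl. Qed.

Lemma tmvZ M a x k : tmv M (fun j => a * x j) k = a * tmv M x k.
Proof. by rewrite mulr_sumr; apply: eq_bigr => j _; ring. Qed.

(** Only the finiteness of the factor matters: it makes the supremum in [not_badU] exist. *)
Lemma l2_mv_crude M x : l2 (mv M x) <= (\sum_k \sum_j `|M k j|) * l2 x.
Proof.
apply: (@le_trans _ _ (l1 (mv M x))).
  apply: l2_le; first exact: l1_ge0.
  rewrite /l1 expr2 mulr_suml; apply: ler_sum => k _.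
  rewrite -(real_normK (num_real _)) expr2 ler_wpM2l //.
  by rewrite (bigD1 k) //= lerDl sumr_ge0.
rewrite /l1 mulr_suml; apply: ler_sum => k _; rewrite mulr_suml.
apply: le_trans (ler_norm_sum _ _ _) _; apply: ler_sum => j _.
by rewrite normrM ler_wpM2l // coord_l2.
Qed.

End MatVec.

Section OperatorNorm.
Context d (T : measurableType d) (R : realType) (P : probability T R).
Variables (K N : finType) (G : K * N -> T -> R) (v : K * N -> R).
Hypothesis gG : gfam P G v.
Hypothesis K0 : (0 < #|K|)%N.

Let mG : forall i, measurable_fun setT (G i). Proof. by case: gG. Qed.

Definition Mat (w : T) : K -> N -> R := fun k j => G (k, j) w.
Definition outer (y : K -> R) (x : N -> R) : K * N -> R := fun q => y q.1 * x q.2.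

Lemma lin_outer y x w : lin G (outer y x) w = dot y (mv (Mat w) x).
Proof.
rewrite /dot /mv; under [RHS]eq_bigr do rewrite mulr_sumr.
by rewrite pair_big /=; apply: eq_bigr => -[k j] _; rewrite /outer /Mat /=; ring.
Qed.

Lemma cov_outer_le y x : cov v (outer y x) (outer y x) <= (l2 y * l2 x) ^+ 2.
Proof.
rewrite exprMn !sqr_l2 mulr_suml; under [leRHS]eq_bigr do rewrite mulr_sumr.
rewrite pair_big /=; apply: ler_sum => -[k j] _ /=.
have [_ _ _ /(_ (k, j)) /andP[v0 v1]] := gG.
rewrite /outer /= -expr2 exprMn ler_piMl // mulr_ge0 ?sqr_ge0 //.
Qed.

(** Grid step of a 1/2-net of the unit ball, for which [D = 2 * #|K|] suffices in [net_approx]. *)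
Definition cK := (2^-1 / Num.sqrt #|K|%:R : R).
Definition badV (t : R) (x : N -> R) : set T :=
  \bigcup_(f in [set f : {ffun K -> code (2 * #|K|)} |
     (f \in net K #|K| (2 * #|K|)) && (l2 (pt cK f) <= 1)])
  [set w | t < lin G (outer (pt cK f) x) w].

Lemma measurable_badV t x : measurable (badV t x).
Proof.
by apply: measurable_bigcup_fin => f; apply: measurable_set_gt => //; exact: measurable_lin.
Qed.

Lemma Pr_badV t x : 0 <= t -> l2 x <= 1 ->
  Pr P (badV t x) <= 12 ^+ #|K| * expR (- (t ^+ 2 / 2)).
Proof.
move=> t0 x1; apply: le_trans (Pr_bigcup P _ _) _.
  by move=> f; apply: measurable_set_gt => //; exact: measurable_lin.
have [_ iG mgf v01] := gG.
apply: (@le_trans _ _ (\sum_(f in net K #|K| (2 * #|K|)) expR (- (t ^+ 2 / 2)))).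
  rewrite [leLHS]big_mkcond [leRHS]big_mkcond; apply: ler_sum => f _.
  case: (f \in _) => //=; case: ifP => [f1|_]; last exact: expR_ge0.
  apply: (lin_tail mG iG mgf) => //; apply: le_trans (cov_outer_le _ _) _.
  by rewrite expr_le1 // ?mulr_ge0 ?l2_ge0 // mulr_ile1 ?l2_ge0.
rewrite sumr_const -[leLHS]mulr_natl ler_wpM2r ?expR_ge0 //.
(* With weight 1 the count is [2 ^ (2 K) * 3 ^ K = 12 ^ K], which is enough when the support is
   unrestricted. *)
apply: le_trans (card_net (th := 1) _ _ _ _ _) _ => //.
rewrite invr1 expr1n mul1r exprM -exprMn mulr1.
by rewrite (_ : 2 ^+ 2 * (1 + 2) = 12 :> R) //; ring.
Qed.

(** Replacing the direction of [y] by a net point loses at most half of [l2 y], so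
    [l2 y <= t + l2 y / 2]. *)
Lemma not_badV t x w : 0 <= t -> (~` badV t x) w -> l2 (mv (Mat w) x) <= 2 * t.
Proof.
move=> t0 nb; set y := mv _ x.
have [y0|y0] := eqVneq (l2 y) 0; first by rewrite y0 mulr_ge0.
have yp : 0 < l2 y by rewrite lt_neqAle eq_sym y0 l2_ge0.
pose z k := (l2 y)^-1 * y k.
have z1 : l2 z = 1 by rewrite l2Z ger0_norm ?invr_ge0 ?l2_ge0 // mulVf.
have half : 0 < 2^-1 :> R by rewrite invr_gt0.
have := @net_approx R K #|K| (2 * #|K|) 2^-1 z K0 half.
case.
- by rewrite natrM mulrA mulVf // mul1r.
- by rewrite z1.
- exact: max_card.
move=> f fn /= [e1 e2 _ _].
have H : dot (pt cK f) y <= t.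
  rewrite leNgt; apply/negP => h; apply: nb; exists f.
    by rewrite /= fn /= -z1.
  by rewrite /= lin_outer.
have zy : dot z y = l2 y by rewrite dotZl dot_self expr2 mulrA mulVf // mul1r.
have : dot (fun k => z k - pt cK f k) y <= 2^-1 * l2 y.
  by apply: le_trans (dot_le _ _) _; rewrite ler_wpM2r ?l2_ge0.
rewrite dotBl zy; lra.
Qed.

Definition cN (S : nat) := (2^-1 / Num.sqrt S%:R : R).
Definition badU (S : nat) (t : R) : set T :=
  \bigcup_(g in [set g : {ffun N -> code (2 * S)} |
     (g \in net N S (2 * S)) && (l2 (pt (cN S) g) <= 1)]) badV t (pt (cN S) g).

Lemma measurable_badU S t : measurable (badU S t).
Proof. by apply: measurable_bigcup_fin => g; exact: measurable_badV. Qed.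

Lemma Pr_badU S t th : 0 <= t -> 0 < th <= 1 ->
  Pr P (badU S t) <= th^-1 ^+ S * 2 ^+ (2 * S) * (1 + 2 * th) ^+ #|N| *
    (12 ^+ #|K| * expR (- (t ^+ 2 / 2))).
Proof.
move=> t0 /andP[th0 th1]; apply: le_trans (Pr_bigcup P _ _) _.
  by move=> f; exact: measurable_badV.
set B := 12 ^+ _ * _.
have B0 : 0 <= B by rewrite mulr_ge0 ?exprn_ge0 ?expR_ge0.
apply: (@le_trans _ _ (\sum_(g in net N S (2 * S)) B)).
  rewrite [leLHS]big_mkcond [leRHS]big_mkcond; apply: ler_sum => f _.
  case: (f \in _) => //=; case: ifP => [f1|_] //.
  exact: Pr_badV.
rewrite sumr_const -[leLHS]mulr_natl ler_wpM2r //.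
exact: card_net.
Qed.

(** The supremum over sparse unit vectors is finite, and the error of the 1/2-net is again sparse of
    norm at most 1/2; hence the supremum is at most [2 t] plus half of itself. *)
Lemma not_badU S t w : 0 <= t -> (~` badU S t) w ->
  forall x, (#|supp x| <= S)%N -> l2 (mv (Mat w) x) <= 4 * t * l2 x.
Proof.
move=> t0 nb.
case: (posnP S) => [S0|S0].
  move=> x; rewrite S0 leqn0 cards_eq0 => /eqP x0.
  have -> : l2 (mv (Mat w) x) = 0.
    rewrite /l2 big1 ?sqrtr0 // => k _; rewrite /mv big1 ?expr0n // => j _.
    have : j \notin supp x by rewrite x0 inE.
    by rewrite inE negbK => /eqP ->; rewrite mulr0.
  by rewrite !mulr_ge0 ?l2_ge0.
set A := \sum_k \sum_j `|Mat w k j|.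
pose E := [set l2 (mv (Mat w) x) | x in [set x : N -> R | (#|supp x| <= S)%N /\ l2 x <= 1]].
have A0 : 0 <= A by rewrite sumr_ge0 // => k _; rewrite sumr_ge0.
have Eub : ubound E A.
  move=> _ [x [_ x1] <-]; apply: le_trans (l2_mv_crude _ _) _.
  by rewrite ler_piMr.
have E0 : E !=set0.
  exists (l2 (mv (Mat w) (fun=> 0))); exists (fun=> 0) => //; split.
    by rewrite (_ : supp _ = finset.set0) ?cards0 //; apply/setP => j; rewrite !inE eqxx.
  by rewrite /l2 big1 ?sqrtr0 // => j _; rewrite expr0n.
have Ehs : has_sup E by split => //; exists A.
have half : 0 < 2^-1 :> R by rewrite invr_gt0.
have step x : (#|supp x| <= S)%N -> l2 x <= 1 -> l2 (mv (Mat w) x) <= 2 * t + 2^-1 * sup E.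
  move=> sx x1.
  have [|f fn /= [e1 e2 _ e4]] := @net_approx R N S (2 * S) 2^-1 x S0 half _ x1 sx.
    by rewrite natrM mulrA mulVf // mul1r.
  set y := pt _ f in e1 e2 e4.
  have Hy : l2 (mv (Mat w) y) <= 2 * t.
    apply: not_badV => // h; apply: nb; exists f => //=; rewrite fn /=.
    exact: le_trans e2 x1.
  have Hr : l2 (mv (Mat w) (fun j => 2 * (x j - y j))) <= sup E.
    apply: ub_le_sup; first by exists A.
    exists (fun j => 2 * (x j - y j)) => //; split.
      apply: leq_trans e4; apply: subset_leq_card; apply/fintype.subsetP => j; rewrite !inE.
      by apply: contra => /eqP ->; rewrite mulr0.
    rewrite l2Z ger0_norm //; have := e1; rewrite /y; lra.
  have -> : l2 (mv (Mat w) x) = l2 (fun k => mv (Mat w) y k + 2^-1 * mv (Mat w) (fun j => 2 * (x j - y j)) k).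
    apply: eq_l2 => k; rewrite mvZ mvB; by field.
  apply: le_trans (l2D _ _) _; rewrite l2Z ger0_norm ?invr_ge0 //.
  by apply: lerD => //; rewrite ler_pM2l.
have s4 : sup E <= 4 * t.
  have : sup E <= 2 * t + 2^-1 * sup E.
    by apply: ge_sup => // _ [x [h1 h2] <-]; exact: step.
  lra.
move=> x sx.
have [x0|x0] := eqVneq (l2 x) 0.
  apply: le_trans (l2_mv_crude _ _) _; by rewrite x0 !mulr0.
have xp : 0 < l2 x by rewrite lt_neqAle eq_sym x0 l2_ge0.
have := step (fun j => (l2 x)^-1 * x j).
rewrite l2Z ger0_norm ?invr_ge0 ?l2_ge0 // mulVf // => /(_ _ (lexx _)) H.
have : l2 (mv (Mat w) (fun j => (l2 x)^-1 * x j)) <= 4 * t.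
  apply: (@le_trans _ _ (2 * t + 2^-1 * sup E)); last by lra.
  apply: H; apply: leq_trans sx; apply: subset_leq_card; apply/fintype.subsetP => j; rewrite !inE.
  by apply: contra => /eqP ->; rewrite mulr0.
have -> : l2 (mv (Mat w) (fun j => (l2 x)^-1 * x j)) = (l2 x)^-1 * l2 (mv (Mat w) x).
  rewrite -[X in _ = X * _]ger0_norm ?invr_ge0 ?l2_ge0 // -l2Z; apply: eq_l2 => k; exact: mvZ.
by rewrite mulrC ler_pdivrMr.
Qed.

End OperatorNorm.

(** * Correlation with the columns of a wide matrix *)

Lemma le_expR_nat (R : realType) (b k n : nat) : (b <= 2 ^ k)%N ->
  (b%:R : R) ^+ n <= expR (k%:R * n%:R).
Proof.
move=> bk; rewrite mulrC expRM_natl lerXn2r ?nnegrE ?expR_ge0 //.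
rewrite -[k%:R]mulr1 expRM_natl; apply: (@le_trans _ _ (2 ^+ k)).
  by rewrite -natrX ler_nat.
by rewrite lerXn2r ?nnegrE ?expR_ge0 // expR1_ge2.
Qed.

Section Quotient.
Context d (T : measurableType d) (R : realType) (P : probability T R).
Variables (K N : finType) (G : K * N -> T -> R) (v : K * N -> R).
Hypothesis gG : gfam P G v.
Hypothesis v2 : forall q, 2^-1 <= v q.
Hypothesis K0 : (0 < #|K|)%N.

Let mG : forall i, measurable_fun setT (G i). Proof. by case: gG. Qed.
Let iG : mutually_independent P G. Proof. by case: gG. Qed.

Definition colform (y : K -> R) (j : N) : K * N -> R :=
  fun q => if q.2 == j then y q.1 else 0.

Lemma sum_col (F : K * N -> R) j :
  \sum_q (if q.2 == j then F q else 0) = \sum_k F (k, j).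
Proof.
transitivity (\sum_k \sum_j' (if j' == j then F (k, j') else 0)).
  by rewrite pair_big /=; apply: eq_bigr => -[k j'].
by apply: eq_bigr => k _; rewrite -big_mkcond big_pred1_eq.
Qed.

Lemma lin_colform y j w : lin G (colform y j) w = tmv (Mat G w) y j.
Proof.
rewrite /tmv -(sum_col (fun q => y q.1 * Mat G w q.1 q.2)); apply: eq_bigr => -[k j'] _.
by rewrite /colform /=; case: eqP => [->|_]; rewrite ?mul0r.
Qed.

Lemma cov_colform y j : 2^-1 * l2 y ^+ 2 <= cov v (colform y j) (colform y j) <= l2 y ^+ 2.
Proof.
have -> : cov v (colform y j) (colform y j) = \sum_k v (k, j) * y k ^+ 2.
  rewrite -(sum_col (fun q => v q * y q.1 ^+ 2)); apply: eq_bigr => -[k j'] _.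
  by rewrite /colform /=; case: eqP => _; rewrite ?mulr0 ?expr2.
have [_ _ _ v01] := gG; rewrite sqr_l2 mulr_sumr; apply/andP; split; apply: ler_sum => k _.
  by rewrite ler_wpM2r ?sqr_ge0.
by rewrite ler_piMl ?sqr_ge0 //; case/andP: (v01 (k, j)).
Qed.

Definition colE (a : R) (y : K -> R) (j : N) : set T := [set w | a <= lin G (colform y j) w].

Lemma sig_colE a y j : sig G (fun q => q.2 == j) (colE a y j).
Proof.
apply: (@measurable_set_ge _ (g_sigma_algebraType (boxes G (fun q => q.2 == j))) R) => //.
by apply: smeas_lin => q; rewrite /colform => /negPf ->.
Qed.

(** Tilting along the form itself moves its mean to [lam] times its variance, which is at least 1/8;
    the 5 is the deviation allowed by [tilt]. *)
Lemma Pr_colE (lam a : R) y j : 0 <= lam -> 2^-1 <= l2 y <= 1 -> a <= lam / 8 - 5 ->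
  4^-1 * expR (- lam ^+ 2) <= Pr P (colE a y j).
Proof.
move=> lam0 /andP[y1 y2] ha.
have mE : measurable (colE a y j) by apply: (sig_measurable mG (@sig_colE a y j)).
have [_ _ mgf v01] := gG.
have /andP[c1 c2] := cov_colform y j.
set c := colform y j in c1 c2 *.
have Q1 : cov v c c <= 1 by apply: le_trans c2 _; rewrite expr_le1 // l2_ge0.
have Q2 : 8^-1 <= cov v c c by apply: le_trans c1; nra.
have xs1 : all (fun x => `[< cov v x x <= 1 >]) [:: c] by rewrite /= andbT; apply/asboolP.
have := tilt mG iG mgf (fun q => lam * c q) (xs := [:: c]) isT xs1.
set A := [set w | _] => H.
apply: (@le_trans _ _ (4^-1 * expR (- cov v (fun i => lam * c i) (fun i => lam * c i)))).
  rewrite ler_pM2l ?invr_gt0 // ler_expR covZl covZr; nra.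
apply: le_trans H _.
have mA : measurable A.
  rewrite /A (_ : [set w | _] = [set w | `|lin G c w - cov v (fun q => lam * c q) c| <= 5]).
    apply: measurable_set_le => //; apply: measurableT_comp => //.
    by apply: measurable_funB => //; exact: measurable_lin.
  apply/seteqP; split => w h; first exact: (h 0%N isT).
  by case.
apply: le_Pr => // w /(_ 0%N isT) /=; rewrite covZl => h.
rewrite /colE /= -/c; have := ler_norml (lin G c w - lam * cov v c c) 5; rewrite h => /esym /andP[h1 h2].
nra.
Qed.

(* For a fixed [y] about [rho ^ 2 * #|K|] columns correlate with [y] at level
   [lam / 16]. If none did at level [lam / 32] for some vector near [y], their
   difference would be mapped by the transpose to a vector too long for the
   operator norm. *)
Lemma quotient_event (a rho : R) : 0 < a -> 16 * (16 * 20) < a ^+ 2 ->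
  16 * (a + 4) <= rho -> 80 ^+ 2 <= 2 * ln rho -> rho ^+ 4 * #|K|%:R = #|N|%:R ->
  exists E : set T, [/\ measurable E, Pr P (~` E) <= 2 * expR (- #|K|%:R) &
    forall w, E w -> forall y, exists j,
      Num.sqrt (2 * ln rho) / 32 * l2 y <= `|tmv (Mat G w) y j|].
Proof.
move=> a0 ha hrho hln hn.
have r1 : 16 * 4 <= rho by lra.
have r0 : 0 < rho by lra.
have rp4 : 1 <= rho ^+ 4 by rewrite exprn_ege1 //; lra.
set kk : R := #|K|%:R in hn *; set n : R := #|N|%:R in hn.
have k1 : 1 <= kk by rewrite /kk ler1n.
(* With this [lam] the tilting cost [expR (- lam ^ 2)] is [rho ^ -2], so among the [rho ^ 4 * #|K|]
   columns the bound of [few] guarantees [rho ^ 2 * #|K| / 16] correlated ones. *)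
set lam := Num.sqrt (2 * ln rho).
have lam2 : lam ^+ 2 = 2 * ln rho.
  by rewrite sqr_sqrtr //; apply: le_trans hln; exact: sqr_ge0.
have lam0 : 0 <= lam by exact: sqrtr_ge0.
have lam80 : 80 <= lam by rewrite -(ler_pXn2r (n := 2)) ?nnegrE // lam2.
clear hln.
have elam : expR (- lam ^+ 2) = (rho ^+ 2)^-1.
  by rewrite expRN lam2 mulrC expRM_natr lnK.
set p := 4^-1 * expR (- lam ^+ 2).
have p4 : p * n / 4 = rho ^+ 2 * kk / 16.
  rewrite /p elam -hn; field; exact: lt0r_neq0.
have kn : kk <= n by rewrite -hn ler_peMl ?(le_trans _ k1).
have r16 : a * rho * kk + 1 + 2 * kk + kk <= rho ^+ 2 * kk / 16.
  have : (a + 4) * rho <= rho ^+ 2 / 16 by nra.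
  have : 1 * kk <= rho * kk by rewrite ler_pM2r; lra.
  nra.
pose D := (Num.truncn (a * rho * kk)).+1.
have q0 : 0 <= a * rho * kk by rewrite !mulr_ge0 // ltW.
have /andP[D1 D2] := truncn_itv q0.
have {}D2 : a * rho * kk <= D%:R by rewrite ltW.
have {}D1 : D%:R <= a * rho * kk + 1 by rewrite /D -natr1 lerD2r.
have ar0 : 0 < a * rho by rewrite mulr_gt0.
(* A net at this scale costs about [expR (a * rho * #|K|)], which the exponent [rho ^ 2 * #|K| / 16]
   absorbs since [rho] is large against [a]. A large [a] makes the approximation fine enough for the
   final contradiction. *)
set eps := (a * rho)^-1.
have eps0 : 0 < eps by rewrite invr_gt0.
have epsE : eps * (a * rho) = 1 by rewrite /eps mulVf //; apply: lt0r_neq0.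
have eD : kk <= eps * D%:R.
  by rewrite -(ler_pM2l ar0) mulrA (mulrC _ eps) epsE mul1r.
(* The tail [expR (- 10 n)] beats the two nets, of sizes at most [expR (4 n)] and [expR (4 k)],
   because [k <= n]. *)
pose t0 := Num.sqrt (20 * n).
have t00 : 0 <= t0 by exact: sqrtr_ge0.
have n0 : 0 <= n by exact: ler0n.
have t02 : t0 ^+ 2 = 20 * n by rewrite sqr_sqrtr // mulr_ge0.
pose F (f : {ffun K -> code D}) := pt (eps / Num.sqrt #|K|%:R) f.
pose B1 := badU G #|N| t0.
pose Q (f : {ffun K -> code D}) := (f \in net K #|K| D) && (2^-1 <= l2 (F f) <= 1).
pose B2 := \bigcup_(f in [set f | Q f]) few (colE (lam / 16) (F f)) p.
have mfew f : measurable (few (colE (lam / 16) (F f)) p).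
  by apply: (measurable_few mG (beta := snd)) => j; exact: sig_colE.
have mB1 : measurable B1 by exact: measurable_badU gG _ _.
have mB2 : measurable B2 by apply: measurable_bigcup_fin.
exists (~` (B1 `|` B2)); split.
- by apply: measurableC; apply: measurableU.
- rewrite setCK; apply: le_trans (PrU P mB1 mB2) _; rewrite mulr_natl mulr2n; apply: lerD.
    apply: le_trans (Pr_badU gG #|N| (th := 1) t00 _) _; first by rewrite ltr01 lexx.
    rewrite invr1 expr1n mul1r t02.
    rewrite (_ : 2 ^+ (2 * #|N|) * (1 + 2 * 1) ^+ #|N| = (12%:R : R) ^+ #|N|); last first.
      by rewrite exprM -exprMn; congr (_ ^+ _); ring.
    have h12 : (12 <= 2 ^ 4)%N by [].
    have H1 := le_expR_nat R #|N| h12; have H2 := le_expR_nat R #|K| h12.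
    apply: (@le_trans _ _ (expR (4%:R * n) * (expR (4%:R * kk) * expR (- (20 * n / 2))))).
      apply: ler_pM; rewrite ?mulr_ge0 ?exprn_ge0 ?expR_ge0 //.
      by rewrite ler_pM2r ?expR_gt0.
    rewrite -!expRD ler_expR; lra.
  apply: le_trans (Pr_bigcup P _ mfew) _.
  apply: (@le_trans _ _ (\sum_(f in net K #|K| D) expR (- (p * n / 4)))).
    rewrite [leLHS]big_mkcond [leRHS]big_mkcond; apply: ler_sum => f _; rewrite /Q.
    case: (f \in _) => //=; case: ifP => [f1|_]; last exact: expR_ge0.
    apply: (Pr_few mG iG (beta := snd)) => // j; first exact: sig_colE.
    apply: Pr_colE => //; lra.
  rewrite sumr_const -[leLHS]mulr_natl p4.
  apply: (@le_trans _ _ (2 ^+ D * 3 ^+ #|K| * expR (- (rho ^+ 2 * kk / 16)))).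
    rewrite ler_wpM2r ?expR_ge0 //; apply: le_trans (card_net (th := 1) _ _ _ _ _) _ => //.
    by rewrite invr1 expr1n mul1r mulr1 (_ : 1 + 2 = 3 :> R).
  apply: (@le_trans _ _ (expR (1%:R * D%:R) * expR (2%:R * kk) * expR (- (rho ^+ 2 * kk / 16)))).
    rewrite ler_wpM2r ?expR_ge0 //; apply: ler_pM; rewrite ?exprn_ge0 //.
      exact: (@le_expR_nat R 2 1).
    exact: (@le_expR_nat R 3 2).
  rewrite -!expRD ler_expR.
  lra.
- move=> w /= nB y.
  have nB1 : (~` B1) w by move=> h; apply: nB; left.
  have nB2 : (~` B2) w by move=> h; apply: nB; right.
  have /card_gt0P [j0 _] : (0 < #|N|)%N by rewrite -(ltr0n R) -/n; apply: lt_le_trans kn; apply: lt_le_trans k1.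
  have [y0|y0] := eqVneq (l2 y) 0; first by exists j0; rewrite y0 mulr0.
  have yp : 0 < l2 y by rewrite lt_neqAle eq_sym y0 l2_ge0.
  pose z k := (l2 y)^-1 * y k.
  have z1 : l2 z = 1 by rewrite l2Z ger0_norm ?invr_ge0 ?l2_ge0 // mulVf.
  suff [j hj] : exists j, lam / 32 <= `|tmv (Mat G w) z j|.
    exists j; move: hj; rewrite tmvZ normrM ger0_norm ?invr_ge0 ?l2_ge0 //.
    have e X : (l2 y)^-1 * X * l2 y = X by rewrite mulrAC mulVf // mul1r.
    by rewrite -(ler_pM2r yp) e.
  apply: contrapT => nj.
  have {}nj j : `|tmv (Mat G w) z j| < lam / 32.
    by rewrite ltNge; apply/negP => h; apply: nj; exists j.
  have [||f fn /= [e1 e2 _ _]] := @net_approx R K #|K| D eps z K0 eps0 eD.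
  - by rewrite z1.
  - exact: max_card.
  rewrite -/(F f) in e1 e2.
  have ehalf : eps <= 2^-1.
    by rewrite /eps lef_pV2 ?posrE //; nra.
  have f2 : 2^-1 <= l2 (F f) by have := l2_subr z (F f); rewrite z1; lra.
  have Qf : Q f by rewrite /Q fn f2 /= -z1.
  have nf : (~` few (colE (lam / 16) (F f)) p) w by move=> h; apply: nB2; exists f.
  have := not_few nf; rewrite p4; set J := [set _ | _]%SET => hJ.
  pose dl k := z k - F f k.
  (* The net point correlates at level [lam / 16] and [z] only below [lam / 32]; the difference
     exceeds [lam / 32], which is at least 1 by [lam80]. *)
  have hd j : j \in J -> 1 <= tmv (Mat G w) dl j ^+ 2.
    rewrite inE => /asboolP; rewrite /colE /= lin_colform => h.
    rewrite /dl tmvB; have := nj j; rewrite ltr_norml => /andP[h1 h2].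
    nra.
  have hs : l2 (tmv (Mat G w) dl) ^+ 2 >= rho ^+ 2 * kk / 16.
    apply: le_trans hJ _; rewrite sqr_l2 -sum1_card natr_sum [leLHS]big_mkcond.
    by apply: ler_sum => j _; case: ifP => [/hd|_] //; rewrite sqr_ge0.
  set g := tmv _ _ in hs.
  have og : l2 g <= 4 * t0 * l2 dl.
    have [g0|g0] := eqVneq (l2 g) 0; first by rewrite g0 !mulr_ge0 ?l2_ge0.
    have gp : 0 < l2 g by rewrite lt_neqAle eq_sym g0 l2_ge0.
    rewrite -(ler_pM2r gp) -expr2 -dot_self -{1}/g -dot_mv.
    apply: le_trans (dot_le _ _) _.
    rewrite (_ : 4 * t0 * l2 dl * l2 g = l2 dl * (4 * t0 * l2 g)); last by ring.
    rewrite ler_wpM2l ?l2_ge0 //.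
    by apply: (not_badU K0 t00 nB1); exact: max_card.
  (* Since [n * eps ^ 2 = rho ^ 2 * kk / a ^ 2], the two bounds on [l2 g ^ 2] would force
     [a ^ 2 <= 16 * (16 * 20)], against [ha]. *)
  have : l2 g ^+ 2 <= (4 * t0 * eps) ^+ 2.
    rewrite lerXn2r ?nnegrE ?l2_ge0 ?mulr_ge0 ?(ltW eps0) //.
    by apply: le_trans og _; rewrite ler_wpM2l ?mulr_ge0.
  rewrite !exprMn t02 -hn => hh.
  have EX : rho ^+ 4 * eps ^+ 2 * a ^+ 2 = rho ^+ 2.
    have : (eps * (a * rho)) ^+ 2 = 1 by rewrite epsE expr1n.
    by move=> E; rewrite -[RHS]mul1r -E; ring.
  have X0 : 0 < rho ^+ 4 * eps ^+ 2 * kk.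
    by rewrite !mulr_gt0 ?exprn_gt0 ?(lt_le_trans _ k1).
  set Y := rho ^+ 4 * eps ^+ 2 * kk / 16.
  have Y0 : 0 < Y by rewrite divr_gt0.
  have := le_trans hs hh; rewrite -EX.
  rewrite [leLHS](_ : _ = a ^+ 2 * Y); last by rewrite /Y; field.
  rewrite [leRHS](_ : _ = 16 * (16 * 20) * Y); last by rewrite /Y; field.
  by rewrite ler_pM2r // leNgt ha.
Qed.

End Quotient.

(** * Products of two measurements *)

Section Rot.
Variables (R : realType) (N : finType).
Implicit Types x y : N * bool -> R.

(* [x : N * bool -> R] encodes a complex vector, [(j, true)] and [(j, false)]
   indexing real and imaginary parts; [rot x] encodes [- 'i * x], and
   [act isR x] says that [x] has entries in the field selected by [isR]. *)
Definition rot x : N * bool -> R := fun p => if p.2 then x (p.1, false) else - x (p.1, true).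
Definition act (isR : bool) x : Prop := isR -> forall j, x (j, false) = 0.

Lemma sum_bool (F : N * bool -> R) : \sum_p F p = \sum_j (F (j, true) + F (j, false)).
Proof.
transitivity (\sum_j \sum_b F (j, b)); first by rewrite pair_big; apply: eq_bigr => -[].
by apply: eq_bigr => j _; rewrite big_bool.
Qed.

Lemma l2_rot x : l2 (rot x) = l2 x.
Proof.
rewrite /l2; congr Num.sqrt; rewrite !sum_bool; apply: eq_bigr => j _.
by rewrite /rot /= sqrrN addrC.
Qed.

Lemma dot_rot x : dot x (rot x) = 0.
Proof. by rewrite /dot sum_bool big1 // => j _; rewrite /rot /=; ring. Qed.

Lemma dot_rotC x y : dot y (rot x) = - dot x (rot y).
Proof. by rewrite /dot !sum_bool -sumrN; apply: eq_bigr => j _; rewrite /rot /=; ring. Qed.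

Lemma act_rot_dot x y : act true x -> act true y -> dot x (rot y) = 0.
Proof.
move=> ax ay; rewrite /dot sum_bool big1 // => j _.
by rewrite /rot /= (ax isT) (ay isT) mulr0 mul0r addr0.
Qed.

End Rot.

(* Variances of the entries: for a real matrix the imaginary entries are
   degenerate Gaussians of variance 0. *)
Definition vF (R : realType) (isR b : bool) : R := if isR then b%:R else 2^-1.
Definition tilt_scale {R : realType} : R := 30 * 30.
(** The probability given by [tilt] for a shift [tilt_scale * z] with [l2 z ^ 2 <= 4], where [z] is
    a sum or difference of two vectors of norm at most 1. *)
Definition p0 {R : realType} : R := 4^-1 * expR (- (4 * tilt_scale ^+ 2)).

(** The mean of a row product is quadratic in [L]. A product of two forms with means at most [2 L],
    each off by at most 5, has an error only linear in [L]; there are two such products, and the 1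
    is the target level. *)
Lemma mean_dominates (R : realType) (L : R) : 30 * 30 <= L ->
  1 + ((5 * 5 + 2 * L * 5 + 5 * (2 * L)) + (5 * 5 + 2 * L * 5 + 5 * (2 * L))) <=
  3 / 16 * (L / 2) ^+ 2.
Proof. by move=> h; nra. Qed.

Lemma norm_combo (R : realType) (a b s : R) : `|a| <= 1 -> `|b| <= 1 -> `|s| = 1 ->
  `|a + s * b| <= 2.
Proof.
move=> ha hb hs; apply: le_trans (ler_normD _ _) _.
by rewrite normrM hs mul1r (_ : 2 = 1 + 1) // lerD.
Qed.

Section Pair.
Context d (T : measurableType d) (R : realType) (P : probability T R).
Variables (isR : bool) (M N : finType) (G : M * N * bool -> T -> R).
Hypothesis gG : gfam P G (fun q => vF R isR q.2).

Let mG : forall i, measurable_fun setT (G i). Proof. by case: gG. Qed.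
Let iG : mutually_independent P G. Proof. by case: gG. Qed.
Let v (q : M * N * bool) := vF R isR q.2.

(** Coefficients of the real part of the [i]-th entry of A x. The imaginary part comes from [rot x],
    because Im a = Re(-'i a); [cross] is then Re(A x conj(A y)). *)
Definition cre (i : M) (x : N * bool -> R) : M * N * bool -> R := fun q =>
  if q.1.1 == i then (if q.2 then x (q.1.2, true) else - x (q.1.2, false)) else 0.

Definition reA (w : T) (x : N * bool -> R) (i : M) : R := lin G (cre i x) w.
Definition imA (w : T) (x : N * bool -> R) (i : M) : R := lin G (cre i (rot x)) w.
Definition cross (w : T) (x y : N * bool -> R) (i : M) : R :=
  reA w x i * reA w y i + imA w x i * imA w y i.

Lemma sum_row (F : M * N * bool -> R) i :
  \sum_q (if q.1.1 == i then F q else 0) = \sum_p F (i, p.1, p.2).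
Proof.
transitivity (\sum_i' \sum_p (if i' == i then F (i', p.1, p.2) else 0)).
  have -> : \sum_i' \sum_(p : N * bool) (if i' == i then F (i', p.1, p.2) else 0) =
    \sum_i' \sum_j \sum_b (if i' == i then F (i', j, b) else 0).
    by apply: eq_bigr => i' _; rewrite pair_big; apply: eq_bigr => -[].
  by rewrite pair_big pair_big; apply: eq_bigr => -[[]].
rewrite (bigD1 i) //= [X in _ + X]big1 ?addr0; last first.
  by move=> i' /negPf ->; rewrite big1.
by apply: eq_bigr => p _; rewrite eqxx.
Qed.

(** Over the reals only the coordinates [(j, true)] carry variance; [act] makes the remaining terms
    of [dot x y] vanish. *)
Lemma cov_cre i x y : act isR x ->
  cov v (cre i x) (cre i y) = (if isR then 1 else 2^-1) * dot x y.
Proof.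
move=> ax; transitivity (\sum_q (if q.1.1 == i then v q * (cre i x q * cre i y q) else 0)).
  apply: eq_bigr => q _; rewrite /cre; case: ifP => //; by rewrite mul0r mulr0.
rewrite sum_row /dot mulr_sumr !sum_bool; apply: eq_bigr => j _.
rewrite /cre /v /vF /= eqxx; move: ax; rewrite /act; case: isR => [/(_ isT) ->|_] /=; ring.
Qed.

Lemma cov_cre_le i x : cov v (cre i x) (cre i x) <= l2 x ^+ 2.
Proof.
have -> : cov v (cre i x) (cre i x) =
    \sum_q (if q.1.1 == i then v q * (cre i x q * cre i x q) else 0).
  apply: eq_bigr => q _; rewrite /cre; case: ifP => //; by rewrite mul0r mulr0.
rewrite sum_row sqr_l2; apply: ler_sum => -[j b] _.
have -> : cre i x (i, j, b) * cre i x (i, j, b) = x (j, b) ^+ 2.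
  by rewrite /cre /= eqxx; case: b; ring.
have [_ _ _ v01] := gG; rewrite ler_piMl ?sqr_ge0 //.
by case/andP: (v01 (i, j, b)).
Qed.

Definition rowE x y i : set T := [set w | 1 <= `|cross w x y i|].

Lemma sig_rowE x y i : sig G (fun q => q.1.1 == i) (rowE x y i).
Proof.
have H z : smeas G (fun q => q.1.1 == i) (fun w => lin G (cre i z) w).
  by apply: smeas_lin => q; rewrite /cre => /negPf ->.
apply: (@measurable_set_ge _ (g_sigma_algebraType (boxes G (fun q => q.1.1 == i))) R) => //.
apply: measurableT_comp => //.
by apply: measurable_funD; apply: measurable_funM; exact: H.
Qed.

Lemma measurable_rowE x y i : measurable (rowE x y i).
Proof. exact: (sig_measurable mG (@sig_rowE x y i)). Qed.

(* Tilting by [L * (x +- y)], with the sign of [dot x y], makes the mean of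
   [cross] at least [L ^ 2 / 4 * (|x|^2 |y|^2 - dot x (rot y) ^ 2)]. *)
Lemma Pr_rowE x y i : act isR x -> act isR y ->
  2^-1 <= l2 x ^+ 2 <= 1 -> 2^-1 <= l2 y ^+ 2 <= 1 -> `|dot x (rot y)| <= 4^-1 ->
  p0 <= Pr P (rowE x y i).
Proof.
move=> ax ay /andP[x1 x2] /andP[y1 y2] hq.
have [_ _ mgf v01] := gG.
set r := dot x y; set q := dot x (rot y) in hq.
pose sg : R := if 0 <= r then 1 else -1.
have sg2 : sg ^+ 2 = 1 by rewrite /sg; case: ifP => _; rewrite ?sqrrN expr1n.
have sgr : 0 <= sg * r.
  by rewrite /sg; case: (leP 0 r) => h; rewrite ?mul1r // mulN1r oppr_ge0 ltW.
pose z p := x p + sg * y p.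
have az : act isR z.
  by move=> h j; rewrite /z (ax h) (ay h) mulr0 addr0.
pose L : R := tilt_scale.
have L900 : 30 * 30 <= L by [].
have L0 : 0 < L by apply: lt_le_trans L900; rewrite mulr_gt0.
pose l q := L * cre i z q.
pose xs := [:: cre i x; cre i (rot x); cre i y; cre i (rot y)].
have lx1 : l2 x <= 1 by rewrite -(ler_pXn2r (n := 2)) ?nnegrE ?l2_ge0 // expr1n.
have ly1 : l2 y <= 1 by rewrite -(ler_pXn2r (n := 2)) ?nnegrE ?l2_ge0 // expr1n.
have hr : `|r| <= 1.
  apply: le_trans (dot_abs x y) _; have := l2_ge0 x; have := l2_ge0 y; nra.
have xs1 : all (fun x => `[< cov v x x <= 1 >]) xs.
  by rewrite /xs /= !andbT; apply/and4P; split; apply/asboolP;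
    apply: le_trans (cov_cre_le _ _) _; rewrite ?l2_rot.
have := tilt mG iG mgf l (xs := xs) isT xs1.
set A := [set w | _] => H.
have lz : l2 z ^+ 2 <= 4.
  have : l2 z <= l2 x + l2 y.
    apply: le_trans (l2D _ _) _; rewrite l2Z lerD2l; rewrite /sg; case: ifP => _;
    by rewrite ?normrN normr1 mul1r.
  have := l2_ge0 z; nra.
apply: (@le_trans _ _ (4^-1 * expR (- cov v l l))).
  rewrite /p0 ler_pM2l ?invr_gt0 // ler_expR lerN2 /l covZl covZr mulrA -expr2 -/L.
  rewrite [leRHS]mulrC ler_pM2l ?exprn_gt0 //.
  exact: le_trans (cov_cre_le _ _) lz.
apply: le_trans H _.
have mA : measurable A.
  have -> : A = \bigcap_(j : 'I_4) [set w |
      `|lin G (nth (fun=> 0) xs j) w - cov v l (nth (fun=> 0) xs j)| <= 5].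
    apply/seteqP; split => w h; first by move=> j _; exact: h.
    by move=> j js; exact: (h (Ordinal js)).
  rewrite -set_true; apply: measurable_bigcap_fin => j.
  apply: measurable_set_le => //; apply: measurableT_comp => //.
  by apply: measurable_funB => //; exact: measurable_lin.
apply: le_Pr => //; first exact: measurable_rowE.
move=> w h.
have := h 0%N isT; have := h 1%N isT; have := h 2%N isT; have := h 3%N isT; rewrite /=.
rewrite /l !covZl !cov_cre //.
set tau := (if isR then 1 else 2^-1).
have tau1 : 2^-1 <= tau <= 1 by rewrite /tau; case: isR; apply/andP; split; lra.
have zx : dot z x = l2 x ^+ 2 + sg * r by rewrite /z dotDl dotZl dot_self (dotC y).
have zrx : dot z (rot x) = - (sg * q).
  by rewrite /z dotDl dotZl dot_rot dot_rotC -/q add0r mulrN.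
have zy : dot z y = r + sg * l2 y ^+ 2 by rewrite /z dotDl dotZl dot_self.
have zry : dot z (rot y) = q by rewrite /z dotDl dotZl dot_rot mulr0 addr0.
rewrite zx zrx zy zry /rowE /= /cross -/(reA w x i) -/(reA w y i) -/(imA w x i) -/(imA w y i).
set a := reA w x i; set b := imA w x i; set c := reA w y i; set e := imA w y i.
set U := l2 x ^+ 2 in x1 x2 *; set V := l2 y ^+ 2 in y1 y2 *.
set ma := L * _; set mb := L * _; set mc := L * _; set me := L * _.
move=> he hc hb ha; clearbody L.
(* This hypothesis keeps [y] away from imaginary multiples of [x], for which [cross] is identically
   0. *)
have q2 : q ^+ 2 <= 16^-1.
  rewrite -(real_normK (num_real q)).
  rewrite (_ : 16^-1 = (4^-1) ^+ 2 :> R); last by field.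
  by rewrite lerXn2r ?nnegrE.
have mean : 3 / 16 * (L / 2) ^+ 2 <= sg * (mc * ma + me * mb).
  have -> : sg * (mc * ma + me * mb) = (L * tau) ^+ 2 *
      ((sg * r) * U + sg ^+ 2 * (U * V) + (sg * r) ^+ 2 + (sg ^+ 2) * (sg * r) * V - (sg ^+ 2) * q ^+ 2).
    by rewrite /ma /mb /mc /me; ring.
  rewrite sg2 !mul1r.
  (* The product [U * V] is at least 1/4 and [q ^ 2] at most 1/16; the choice of sign makes all
     other terms nonnegative. *)
  have h1 : 3 / 16 <= sg * r * U + U * V + (sg * r) ^+ 2 + sg * r * V - q ^+ 2.
    have : 0 <= sg * r * U by rewrite mulr_ge0 //; lra.
    have : 0 <= sg * r * V by rewrite mulr_ge0 //; lra.
    have : 0 <= (sg * r) ^+ 2 by exact: sqr_ge0.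
    nra.
  have h2 : (L / 2) ^+ 2 <= (L * tau) ^+ 2.
    case/andP: tau1 => t1 _; have Lt : L / 2 <= L * tau by rewrite ler_pM2l.
    have L2 : 0 <= L / 2 by rewrite divr_ge0 // ltW.
    by rewrite lerXn2r ?nnegrE // (le_trans L2).
  rewrite mulrC; apply: ler_pM => //; first exact: sqr_ge0.
have sg1 : sg = 1 \/ sg = -1 by rewrite /sg; case: ifP; [left|right].
have bm : [/\ `|ma| <= 2 * L, `|mb| <= 2 * L, `|mc| <= 2 * L & `|me| <= 2 * L].
  have hh k : `|k| <= 2 -> `|L * (tau * k)| <= 2 * L.
    move=> hk; case/andP: tau1 => t1 t2.
    have tau0 : 0 <= tau by apply: le_trans t1; rewrite invr_ge0.
    rewrite !normrM (ger0_norm (ltW L0)) (ger0_norm tau0) mulrC ler_pM2r //.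
    by rewrite -[leRHS]mul1r ler_pM.
  have q1 : `|q| <= 2 by apply: le_trans hq _; apply: le_trans (_ : 4^-1 <= 1) _; rewrite ?invf_le1 ?ler1n.
  have U1 : `|U| <= 1 by rewrite ger0_norm ?sqr_ge0.
  have V1 : `|V| <= 1 by rewrite ger0_norm ?sqr_ge0.
  have sgn : `|sg| = 1 by case: sg1 => ->; rewrite ?normrN normr1.
  rewrite /ma /mb /mc /me; split; apply: hh => //; first exact: norm_combo.
    by rewrite normrN normrM sgn mul1r.
  exact: norm_combo.
have prod_le s t ms mt : `|s - ms| <= 5 -> `|t - mt| <= 5 -> `|ms| <= 2 * L -> `|mt| <= 2 * L ->
    `|s * t - ms * mt| <= 5 * 5 + 2 * L * 5 + 5 * (2 * L).
  move=> h1 h2 h3 h4.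
  rewrite (_ : s * t - ms * mt = (s - ms) * (t - mt) + ms * (t - mt) + (s - ms) * mt); last by ring.
  apply: le_trans (ler_normD _ _) _; apply: le_trans (lerD (ler_normD _ _) (lexx _)) _.
  by rewrite !normrM; do ! apply: lerD; apply: ler_pM.
case: bm => b1 b2 b3 b4.
have P1 := prod_le _ _ _ _ ha hc b4 b2.
have P2 := prod_le _ _ _ _ hb he b3 b1.
have big : 3 / 16 * (L / 2) ^+ 2 <= `|mc * ma + me * mb|.
  apply: le_trans mean _.
  case: sg1 => ->; first by rewrite mul1r ler_norm.
  by rewrite mulN1r -normrN ler_norm.
rewrite leNgt; apply/negP => small.
have : `|mc * ma + me * mb| <= `|a * c + b * e| +
    ((5 * 5 + 2 * L * 5 + 5 * (2 * L)) + (5 * 5 + 2 * L * 5 + 5 * (2 * L))).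
  rewrite (_ : mc * ma + me * mb = (a * c + b * e) - ((a * c - me * mb) + (b * e - mc * ma))); last by ring.
  apply: le_trans (ler_normB _ _) _; rewrite lerD2l.
  by apply: le_trans (ler_normD _ _) _; apply: lerD.
move=> up; have {up big} := le_trans big up.
apply/negP; rewrite -ltNge; apply: lt_le_trans (ltr_leD small (lexx _)) _.
exact: mean_dominates.
Qed.

(** Rows are independent blocks, so for each pair of net points at least [p0 * #|M| / 4] rows
    contribute 1 or more outside [few]. The union bound runs over pairs, hence [B ^ 2]. *)
Lemma pair_event (S D : nat) (h : R) (B : R) :
  #|net (N * bool)%type S D|%:R <= B ->
  exists E : set T, [/\ measurable E,
    Pr P (~` E) <= B ^+ 2 * expR (- (p0 * #|M|%:R / 4)) &
    forall w, E w -> forall f g : {ffun N * bool -> code D}, f \in net (N * bool)%type S D ->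
      g \in net (N * bool)%type S D ->
      act isR (pt h f) -> act isR (pt h g) ->
      2^-1 <= l2 (pt h f) ^+ 2 <= 1 -> 2^-1 <= l2 (pt h g) ^+ 2 <= 1 ->
      `|dot (pt h f) (rot (pt h g))| <= 4^-1 ->
      p0 * #|M|%:R / 4 <= \sum_i `|cross w (pt h f) (pt h g) i|].
Proof.
move=> cB.
pose Q (fg : {ffun N * bool -> code D} * {ffun N * bool -> code D}) :=
  [&& fg.1 \in net (N * bool)%type S D, fg.2 \in net (N * bool)%type S D &
   `[< [/\ act isR (pt h fg.1), act isR (pt h fg.2), 2^-1 <= l2 (pt h fg.1) ^+ 2 <= 1,
       2^-1 <= l2 (pt h fg.2) ^+ 2 <= 1 & `|dot (pt h fg.1) (rot (pt h fg.2))| <= 4^-1] >] ].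
pose F (fg : {ffun N * bool -> code D} * {ffun N * bool -> code D}) :=
  few (rowE (pt h fg.1) (pt h fg.2)) (p0 : R).
have mF : forall fg, measurable (F fg).
  by move=> fg; apply: (measurable_few mG (beta := fun q => q.1.1)) => i; exact: sig_rowE.
have mU : measurable (\bigcup_(fg in [set fg | Q fg]) F fg) by exact: measurable_bigcup_fin.
exists (~` \bigcup_(fg in [set fg | Q fg]) F fg); split.
- exact: measurableC.
- rewrite setCK; apply: le_trans (Pr_bigcup P _ mF) _.
  set b := expR _.
  apply: (@le_trans _ _ (\sum_(fg | (fg.1 \in net (N * bool)%type S D) && (fg.2 \in net (N * bool)%type S D)) b)).
    rewrite [leLHS]big_mkcond [leRHS]big_mkcond; apply: ler_sum => fg _; rewrite /Q andbA.
    case: ((fg.1 \in _) && _) => //=; case: ifP => [/asboolP [a1 a2 b1 b2 c1]|_]; last exact: expR_ge0.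
    rewrite /F /b; apply: (Pr_few mG iG (beta := fun q => q.1.1)).
    - by move=> i; exact: sig_rowE.
    - by move=> i; apply: Pr_rowE.
  rewrite -(pair_big (fun f => f \in net (N * bool)%type S D)
      (fun g => g \in net (N * bool)%type S D) (fun _ _ => b)) /=.
  rewrite !sumr_const -!mulrnA -mulr_natl ler_wpM2r ?expR_ge0 //.
  by rewrite natrM expr2 ler_pM.
- move=> w nE f g fn gn af ag lf lg dfg.
  have nf : (~` few (rowE (pt h f) (pt h g)) (p0 : R)) w.
    move=> hh; apply: nE; exists (f, g) => //=.
    by rewrite /Q /= fn gn /=; apply/asboolP.
  apply: le_trans (not_few nf) _.
  rewrite -sum1_card natr_sum [leLHS]big_mkcond; apply: ler_sum => i _.
  by case: ifP => //; rewrite inE => /asboolP.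
Qed.

End Pair.

(** * Sorting and greedy pursuit *)

Section Tail.
Variables (R : realType) (J : finType) (phi : (J -> R) -> R) (C : R) (s : nat).
Hypothesis phiD : forall x y, phi (fun j => x j + y j) <= phi x + phi y.
Hypothesis C0 : 0 <= C.
Hypothesis s0 : (0 < s)%N.
Hypothesis phis : forall x, (#|supp x| <= s)%N -> phi x <= C * l2 x.
Let q : R := Num.sqrt s%:R.

Let q0 : 0 < q. Proof. by rewrite sqrtr_gt0 ltr0n. Qed.
Let qq : q * q = s%:R. Proof. by rewrite -expr2 sqr_sqrtr ?ler0n. Qed.

Lemma phi_restr (A : {set J}) x : phi x <= phi (restr A x) + phi (restr (~: A)%SET x).
Proof.
have {1}-> : x = (fun j => restr A x j + restr (~: A)%SET x j).
  by apply/funext => j; rewrite -restr_split.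
exact: phiD.
Qed.

(* Peel off the [s] largest entries: the next layer is bounded by their
   average. *)
Lemma tail_bound x (b : R) : (forall j, `|x j| <= b) -> 0 <= b ->
  phi x <= C * (q * b + l1 x / q).
Proof.
elim: {x}_.+1 {-2}x (ltnSn #|supp x|) b => // c IH x xc b xb b0.
have l1q : 0 <= l1 x / q by rewrite divr_ge0 ?l1_ge0 // ltW.
have [xs|xs] := leqP #|supp x| s.
  apply: le_trans (phis xs) _; rewrite ler_wpM2l //.
  by apply: le_trans (l2_le_inf xs xb b0) _; rewrite lerDl.
have sJ : (s <= #|J|)%N by apply: leq_trans (ltnW xs) (max_card _).
have [A As Atop] := top_set (fun j => `|x j|) sJ.
have sp : 0 < s%:R :> R by rewrite ltr0n.
set b' := l1 (restr A x) / s%:R.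
have b'0 : 0 <= b' by rewrite divr_ge0 ?l1_ge0 // ltW.
have out j : j \notin A -> `|x j| <= b'.
  move=> jA; rewrite /b' ler_pdivlMr // l1_restr mulr_natr -As -sumr_const.
  by apply: ler_sum => i iA; exact: Atop.
have tb j : `|restr (~: A)%SET x j| <= b'.
  by rewrite /restr inE; case: (boolP (j \in A)) => /= jA; [rewrite normr0|exact: out].
have small : (#|supp (restr (~: A)%SET x)| < c)%N.
  rewrite -ltnS; apply: leq_trans xc; rewrite ltnS; apply: proper_card.
  apply/properP; split.
    apply/fintype.subsetP => j; rewrite !inE /restr inE.
    by case: (j \in A) => //=; rewrite eqxx.
  (* The induction on the support needs a nonzero entry in [A]; otherwise the average [b'] is 0 and
     [x] vanishes everywhere. *)
  have [i iA xi] : exists2 i, i \in A & x i != 0.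
    apply: contrapT => h.
    have A0 i : i \in A -> x i = 0.
      by move=> iA; apply/eqP/negPn/negP => xi; apply: h; exists i.
    have b'z : b' = 0.
      rewrite /b' l1_restr big1 ?mul0r // => i iA; by rewrite A0 ?normr0.
    have : #|supp x| = 0%N.
      apply: eq_card0 => j; rewrite inE; apply/negbTE; rewrite negbK.
      have [jA|jA] := boolP (j \in A); first by rewrite A0.
      by have := out j jA; rewrite b'z normr_le0.
    by move=> e; rewrite e in xs.
  exists i; first by rewrite inE.
  by rewrite inE /restr inE iA eqxx.
apply: le_trans (phi_restr A x) _.
have h2 := IH _ small b' tb b'0.
have sA : (#|supp (restr A x)| <= s)%N by rewrite -As; apply: subset_leq_card; exact: supp_restr.
have h1 : phi (restr A x) <= C * (q * b).
  apply: le_trans (phis sA) _; rewrite ler_wpM2l //; apply: l2_le_inf => // j.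
  by rewrite /restr; case: ifP; rewrite ?normr0.
apply: le_trans (lerD h1 h2) _; rewrite -mulrDr ler_wpM2l // lerD2l (l1_split A x) mulrDl lerD2r.
by rewrite /b' -qq invfM mulrA mulrA mulrAC (mulrC q) mulfK ?gt_eqF.
Qed.

(** [H] collects the entries above [l1 x / s], at most [s] of them by Markov; strictness makes it
    empty when [l1 x = 0]. On the rest [tail_bound] has two equal contributions, hence the factor
    2. *)
Lemma head_tail x : exists H : {set J}, [/\ (#|H| <= s)%N,
  phi (restr (~: H)%SET x) <= 2 * C * (l1 x / q) &
  forall j, `|restr (~: H)%SET x j| <= l1 x / s%:R].
Proof.
have sp : 0 < s%:R :> R by rewrite ltr0n.
pose H := [set j | l1 x < s%:R * `|x j|]%SET.
have tb j : `|restr (~: H)%SET x j| <= l1 x / s%:R.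
  rewrite /restr !inE -leNgt; case: ifP => h; last by rewrite normr0 divr_ge0 ?l1_ge0.
  by rewrite ler_pdivlMr // mulrC.
exists H; split => //.
  have [x0|x0] := eqVneq (l1 x) 0.
    suff -> : H = finset.set0 by rewrite cards0.
    apply/setP => j; rewrite !inE x0; apply/negbTE; rewrite -leNgt.
    rewrite mulr_ge0_le0 ?ler0n // -x0 /l1 (bigD1 j) //= lerDl sumr_ge0 //.
  have xp : 0 < l1 x by rewrite lt_neqAle eq_sym x0 l1_ge0.
  rewrite -(ler_nat R) -(ler_pM2r xp) mulr_natl -sumr_const.
  apply: (@le_trans _ _ (\sum_(j in H) s%:R * `|x j|)).
    by apply: ler_sum => j; rewrite inE => /ltW.
  rewrite -mulr_sumr ler_wpM2l ?ler0n //.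
  by rewrite -l1_restr (l1_split H x) lerDl l1_ge0.
apply: le_trans (tail_bound tb _) _; first by rewrite divr_ge0 ?l1_ge0.
rewrite (_ : 2 * C * (l1 x / q) = C * (l1 x / q + l1 x / q)); last by ring.
rewrite ler_wpM2l //; apply: lerD.
  by rewrite -qq le_eqVlt; apply/orP; left; apply/eqP; field; rewrite lt0r_neq0.
rewrite ler_pM2r ?invr_gt0 //.
by rewrite [leRHS](l1_split H x) lerDr l1_ge0.
Qed.

End Tail.

Section Pursuit.
Variables (R : realType) (K N : finType) (M : K -> N -> R) (c : R).
Hypothesis c0 : 0 < c.
Hypothesis Mc : forall y, exists j, c * l2 y <= `|tmv M y j|.

Let col j : K -> R := fun k => M k j.
Let bump j (a : R) : N -> R := fun i => if i == j then a else 0.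

Lemma mv_bump j a k : mv M (bump j a) k = M k j * a.
Proof.
rewrite /mv (bigD1 j) //= /bump eqxx big1 ?addr0 // => i /negPf ->; exact: mulr0.
Qed.

Lemma l1_bump j a : l1 (bump j a) = `|a|.
Proof.
rewrite /l1 (bigD1 j) //= /bump eqxx big1 ?addr0 // => i /negPf ->; exact: normr0.
Qed.

(* The residual is projected off its best correlated column; its decrease pays
   for the l1 cost of the step. *)
Lemma pursuit_step (B : R) r : (forall j, l2 (col j) ^+ 2 <= B) -> 0 < B -> c ^+ 2 <= B ->
  exists j a, let r' := fun k => r k - M k j * a in
    `|a| <= 2 / c * (l2 r - l2 r') /\ l2 r' <= (1 - c ^+ 2 / (2 * B)) * l2 r.
Proof.
move=> colB B0 cB; have [j hj] := Mc r.
have [r0|r0] := eqVneq (l2 r) 0.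
  have r'0 : l2 (fun k => r k - M k j * 0) = 0.
    by rewrite -[RHS]r0; apply: eq_l2 => k; rewrite mulr0 subr0.
  by exists j, 0; rewrite /= r'0 r0 subrr !mulr0 normr0.
have rp : 0 < l2 r by rewrite lt_neqAle eq_sym r0 l2_ge0.
set g := tmv M r j in hj.
have gE : g = dot r (col j) by [].
have gp : 0 < `|g| by apply: lt_le_trans hj; rewrite mulr_gt0.
set b := l2 (col j).
have gb : `|g| <= l2 r * b by rewrite gE dot_abs.
have bp : 0 < b.
  rewrite lt_neqAle l2_ge0 andbT eq_sym; apply/eqP => e.
  by move: gb; rewrite e mulr0 leNgt gp.
exists j, (g / b ^+ 2) => /=; set r' := fun k => _.
have b2 : b ^+ 2 != 0 by rewrite expf_neq0 // gt_eqF.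
have g2 : g ^+ 2 = `|g| ^+ 2 by rewrite real_normK // num_real.
have r'2 : l2 r' ^+ 2 = l2 r ^+ 2 - `|g| ^+ 2 / b ^+ 2.
  have -> : l2 r' ^+ 2 = dot r r - 2 * (g / b ^+ 2) * dot r (col j) + (g / b ^+ 2) ^+ 2 * dot (col j) (col j).
    rewrite -dot_self /dot !mulr_sumr -sumrB -big_split; apply: eq_bigr => k _ /=.
    rewrite /r' /col; ring.
  rewrite !dot_self -gE -/b -g2; field; exact: lt0r_neq0.
(* From [r' ^ 2 = r ^ 2 - 2 r t] follows [r' <= r - t]. The drop [t] is bounded below twice: by
   [c / 2 * |a|], which pays for the step, and by a fixed fraction of [l2 r], which gives geometric
   decay. *)
set t := `|g| ^+ 2 / (2 * b ^+ 2 * l2 r).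
have key : l2 r' <= l2 r - t.
  have t0 : 0 <= t by rewrite divr_ge0 ?sqr_ge0 // !mulr_ge0 ?sqr_ge0 ?l2_ge0.
  have tE : 2 * l2 r * t = `|g| ^+ 2 / b ^+ 2.
    by rewrite /t; field; rewrite r0 lt0r_neq0.
  have tr : 0 <= l2 r - t.
    rewrite -(pmulr_rge0 _ (_ : 0 < 2 * l2 r)); last by rewrite mulr_gt0.
    rewrite mulrBr tE subr_ge0 ler_pdivrMr ?exprn_gt0 //.
    apply: (@le_trans _ _ ((l2 r * b) ^+ 2)).
      by rewrite lerXn2r ?nnegrE ?mulr_ge0 ?l2_ge0.
    rewrite exprMn ler_wpM2r ?sqr_ge0 //; have := sqr_ge0 (l2 r); lra.
  rewrite -(ler_pXn2r (n := 2)) ?nnegrE ?l2_ge0 // r'2 -tE; have := sqr_ge0 t; nra.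
have a1 : `|g / b ^+ 2| = `|g| / b ^+ 2 by rewrite normrM normfV (ger0_norm (sqr_ge0 b)).
have t1 : c / 2 * (`|g| / b ^+ 2) <= t.
  have -> : t = (`|g| / l2 r) / 2 * (`|g| / b ^+ 2).
    by rewrite /t; field; rewrite r0 lt0r_neq0.
  by rewrite ler_pM2r ?divr_gt0 ?exprn_gt0 // ler_pM2r ?invr_gt0 // ler_pdivlMr.
have t2 : c ^+ 2 / (2 * B) * l2 r <= t.
  have -> : t = (`|g| / l2 r) ^+ 2 / (2 * b ^+ 2) * l2 r.
    by rewrite /t; field; rewrite r0 lt0r_neq0.
  rewrite ler_pM2r //; apply: ler_pM.
  - exact: sqr_ge0.
  - by rewrite invr_ge0 mulr_ge0 // ltW.
  - by rewrite lerXn2r ?nnegrE ?divr_ge0 ?l2_ge0 ?(ltW c0) // ler_pdivlMr.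
  - have B2 : 0 < 2 * B by rewrite mulr_gt0.
    have b22 : 0 < 2 * b ^+ 2 by rewrite mulr_gt0 // exprn_gt0.
    rewrite lef_pV2 ?posrE // ler_pM2l //; exact: colB.
split; last by rewrite mulrBl mul1r; lra.
rewrite a1 -(ler_pM2l (_ : 0 < c / 2)); last by rewrite divr_gt0.
have -> : c / 2 * (2 / c * (l2 r - l2 r')) = l2 r - l2 r' by field; rewrite lt0r_neq0.
lra.
Qed.

(** The l1 costs telescope with the residual norms, so their total is bounded independently of the
    number of steps. *)
Lemma pursuit_approx (B : R) e t : (forall j, l2 (col j) ^+ 2 <= B) -> 0 < B -> c ^+ 2 <= B ->
  exists u, l1 u <= 2 / c * l2 e /\
    l2 (fun k => e k - mv M u k) <= (1 - c ^+ 2 / (2 * B)) ^+ t * l2 e.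
Proof.
move=> colB B0 cB.
suff [u [h1 h2]] : exists u, l1 u <= 2 / c * (l2 e - l2 (fun k => e k - mv M u k)) /\
    l2 (fun k => e k - mv M u k) <= (1 - c ^+ 2 / (2 * B)) ^+ t * l2 e.
  exists u; split => //; apply: le_trans h1 _.
  by rewrite ler_pM2l ?divr_gt0 // lerBlDr lerDl l2_ge0.
elim: t => [|t [u [h1 h2]]].
  exists (fun=> 0).
  have -> : l2 (fun k => e k - mv M (fun=> 0) k) = l2 e.
    by apply: eq_l2 => k; rewrite /mv big1 ?subr0 // => j _; exact: mulr0.
  by rewrite subrr mulr0 expr0 mul1r /l1 big1 // => j _; exact: normr0.
have [j [a [g1 g2]]] := pursuit_step (fun k => e k - mv M u k) colB B0 cB.
exists (fun i => u i + bump j a i).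
have E : l2 (fun k => e k - mv M (fun i => u i + bump j a i) k) =
   l2 (fun k => e k - mv M u k - M k j * a).
  by apply: eq_l2 => k; rewrite mvD mv_bump opprD addrA.
rewrite E; split.
  apply: le_trans (l1D _ _) _; rewrite l1_bump; apply: le_trans (lerD h1 g1) _.
  by rewrite -mulrDr ler_pM2l ?divr_gt0 //; lra.
apply: le_trans g2 _; rewrite (exprS _ t) -[leRHS]mulrA ler_wpM2l //.
rewrite subr_ge0 ler_pdivrMr ?mulr_gt0 //; lra.
Qed.

(** By [Mc] the transpose annihilates no nonzero vector, so the matrix is surjective. *)
Lemma right_inverse : exists L : R, 0 <= L /\
  forall r, exists u, (forall k, mv M u k = r k) /\ l1 u <= L * l2 r.
Proof.
pose A : 'M[R]_(#|N|, #|K|) := \matrix_(a, b) M (enum_val b) (enum_val a).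
have fullA : row_full A.
  rewrite /row_full -mxrank_tr -/(row_free A^T) -kermx_eq0.
  apply/rowV0P => y /sub_kermxP yA.
  pose y' k := y 0 (enum_rank k).
  have ty j : tmv M y' j = 0.
    have := congr1 (fun B : 'rV[R]_(#|N|) => B 0 (enum_rank j)) yA; rewrite !mxE => <-.
    rewrite /tmv (reindex (@enum_val K xpredT)) /=; last first.
      exists (@enum_rank K) => x _; [exact: enum_valK|exact: enum_rankK].
    apply: eq_bigr => b _; rewrite /y' enum_valK !mxE enum_rankK //.
  have [j hj] := Mc y'.
  have y0 : l2 y' = 0.
    move: hj; rewrite ty normr0 pmulr_rle0 // => h.
    by apply/eqP; rewrite eq_le h l2_ge0.
  by apply/rowP => b; have := l2_0E y0 (enum_val b); rewrite /y' enum_valK mxE.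
have [B AB] := row_fullP fullA.
exists (\sum_j \sum_k `|B k j|); split.
  by apply: sumr_ge0 => j _; apply: sumr_ge0.
move=> r; pose rr : 'rV[R]_#|K| := \row_b r (enum_val b).
pose uu := rr *m B.
exists (fun j => uu 0 (enum_rank j)); split.
  move=> k; have : (uu *m A) 0 (enum_rank k) = r k.
    by rewrite /uu -mulmxA AB mulmx1 mxE enum_rankK.
  rewrite mxE => <-; rewrite /mv (reindex (@enum_val N xpredT)) /=; last first.
    exists (@enum_rank N) => x _; [exact: enum_valK|exact: enum_rankK].
  by apply: eq_bigr => a _; rewrite enum_valK [A _ _]mxE enum_rankK mulrC.
rewrite /l1 (reindex (@enum_val N xpredT)) /=; last first.
  exists (@enum_rank N) => x _; [exact: enum_valK|exact: enum_rankK].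
rewrite mulr_suml; apply: ler_sum => a _; rewrite enum_valK /uu mxE mulr_suml.
apply: le_trans (ler_norm_sum _ _ _) _; apply: ler_sum => b _.
by rewrite normrM mulrC ler_wpM2l // mxE coord_l2.
Qed.

(* The residual left by finitely many steps is so small that an exact right
   inverse of uncontrolled norm absorbs it. *)
Lemma pursuit e : exists u, (forall k, mv M u k = e k) /\ l1 u <= 3 / c * l2 e.
Proof.
pose B := c ^+ 2 + \sum_j l2 (col j) ^+ 2.
have s0 : 0 <= \sum_j l2 (col j) ^+ 2 by apply: sumr_ge0 => j _; exact: sqr_ge0.
have c2 : 0 < c ^+ 2 by rewrite exprn_gt0.
have cB : c ^+ 2 <= B by rewrite lerDl.
have B0 : 0 < B by apply: lt_le_trans cB.
have colB j : l2 (col j) ^+ 2 <= B.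
  rewrite /B (bigD1 j) //= addrCA lerDl addr_ge0 ?sqr_ge0 //.
  by apply: sumr_ge0 => i _; exact: sqr_ge0.
have [L [L0 HL]] := right_inverse.
set rho := 1 - c ^+ 2 / (2 * B).
(* The remaining residual then costs at most [1 / c] times [l2 e], on top of [2 / c] for the
   pursuit. Using [L + 1] allows [L = 0]. *)
have [t ht] : exists t, L * rho ^+ t <= c^-1.
  have rho1 : `|rho| < 1.
    have h1 : 0 < c ^+ 2 / (2 * B) by rewrite divr_gt0 // mulr_gt0.
    have h2 : c ^+ 2 / (2 * B) <= 1 by rewrite ler_pdivrMr ?mulr_gt0 //; lra.
    by rewrite ger0_norm /rho; lra.
  have := cvg_expr rho1 => /cvgr0Pnorm_le H.
  have L1 : 0 < L + 1 by lra.
  have e0 : 0 < (c * (L + 1))^-1 by rewrite invr_gt0 mulr_gt0.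
  have [t _ /(_ t (leqnn t)) /= h] := H _ e0.
  exists t; apply: (@le_trans _ _ ((L + 1) * (c * (L + 1))^-1)).
    apply: (@le_trans _ _ (L * (c * (L + 1))^-1)).
      by rewrite ler_wpM2l //; apply: le_trans (ler_norm _) h.
    by rewrite ler_pM2r //; lra.
  by rewrite invfM mulrCA mulfV ?mulr1 // gt_eqF.
have [u [h1 h2]] := pursuit_approx e t colB B0 cB.
have [u' [g1 g2]] := HL (fun k => e k - mv M u k).
exists (fun j => u j + u' j); split.
  by move=> k; rewrite mvD g1 addrC subrK.
apply: le_trans (l1D _ _) _; apply: le_trans (lerD h1 g2) _.
have : L * l2 (fun k => e k - mv M u k) <= c^-1 * l2 e.
  apply: (@le_trans _ _ (L * (rho ^+ t * l2 e))); first by rewrite ler_wpM2l.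
  by rewrite mulrA ler_wpM2r ?l2_ge0.
lra.
Qed.

End Pursuit.

(** * Deterministic recovery *)

Section ComplexModulus.
Variables (R : realType) (N : finType).
Implicit Types x y z : N * bool -> R.

(** Entrywise complex modulus; [cl1] is the complex l1-norm, while [l1] sums over real
    coordinates. *)
Definition ca x : N -> R := fun j => l2 (fun b => x (j, b)).
Definition cl1 x : R := \sum_j ca x j.

Lemma sqr_ca x j : ca x j ^+ 2 = x (j, true) ^+ 2 + x (j, false) ^+ 2.
Proof. by rewrite sqr_l2 big_bool. Qed.

Lemma l2_ca x : l2 (ca x) = l2 x.
Proof.
rewrite /l2; congr Num.sqrt; rewrite sum_bool; apply: eq_bigr => j _; exact: sqr_ca.
Qed.

Lemma ca_ge0 x j : 0 <= ca x j. Proof. exact: l2_ge0. Qed.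

Lemma caD x y j : ca (fun p => x p + y p) j <= ca x j + ca y j.
Proof. exact: l2D. Qed.

Lemma ca_subr x y j : ca x j - ca y j <= ca (fun p => x p - y p) j.
Proof. exact: l2_subr. Qed.

Lemma cl1D x y : cl1 (fun p => x p + y p) <= cl1 x + cl1 y.
Proof. by rewrite /cl1 -big_split; apply: ler_sum => j _; exact: caD. Qed.

Lemma cl1_le x (A : {set N}) : (forall j b, j \notin A -> x (j, b) = 0) ->
  cl1 x <= Num.sqrt #|A|%:R * l2 x.
Proof.
move=> xA; rewrite -l2_ca; apply: le_trans (sum_le_l2 A (ca x)).
rewrite /cl1 [leRHS]big_mkcond; apply: ler_sum => j _; case: ifP => jA.
  by rewrite ger0_norm ?ca_ge0.
rewrite /ca /l2 big1 ?sqrtr0 // => b _; by rewrite xA ?jA // expr0n.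
Qed.

Lemma l1_le_cl1 x : l1 x <= 2 * cl1 x.
Proof.
rewrite /l1 sum_bool /cl1 mulr_sumr; apply: ler_sum => j _.
by rewrite mulr_natl mulr2n; apply: lerD; exact: (coord_l2 (fun b => x (j, b))).
Qed.

(** Multiplication by the scalar [al - 'i * be]. *)
Definition phase (al be : R) x : N * bool -> R := fun p => al * x p + be * rot x p.

Lemma ca_phase al be x j : al ^+ 2 + be ^+ 2 = 1 -> ca (phase al be x) j = ca x j.
Proof.
move=> ab; have : ca (phase al be x) j ^+ 2 = ca x j ^+ 2.
  rewrite !sqr_ca /phase /rot /= -[RHS]mul1r -ab; ring.
by move=> /eqP; rewrite eqrXn2 ?ca_ge0 // => /eqP.
Qed.

(** The phase is the normalized inner product with components [p] and [q]. Over the reals [q = 0],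
    so it is a sign; if the inner product is 0, the phase 1 does. *)
Lemma align x z (isR : bool) : act isR x -> act isR z ->
  exists al be, [/\ al ^+ 2 + be ^+ 2 = 1, isR -> be = 0,
    0 <= dot x (phase al be z) & dot x (rot (phase al be z)) = 0].
Proof.
move=> ax az; set p := dot x z; set q := dot x (rot z).
have qR : isR -> q = 0 by move=> h; apply: act_rot_dot; rewrite -h.
have E al be : dot x (phase al be z) = al * p + be * q.
  by rewrite /phase dotDr !dotZr.
have E' al be : dot x (rot (phase al be z)) = al * q - be * p.
  rewrite (@eq_dot _ _ _ _ x (fun i => al * rot z i - be * z i)) //.
    by rewrite dotBr !dotZr.
  by case=> j [] ; rewrite /phase /rot /=; ring.
set rho := Num.sqrt (p ^+ 2 + q ^+ 2).
have s0 : 0 <= p ^+ 2 + q ^+ 2 by rewrite addr_ge0 ?sqr_ge0.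
have rho2 : rho ^+ 2 = p ^+ 2 + q ^+ 2 by rewrite sqr_sqrtr.
have [r0|r0] := eqVneq rho 0.
  move: rho2; rewrite r0 expr0n /= => /esym/eqP.
  rewrite paddr_eq0 ?sqr_ge0 // !sqrf_eq0 => /andP[/eqP p0 /eqP q0].
  exists 1, 0; rewrite E E' p0 q0 !mulr0 !addr0 subr0; split => //.
  by rewrite expr1n expr0n addr0.
exists (p / rho), (q / rho); rewrite E E'; split.
- by rewrite !exprMn -mulrDl -rho2 exprVn mulfV // expf_neq0.
- by move=> /qR ->; rewrite mul0r.
- by rewrite (_ : _ + _ = (p ^+ 2 + q ^+ 2) / rho); [rewrite divr_ge0 // sqrtr_ge0|ring].
- by ring.
Qed.

End ComplexModulus.

Lemma l2_le_l1_sup (R : realType) (J : finType) (x : J -> R) (b c : R) :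
  (forall j, `|x j| <= b) -> l1 x <= c -> 0 <= b -> l2 x ^+ 2 <= b * c.
Proof.
move=> xb xc b0; apply: (@le_trans _ _ (b * l1 x)); last by rewrite ler_wpM2l.
rewrite sqr_l2 mulr_sumr; apply: ler_sum => j _.
by rewrite -(real_normK (num_real (x j))) expr2 ler_wpM2r.
Qed.

Section Recovery.
Variables (R : realType) (isR : bool) (M N : finType).
Variable re : (N * bool -> R) -> M -> R.
Hypothesis reD : forall x y i, re (fun p => x p + y p) i = re x i + re y i.
Hypothesis reZ : forall a x i, re (fun p => a * x p) i = a * re x i.

(** Same form as [cross], for an arbitrary real-linear [re]: from here on recovery is
    deterministic. *)
Definition crs x y i : R := re x i * re y i + re (rot x) i * re (rot y) i.
Definition img x : M * bool -> R := fun p => if p.2 then re x p.1 else re (rot x) p.1.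

Lemma reB x y i : re (fun p => x p - y p) i = re x i - re y i.
Proof.
rewrite -mulN1r -reZ -reD; congr (re _ i); apply/funext => p; by rewrite mulN1r.
Qed.

Lemma rotD x y : rot (fun p => x p + y p) = (fun p => rot x p + rot y p) :> (N * bool -> R).
Proof. by apply/funext => -[j []]; rewrite /rot /= ?opprD. Qed.

Lemma rotB x y : rot (fun p => x p - y p) = (fun p => rot x p - rot y p) :> (N * bool -> R).
Proof. by apply/funext => -[j []]; rewrite /rot /= ?opprD. Qed.

Lemma rotZ a x : rot (fun p => a * x p) = (fun p => a * rot x p) :> (N * bool -> R).
Proof. by apply/funext => -[j []]; rewrite /rot /= ?mulrN. Qed.

Lemma imgD x y p : img (fun p => x p + y p) p = img x p + img y p.
Proof. by rewrite /img rotD !reD; case: ifP. Qed.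

Lemma l2_imgD x y : l2 (img (fun p => x p + y p)) <= l2 (img x) + l2 (img y).
Proof. by rewrite (eq_l2 (imgD x y)); exact: l2D. Qed.

Lemma l2_imgZ a x : l2 (img (fun p => a * x p)) = `|a| * l2 (img x).
Proof.
rewrite -l2Z; apply: eq_l2 => p; by rewrite /img rotZ !reZ; case: ifP.
Qed.

Lemma crsBl x y z i : crs (fun p => x p - y p) z i = crs x z i - crs y z i.
Proof. by rewrite /crs rotB !reB; ring. Qed.

Lemma crsBr x y z i : crs z (fun p => x p - y p) i = crs z x i - crs z y i.
Proof. by rewrite /crs rotB !reB; ring. Qed.

Lemma crsZZ a b x y i : crs (fun p => a * x p) (fun p => b * y p) i = a * b * crs x y i.
Proof. by rewrite /crs !rotZ !reZ; ring. Qed.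

Lemma crs_diff x y i : crs (fun p => x p - y p) (fun p => x p + y p) i = crs x x i - crs y y i.
Proof. by rewrite /crs rotB rotD !reB !reD; ring. Qed.

Lemma crs_phase al be x i : al ^+ 2 + be ^+ 2 = 1 ->
  crs (phase al be x) (phase al be x) i = crs x x i.
Proof.
move=> ab; rewrite /crs.
have -> : re (phase al be x) i = al * re x i + be * re (rot x) i by rewrite /phase reD !reZ.
have -> : re (rot (phase al be x)) i = al * re (rot x) i - be * re x i.
  rewrite -!reZ -reB; congr (re _ i); apply/funext => -[j []]; rewrite /phase /rot /=; ring.
rewrite -[RHS]mul1r -ab; ring.
Qed.

Lemma sum_crs_le x y : \sum_i `|crs x y i| <= l2 (img x) * l2 (img y).
Proof.
apply: (@le_trans _ _ (dot (fun p => `|img x p|) (fun p => `|img y p|))).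
  rewrite /dot sum_bool; apply: ler_sum => i _; rewrite /img /= -!normrM.
  exact: ler_normD.
apply: le_trans (dot_le _ _) _; apply: ler_pM; rewrite ?l2_ge0 //; apply: le_l2 => p;
by rewrite normr_id.
Qed.

Variables (s D : nat) (eps kap lev : R).
Hypothesis s0 : (0 < s)%N.
Hypothesis eps0 : 0 < eps.
Hypothesis eps24 : 24 * eps <= 1.
Hypothesis sD : s%:R <= eps * D%:R.
Hypothesis kap0 : 0 <= kap.
Hypothesis lev0 : 0 < lev.
Hypothesis kaplev : 9 * kap ^+ 2 * eps <= lev / 2.
Hypothesis kapS : forall x, (#|supp x| <= s)%N -> l2 (img x) <= kap * l2 x.
Let h : R := eps / Num.sqrt s%:R.
Hypothesis netlev : forall f g : {ffun N * bool -> code D},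
  f \in net (N * bool)%type s D -> g \in net (N * bool)%type s D ->
  act isR (pt h f) -> act isR (pt h g) ->
  2^-1 <= l2 (pt h f) ^+ 2 <= 1 -> 2^-1 <= l2 (pt h g) ^+ 2 <= 1 ->
  `|dot (pt h f) (rot (pt h g))| <= 4^-1 ->
  lev <= \sum_i `|crs (pt h f) (pt h g) i|.

Let q : R := Num.sqrt s%:R.
Let q0 : 0 < q. Proof. by rewrite sqrtr_gt0 ltr0n. Qed.

(** The sparse head of [x] is rounded with error [eps]; the tail has l2-norm at most [eps], and by
    [head_tail] its image has norm at most [2 * kap * eps]. So [3 * eps] serves for both the vector
    and its image. *)
Lemma net_cone x : act isR x -> l2 x = 1 -> l1 x <= eps * q ->
  exists f, [/\ f \in net (N * bool)%type s D, act isR (pt h f), 2^-1 <= l2 (pt h f) ^+ 2 <= 1,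
    l2 (fun p => x p - pt h f p) <= 3 * eps & l2 (img (fun p => x p - pt h f p)) <= 3 * eps * kap].
Proof.
move=> ax x1 xc.
have [H [Hs Htail Hinf]] := head_tail (phi := fun x => l2 (img x)) l2_imgD kap0 s0 kapS x.
have l1q : l1 x / q <= eps by rewrite ler_pdivrMr.
have l1q0 : 0 <= l1 x / q by rewrite divr_ge0 ?l1_ge0 // ltW.
set xh := restr H x; set xt := restr (~: H)%SET x in Htail Hinf.
have xt2 : l2 xt <= eps.
  apply: le_trans l1q; apply: l2_le => //; rewrite -sqr_l2.
  have h1 : l1 xt <= l1 x by rewrite [leRHS](l1_split H) lerDr l1_ge0.
  apply: le_trans (l2_le_l1_sup Hinf h1 _) _; first by rewrite divr_ge0 ?l1_ge0.
  by rewrite exprMn exprVn sqr_sqrtr ?ler0n // mulrAC -expr2.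
have hs : (#|supp xh| <= s)%N by apply: leq_trans Hs; apply: subset_leq_card; exact: supp_restr.
have h1 : l2 xh <= 1 by rewrite -x1 l2_restr.
have [f fn /= [e1 e2 e3 e4]] := net_approx s0 eps0 sD h1 hs.
rewrite -/h in e1 e2 e3 e4.
have split_x p : x p - pt h f p = (xh p - pt h f p) + xt p.
  by rewrite (restr_split H x) -/xh -/xt addrAC.
have d1 : l2 (fun p => x p - pt h f p) <= 3 * eps.
  rewrite (eq_l2 split_x); apply: le_trans (l2D _ _) _; have := eps0; lra.
exists f; split => //.
- by move=> hR j; apply: e3; rewrite /xh /restr; case: ifP => // _; exact: ax.
- have h2 : 1 - 3 * eps <= l2 (pt h f).
    have := l2_subr x (pt h f); rewrite x1; lra.
  have h3 : l2 (pt h f) <= 1 by apply: le_trans e2 h1.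
  have g0 := l2_ge0 (pt h f).
  have h4 : 7 / 8 <= l2 (pt h f).
    by apply: le_trans h2; have := eps24; lra.
  by apply/andP; split; [nra | rewrite expr_le1].
- have -> : (fun p => x p - pt h f p) = (fun p => (xh p - pt h f p) + xt p).
    by apply/funext => p; exact: split_x.
  apply: le_trans (l2_imgD _ _) _.
  have k1 : l2 (img (fun p => xh p - pt h f p)) <= kap * eps.
    by apply: le_trans (kapS e4) _; rewrite ler_wpM2l.
  have k2 : l2 (img xt) <= 2 * kap * eps.
    by apply: le_trans Htail _; rewrite ler_wpM2l // mulr_ge0.
  lra.
Qed.

(** Rounding destroys the exact orthogonality of [x] and [rot y], but only up to 1/8 for each
    vector, which is the 1/4 tolerated by [netlev]. The errors in the sum, 6 and 3 times
    [kap ^ 2 * eps], are covered by [kaplev]. *)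
Lemma cross_lower1 x y : act isR x -> act isR y -> l2 x = 1 -> l2 y = 1 ->
  l1 x <= eps * q -> l1 y <= eps * q -> dot x (rot y) = 0 ->
  lev / 2 <= \sum_i `|crs x y i|.
Proof.
move=> ax ay x1 y1 xc yc xy.
have [f [fn af lf df kf]] := net_cone ax x1 xc.
have [g [gn ag lg dg kg]] := net_cone ay y1 yc.
set x' := pt h f in af lf df kf; set y' := pt h g in ag lg dg kg.
set dx := (fun p => x p - x' p) in df kf; set dy := (fun p => y p - y' p) in dg kg.
have x'1 : l2 x' <= 1 by case/andP: lf => _; rewrite expr_le1 ?l2_ge0.
have e8 : 3 * eps <= 8^-1.
  by have := eps24; lra.
have dxy : `|dot x' (rot y')| <= 4^-1.
  have -> : dot x' (rot y') = dot x (rot y) - dot dx (rot y) - dot x' (rot dy).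
    have -> : dot x' (rot dy) = dot x' (rot y) - dot x' (rot y').
      by rewrite -dotBr; apply: eq_dot => // p; rewrite /dy rotB.
    by rewrite /dx dotBl; ring.
  rewrite xy sub0r -opprD normrN; apply: le_trans (ler_normD _ _) _.
  have h1 : `|dot dx (rot y)| <= 8^-1.
    apply: le_trans (dot_abs _ _) _; rewrite l2_rot y1 mulr1; exact: le_trans df e8.
  have h2 : `|dot x' (rot dy)| <= 8^-1.
    apply: le_trans (dot_abs _ _) _; rewrite l2_rot; apply: le_trans (le_trans dg e8).
    by rewrite ler_piMl ?l2_ge0.
  by apply: le_trans (lerD h1 h2) _; lra.
have H := netlev fn gn af ag lf lg dxy.
have xk : l2 (img x) <= 2 * kap.
  have -> : img x = img (fun p => x' p + dx p).
    by congr img; apply/funext => p; rewrite /dx addrC subrK.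
  apply: le_trans (l2_imgD _ _) _.
  have k1 : l2 (img x') <= kap.
    apply: (@le_trans _ _ (kap * l2 x')); last by rewrite ler_piMr.
    apply: kapS; have := fn; rewrite inE => /andP[c1 _]; apply: leq_trans c1.
    apply: subset_leq_card; apply/fintype.subsetP => p; rewrite !inE /x' /pt.
    by apply: contra => /eqP ->; rewrite mulr0.
  have : 3 * eps * kap <= kap by rewrite ler_piMl //; lra.
  lra.
have yk : l2 (img y) <= 2 * kap.
  have -> : img y = img (fun p => y' p + dy p).
    by congr img; apply/funext => p; rewrite /dy addrC subrK.
  apply: le_trans (l2_imgD _ _) _.
  have y'1 : l2 y' <= 1 by case/andP: lg => _; rewrite expr_le1 ?l2_ge0.
  have k1 : l2 (img y') <= kap.
    apply: (@le_trans _ _ (kap * l2 y')); last by rewrite ler_piMr.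
    apply: kapS; have := gn; rewrite inE => /andP[c1 _]; apply: leq_trans c1.
    apply: subset_leq_card; apply/fintype.subsetP => p; rewrite !inE /y' /pt.
    by apply: contra => /eqP ->; rewrite mulr0.
  have : 3 * eps * kap <= kap by rewrite ler_piMl //; lra.
  lra.
have x'k : l2 (img x') <= kap.
  apply: (@le_trans _ _ (kap * l2 x')); last by rewrite ler_piMr.
  apply: kapS; have := fn; rewrite inE => /andP[c1 _]; apply: leq_trans c1.
  apply: subset_leq_card; apply/fintype.subsetP => p; rewrite !inE /x' /pt.
  by apply: contra => /eqP ->; rewrite mulr0.
have b1 : \sum_i `|crs dx y i| <= 6 * kap ^+ 2 * eps.
  apply: le_trans (sum_crs_le _ _) _.
  apply: (@le_trans _ _ ((3 * eps * kap) * (2 * kap))); first by rewrite ler_pM ?l2_ge0.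
  by rewrite le_eqVlt; apply/orP; left; apply/eqP; ring.
have b2 : \sum_i `|crs x' dy i| <= 3 * kap ^+ 2 * eps.
  apply: le_trans (sum_crs_le _ _) _.
  apply: (@le_trans _ _ (kap * (3 * eps * kap))); first by rewrite ler_pM ?l2_ge0.
  by rewrite le_eqVlt; apply/orP; left; apply/eqP; ring.
have : \sum_i `|crs x' y' i| <= \sum_i `|crs x y i| + \sum_i `|crs dx y i| + \sum_i `|crs x' dy i|.
  rewrite -!big_split /=; apply: ler_sum => i _.
  have -> : crs x' y' i = crs x y i - crs dx y i - crs x' dy i.
    by rewrite crsBl crsBr; ring.
  apply: le_trans (ler_normB _ _) _; rewrite lerD2r; exact: ler_normB.
have := kaplev; lra.
Qed.

Lemma cross_lower x y : act isR x -> act isR y ->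
  l1 x <= eps * q * l2 x -> l1 y <= eps * q * l2 y -> dot x (rot y) = 0 ->
  lev / 2 * (l2 x * l2 y) <= \sum_i `|crs x y i|.
Proof.
move=> ax ay xc yc xy.
have [x0|x0] := eqVneq (l2 x) 0; first by rewrite x0 mul0r mulr0 sumr_ge0.
have [y0|y0] := eqVneq (l2 y) 0; first by rewrite y0 !mulr0 sumr_ge0.
have xp : 0 < l2 x by rewrite lt_neqAle eq_sym x0 l2_ge0.
have yp : 0 < l2 y by rewrite lt_neqAle eq_sym y0 l2_ge0.
have aZ (a : R) (z : N * bool -> R) : act isR z -> act isR (fun p => a * z p).
  by move=> az hR j; rewrite az // mulr0.
have nZ (z : N * bool -> R) : 0 < l2 z -> l2 (fun p => (l2 z)^-1 * z p) = 1.
  by move=> zp; rewrite l2Z ger0_norm ?invr_ge0 ?l2_ge0 // mulVf // gt_eqF.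
have cZ (z : N * bool -> R) : 0 < l2 z -> l1 z <= eps * q * l2 z -> l1 (fun p => (l2 z)^-1 * z p) <= eps * q.
  move=> zp zc; have -> : l1 (fun p => (l2 z)^-1 * z p) = l1 z / l2 z.
    rewrite /l1 mulr_suml; apply: eq_bigr => p _.
    by rewrite normrM ger0_norm ?invr_ge0 ?l2_ge0 // mulrC.
  by rewrite ler_pdivrMr.
have := cross_lower1 (aZ _ _ ax) (aZ _ _ ay) (nZ _ xp) (nZ _ yp) (cZ _ xp xc) (cZ _ yp yc).
rewrite rotZ dotZl dotZr xy !mulr0 => /(_ erefl) H.
rewrite -ler_pdivlMr ?mulr_gt0 //; apply: le_trans H _.
rewrite mulr_suml; apply: ler_sum => i _.
by rewrite crsZZ normrM [leRHS]mulrC invfM ger0_norm // mulr_ge0 // invr_ge0 l2_ge0.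
Qed.

Variables (k : nat) (CQ : R) (T : {set N}) (x0 xT w uq z : N * bool -> R).
Hypothesis x0E : forall p, x0 p = xT p + w p.
Hypothesis axT : act isR xT.
Hypothesis auq : act isR uq.
Hypothesis az : act isR z.
Hypothesis Tk : (#|T| <= k)%N.
Hypothesis ks : (2 * k <= s)%N.
Hypothesis ks' : 4 * 4 * Num.sqrt k%:R <= eps * q.
Hypothesis xTT : forall j b, j \notin T -> xT (j, b) = 0.
Hypothesis uqw : forall p, img uq p = img w p.
Hypothesis CQ1 : 1 <= CQ.
Hypothesis uq1 : cl1 uq <= CQ * q * l2 w.
Hypothesis wk : l2 (img w) <= kap * l2 w.
Hypothesis zx0 : forall i, crs z z i = crs x0 x0 i.
Hypothesis zmin : forall y, act isR y -> (forall i, crs y y i = crs x0 x0 i) -> cl1 z <= cl1 y.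

Lemma recovery : exists al be, [/\ al ^+ 2 + be ^+ 2 = 1, isR -> be = 0 &
  l2 (fun p => phase al be z p - x0 p) <= (8 * CQ / eps + 6 * kap ^+ 2 / lev + 1) * l2 w].
Proof.
have [al [be [ab beR dxz dxrz]]] := align axT az.
exists al, be; split => //.
set z' := phase al be z in dxz dxrz *.
pose u p := z' p - xT p; pose v p := z' p + xT p.
suff Hu : l2 u <= (8 * CQ / eps + 6 * kap ^+ 2 / lev) * l2 w.
  have -> : l2 (fun p => z' p - x0 p) = l2 (fun p => u p - w p).
    by apply: eq_l2 => p; rewrite x0E /u opprD addrA.
  by apply: le_trans (l2B _ _) _; rewrite mulrDl mul1r lerD2r.
have az' : act isR z'.
  by move=> hR j; rewrite /z' /phase (az hR) (beR hR) mul0r mulr0 addr0.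
have au : act isR u by move=> hR j; rewrite /u az' // axT // subr0.
have av : act isR v by move=> hR j; rewrite /v az' // axT // addr0.
have cz' : cl1 z' = cl1 z by apply: eq_bigr => j _; exact: ca_phase.
have crsz i : crs z' z' i = crs z z i by exact: crs_phase.
clearbody z'.
have imgE x y i : (forall p, img x p = img y p) -> crs x x i = crs y y i.
  by move=> e; have := e (i, true); have := e (i, false); rewrite /img /crs /= => -> ->.
have zmin' : cl1 z' <= cl1 xT + cl1 uq.
  rewrite cz'; apply: le_trans (cl1D _ _); apply: zmin.
    by move=> hR j; rewrite axT // auq // addr0.
  move=> i; apply: imgE => p; rewrite imgD uqw -imgD; congr (img _ p).
  by apply/funext => p'; rewrite x0E.
(* Nonnegativity of the aligned inner product makes the sum [v] dominate both the difference [u] and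
   [xT]. *)
have uv : l2 u <= l2 v /\ l2 xT <= l2 v.
  have hv : l2 v ^+ 2 = l2 z' ^+ 2 + l2 xT ^+ 2 + 2 * dot xT z'.
    by rewrite -!dot_self /v dotDl !dotDr (dotC z' xT); ring.
  have hu : l2 u ^+ 2 = l2 z' ^+ 2 + l2 xT ^+ 2 - 2 * dot xT z'.
    by rewrite -!dot_self /u dotBl !dotBr (dotC z' xT); ring.
  split; rewrite -(ler_pXn2r (n := 2)) ?nnegrE ?l2_ge0 // hv ?hu; first by lra.
  have := sqr_ge0 (l2 z'); lra.
case: uv => uv xTv.
have urv : dot u (rot v) = 0.
  rewrite /v rotD dotDr /u !dotBl !dot_rot dxrz dot_rotC dxrz; ring.
have sk0 : 0 <= Num.sqrt k%:R :> R by exact: sqrtr_ge0.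
have sqT : Num.sqrt #|T|%:R <= Num.sqrt k%:R :> R by rewrite ler_sqrt ?ler0n // ler_nat.
(* Minimality of [z]: outside [T] the moduli of [u] are those of [z'], and their sum exceeds what is
   lost on [T] by at most [cl1 uq]. *)
have cu : cl1 u <= 2 * Num.sqrt k%:R * l2 u + cl1 uq.
  have uT : \sum_(j in T) ca u j <= Num.sqrt k%:R * l2 u.
    rewrite -(l2_ca u); apply: (@le_trans _ _ (Num.sqrt #|T|%:R * l2 (ca u))).
      apply: le_trans (sum_le_l2 T (ca u)); apply: ler_sum => j _; exact: ler_norm.
    by rewrite ler_wpM2r ?l2_ge0.
  have split_sum (x : N * bool -> R) : cl1 x = \sum_(j in T) ca x j + \sum_(j | j \notin T) ca x j.
    by rewrite /cl1 (bigID (fun j => j \in T)).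
  have xTout : \sum_(j | j \notin T) ca xT j = 0.
    apply: big1 => j jT; rewrite /ca /l2 big1 ?sqrtr0 // => b _; by rewrite xTT // expr0n.
  have uout : \sum_(j | j \notin T) ca u j = \sum_(j | j \notin T) ca z' j.
    apply: eq_bigr => j jT; apply: eq_l2 => b; by rewrite /u xTT // subr0.
  have zT : \sum_(j in T) ca xT j - \sum_(j in T) ca u j <= \sum_(j in T) ca z' j.
    rewrite -sumrB; apply: ler_sum => j _; rewrite lerBlDr -lerBlDl.
    have -> : ca u j = ca (fun p => xT p - z' p) j.
      by rewrite /ca -[RHS]l2N; apply: eq_l2 => b; rewrite /u opprB.
    exact: ca_subr.
  move: zmin'; rewrite (split_sum z') (split_sum xT) (split_sum u) xTout uout; lra.
have l1u : l1 u <= 4 * Num.sqrt k%:R * l2 u + 2 * CQ * q * l2 w.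
  apply: le_trans (l1_le_cl1 u) _; have := uq1; lra.
have w0 := l2_ge0 w; have u0 := l2_ge0 u; have xT0 := l2_ge0 xT.
have r1 : 0 <= 8 * CQ / eps by rewrite divr_ge0 ?mulr_ge0 ?(ltW eps0) // (le_trans _ CQ1).
have r2 : 0 <= 6 * kap ^+ 2 / lev by rewrite divr_ge0 ?mulr_ge0 ?sqr_ge0 ?(ltW lev0).
have [uw|uw] := leP (l2 u) (8 * CQ / eps * l2 w).
  by apply: le_trans uw _; rewrite ler_wpM2r // lerDl.
have {}uw : 8 * (CQ * l2 w) < eps * l2 u.
  move: uw; rewrite mulrAC ltr_pdivrMr // => uw.
  by rewrite (mulrC eps) mulrA.
have uwq : 8 * (CQ * q * l2 w) <= eps * q * l2 u.
  have := ler_wpM2l (ltW q0) (ltW uw); lra.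
have ksu : 4 * 4 * Num.sqrt k%:R * l2 u <= eps * q * l2 u by rewrite ler_wpM2r.
have l1u' : l1 u <= 2^-1 * (eps * q * l2 u) by lra.
have equ : 0 <= eps * q * l2 u by rewrite !mulr_ge0 // ltW.
have eq0 : 0 <= eps * q by rewrite mulr_ge0 // ltW.
have l1v : l1 v <= eps * q * l2 v.
  have -> : l1 v = l1 (fun p => u p + 2 * xT p).
    by apply: eq_bigr => p _; congr (`|_|); rewrite /v /u; ring.
  apply: le_trans (l1D _ _) _.
  have -> : l1 (fun p => 2 * xT p) = 2 * l1 xT.
    by rewrite /l1 mulr_sumr; apply: eq_bigr => p _; rewrite normrM ger0_norm.
  have : l1 xT <= 2 * (Num.sqrt k%:R * l2 xT).
    apply: le_trans (l1_le_cl1 xT) _; rewrite ler_wpM2l //.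
    apply: le_trans (cl1_le xTT) _; by rewrite ler_wpM2r.
  have : 4 * 4 * Num.sqrt k%:R * l2 xT <= eps * q * l2 v by apply: ler_pM => //; rewrite mulr_ge0.
  have : eps * q * l2 u <= eps * q * l2 v by rewrite ler_wpM2l.
  lra.
have l1u'' : l1 u <= eps * q * l2 u by lra.
have low := cross_lower au av l1u'' l1v urv.
(* The difference of squared measurements factors once more, as the cross product of [w] with
   [x0 + xT = w + 2 xT]: the fixed vector is controlled by [wk], the sparse one by [kapS]. *)
have up : \sum_i `|crs u v i| <= kap * l2 w * (kap * (l2 w + 2 * l2 xT)).
  have -> : \sum_i `|crs u v i| = \sum_i `|crs w (fun p => x0 p + xT p) i|.
    apply: eq_bigr => i _; congr (`|_|).
    rewrite crs_diff crsz zx0 -crs_diff; congr (crs _ _ i).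
    by apply/funext => p; rewrite x0E addrC addKr.
  apply: le_trans (sum_crs_le _ _) _; apply: ler_pM; rewrite ?l2_ge0 //.
  have -> : img (fun p => x0 p + xT p) = img (fun p => w p + 2 * xT p).
    by congr img; apply/funext => p; rewrite x0E; ring.
  apply: le_trans (l2_imgD _ _) _; rewrite l2_imgZ ger0_norm // mulrDr; apply: lerD => //.
  (* Each index of [T] accounts for two real coordinates, hence the requirement [2 * k <= s]. *)
  rewrite mulrCA ler_wpM2l //; apply: kapS.
  apply: leq_trans ks; have Tk2 : (#|T| * 2 <= 2 * k)%N by rewrite mulnC leq_pmul2l.
  apply: leq_trans Tk2; rewrite -card_bool -cardsT -cardsX.
  apply: subset_leq_card; apply/fintype.subsetP => -[j b]; rewrite !inE andbT /=.
  by apply: contraR => jT; rewrite xTT.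
(* In this case [w] is also dominated by [v], so the upper bound has a factor [l2 v] that cancels
   against the lower bound. *)
have wv : l2 w <= l2 v.
  apply: le_trans uv; apply: le_trans (_ : CQ * l2 w <= _); first by rewrite ler_peMl.
  have e1 : eps <= 1 by have := eps24; have := eps0; lra.
  have : eps * l2 u <= l2 u by rewrite ler_piMl.
  have : 0 <= CQ * l2 w by rewrite mulr_ge0 // (le_trans _ CQ1).
  lra.
have v0 := l2_ge0 v.
have up3 : kap * l2 w * (kap * (l2 w + 2 * l2 xT)) <= 3 * kap ^+ 2 * l2 w * l2 v.
  rewrite (_ : 3 * kap ^+ 2 * l2 w * l2 v = kap * l2 w * (kap * (l2 v + 2 * l2 v))); last by ring.
  rewrite ler_wpM2l ?mulr_ge0 // ler_wpM2l //; lra.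
have [v00|v00] := eqVneq (l2 v) 0.
  by move: uv; rewrite v00 => u00; apply: le_trans u00 _; rewrite mulr_ge0 // addr_ge0.
have vp : 0 < l2 v by rewrite lt_neqAle eq_sym v00 l2_ge0.
have fin : lev / 2 * l2 u <= 3 * kap ^+ 2 * l2 w.
  rewrite -(ler_pM2r vp) -[leLHS]mulrA; exact: (le_trans low (le_trans up up3)).
apply: (@le_trans _ _ (6 * kap ^+ 2 / lev * l2 w)); last by rewrite ler_wpM2r // lerDr.
rewrite mulrAC ler_pdivlMr //; lra.
Qed.

End Recovery.

(** * Probability estimates *)

Section Entries.
Context d (T : measurableType d) (R : realType) (P : probability T R).

Lemma normal_law_mgf (s t : R) (X : T -> R) : s != 0 -> has_normal_law P s X ->
  (\int[P]_w (expR (t * X w))%:E = (expR (t ^+ 2 * s ^+ 2 / 2))%:E)%E.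
Proof.
move=> s0 [mX XP].
have mX' : measurable_fun setT (X : T -> measurableTypeR R) by [].
pose X' : {mfun T >-> measurableTypeR R} := HB.pack (X : T -> measurableTypeR R)
  (isMeasurableFun.Build _ _ _ _ (X : T -> measurableTypeR R) mX').
have mexp : measurable_fun setT (fun x : measurableTypeR R => (expR (t * x))%:E).
  apply/measurable_EFinP; apply: measurableT_comp => //; exact: mulrl_measurable.
rewrite -normal_mgf //.
transitivity (\int[distribution P X']_x (expR (t * x))%:E)%E.
  by rewrite ge0_integral_distribution // => y; rewrite lee_fin expR_ge0.
apply: eq_measure_integral => B mB _.
exact: XP.
Qed.

Variables (isR : bool) (m n : nat) (Are Aim : 'I_m -> 'I_n -> T -> R).

Definition entries (q : 'I_m * 'I_n * bool) : T -> R :=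
  if q.2 then Are q.1.1 q.1.2 else Aim q.1.1 q.1.2.

Lemma entries_gfam : std_gaussian P isR Are Aim -> gfam P entries (fun q => vF R isR q.2).
Proof.
rewrite /std_gaussian /vF; case: isR => [[h1 [h2 h3]]|[h1 [h2 h3]]]; last first.
  have s0 : Num.sqrt (2^-1) != 0 :> R by rewrite gt_eqF // sqrtr_gt0.
  have s2 : Num.sqrt (2^-1) ^+ 2 = 2^-1 :> R by rewrite sqr_sqrtr.
  split => //.
  - by move=> [[i j] []]; [exact: (h1 i j).1|exact: (h2 i j).1].
  - move=> [[i j] []] t.
      by have := normal_law_mgf t s0 (h1 i j); rewrite s2.
    by have := normal_law_mgf t s0 (h2 i j); rewrite s2.
  - by move=> q; rewrite invr_ge0 ler0n invf_le1 ?ler1n.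
have E0 i j w : entries (i, j, false) w = 0 by exact: h2.
split.
- move=> [[i j] []]; first exact: (h1 i j).1.
  rewrite (_ : entries _ = (fun=> 0)); first exact: measurable_cst.
  by apply/funext => w; rewrite E0.
- move=> B mB.
  have mA ij : measurable (Are ij.1 ij.2 @^-1` B (ij, true)).
    by rewrite -[X in measurable X]setTI; apply: (h1 ij.1 ij.2).1.
  have split_prod (F : 'I_m * 'I_n * bool -> \bar R) :
      \big[*%E/1%E]_q F q = (\big[*%E/1%E]_ij F (ij, true) * \big[*%E/1%E]_ij F (ij, false))%E.
    transitivity (\big[*%E/1%E]_ij \big[*%E/1%E]_b F (ij, b)).
      by rewrite pair_big; apply: eq_bigr => -[].
    rewrite -big_split; apply: eq_bigr => ij _; by rewrite big_bool.
  rewrite split_prod -(h3 (fun ij => B (ij, true))) //.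
  (* Imaginary entries are identically 0 here: either every constraint on them contains 0 and
     disappears, or both sides are 0. *)
  have [all0|] := pselect (forall ij, B (ij, false) 0).
    rewrite [X in (_ * X)%E]big1 ?mule1; last first.
      move=> [i j] _; rewrite (_ : _ @^-1` _ = setT); first exact: probability_setT.
      by apply/seteqP; split => w // _; rewrite /= E0; exact: all0.
    congr (P _); apply/seteqP; split => w h; first by move=> ij _; exact: (h (ij, true)).
    by case=> -[i j] [] _; [exact: (h (i, j))|rewrite /= E0; exact: all0].
  move=> /existsNP [[i j] nB].
  rewrite (_ : \bigcap_(q in _) _ = set0); last first.
    apply/seteqP; split => w // h; apply: nB; have := h (i, j, false) Logic.I.
    by rewrite /= E0.
  rewrite measure0 [X in (_ * X)%E](bigD1 (i, j)) //= (_ : _ @^-1` B (i, j, false) = set0).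
    by rewrite measure0 mul0e mule0.
  by apply/seteqP; split => w //=; rewrite E0 => /nB.
- move=> [[i j] []] t /=.
    by have := normal_law_mgf t (oner_neq0 R) (h1 i j); rewrite expr1n.
  rewrite mulr0 mul0r expR0 (eq_integral (fun=> 1%E)) => [|w _].
    by rewrite integral_cst // mul1e; exact: probability_setT.
  by rewrite E0 mulr0 expR0.
- by move=> [[i j] []] /=; rewrite ?lexx ?ler01.
Qed.

End Entries.

Lemma expR1_le4 (R : realType) : expR 1 <= 4 :> R.
Proof.
have h : expR (2^-1) <= 2 :> R.
  have := expR_ge1Dx (- 2^-1 : R); rewrite expRN => h.
  rewrite -[leRHS]invrK -[leLHS]invrK lef_pV2 ?posrE ?invr_gt0 ?expR_gt0 //; lra.
have -> : expR 1 = expR (2^-1) ^+ 2 :> R by rewrite -expRM_natl mulfV.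
rewrite (_ : 4 = 2 ^+ 2 :> R); last by ring.
by rewrite lerXn2r ?nnegrE ?expR_ge0.
Qed.

Lemma ln_le_id (R : realType) (x : R) : 0 < x -> ln x <= x - 1.
Proof. by move=> x0; have := expR_ge1Dx (ln x); rewrite lnK ?posrE //; lra. Qed.

Lemma ln_prod_le (R : realType) (a r l : R) : 0 < a -> 0 < r -> 0 < l ->
  ln (2 * (a * a * (r * l))) <= 2 * a + ln r + l - 2.
Proof.
move=> a0 r0 l0; rewrite lnM ?posrE ?mulr_gt0 // lnM ?posrE ?mulr_gt0 // (lnM (x := a)) ?posrE //.
rewrite (lnM (x := r)) ?posrE //.
have := ln_le_id a0; have := ln_le_id l0; have := ln_le_id (ltr0Sn R 1); lra.
Qed.

(** The sparsity is [eta ^ 2 * m / ell] rounded down, with [ell] of order log(e n / m); the 2 in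
    [ell] gives [ell >= 1] on the whole range [m <= e n]. The square of [eta] leaves a small factor
    even after the entropy has produced a term [2 / eta]. *)
Lemma sparsity_choice (R : realType) (c eps eta : R) (m n k : nat) :
  0 < c <= 1 -> 0 < eps <= 1 -> 0 < eta -> eta * (9 + 2 / eps) <= c ->
  (0 < k <= n)%N ->
  4 * (16 * 16) / (eps ^+ 2 * eta ^+ 2) * k%:R * ln (expR 1 * n%:R / k%:R) <= m%:R ->
  m%:R <= expR 1 * n%:R :> R ->
  let ell := 2 + ln (n%:R / m%:R : R) in
  exists s D : nat, [/\ [/\ (0 < m)%N, (0 < s <= n)%N, (2 * k <= s)%N & 1 <= ell],
    4 * 4 * Num.sqrt k%:R <= eps * Num.sqrt s%:R, s%:R <= eps * D%:R,
    eta ^+ 2 * m%:R <= 2 * ell * s%:R &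
    s%:R * (ln (n%:R / s%:R) + 4) + D%:R <= c * m%:R].
Proof.
move=> /andP[c0 c1] /andP[e0 e1] eta0 etac /andP[k0 kn] hm men ell.
have kp : 1 <= k%:R :> R by rewrite ler1n.
have knR : k%:R <= n%:R :> R by rewrite ler_nat.
have np : 0 < n%:R :> R by lra.
have kp0 : 0 < k%:R :> R by lra.
set X := ln _ in hm.
have XE : X = 1 + ln (n%:R / k%:R).
  by rewrite /X -mulrA lnM ?posrE ?expR_gt0 ?divr_gt0 // expRK.
have X1 : 1 <= X.
  by rewrite XE lerDl ln_ge0 // ler_pdivlMr // mul1r.
have eps2 : 0 < eps ^+ 2 by rewrite exprn_gt0.
have eta2 : 0 < eta ^+ 2 by rewrite exprn_gt0.
have iep : 1 <= eps^-1 by rewrite invf_ge1.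
have eta11 : 11 * eta <= 1 by nra.
have den1 : eps ^+ 2 * eta ^+ 2 <= 1.
  by rewrite mulr_ile1 ?sqr_ge0 // expr_le1 //; lra.
set C := 4 * (16 * 16) / _ in hm.
have den0 : 0 < eps ^+ 2 * eta ^+ 2 by rewrite mulr_gt0.
have CE : C * (eps ^+ 2 * eta ^+ 2) = 4 * (16 * 16) by rewrite /C divfK // gt_eqF.
have C0 : 0 < C by rewrite divr_gt0 // mulr_gt0 // mulr_gt0.
have C1 : 1 <= C by rewrite /C ler_pdivlMr // mul1r; apply: le_trans den1 _; rewrite -!natrM ler1n.
clearbody C.
have CkX : C * k%:R <= C * k%:R * X by rewrite ler_peMr // mulr_ge0 // ltW.
have km : k%:R <= m%:R :> R.
  by apply: le_trans hm; apply: le_trans CkX; rewrite ler_peMl // ltW.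
have mp : 0 < m%:R :> R by lra.
have m0 : (0 < m)%N by rewrite -(ltr0n R).
have lnm : -1 <= ln (n%:R / m%:R : R).
  rewrite -[leLHS]expRK ler_ln ?posrE ?expR_gt0 ?divr_gt0 //.
  by rewrite ler_pdivlMr // expRN mulrC ler_pdivrMr ?expR_gt0 // mulrC.
have ell1 : 1 <= ell by rewrite /ell; lra.
have ellX : ell <= 2 * X.
  have : ln (n%:R / m%:R : R) <= ln (n%:R / k%:R).
    by rewrite ler_ln ?posrE ?divr_gt0 // ler_pM2l // lef_pV2 ?posrE.
  rewrite /ell; lra.
have ellp : 0 < ell by lra.
set y := eta ^+ 2 * m%:R / ell.
have yE : y * ell = eta ^+ 2 * m%:R by rewrite /y divfK // gt_eqF.
have y0 : 0 <= y by rewrite divr_ge0 // ?mulr_ge0 // ltW.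
(* The sampling condition is spent here: it makes [16 * sqrt k] at most [eps * sqrt s], the factor 2
   covering the loss in rounding [y] down. *)
have yk : 2 * (16 * 16) * k%:R <= eps ^+ 2 * y.
  rewrite -(ler_pM2r ellp) -[leRHS]mulrA yE.
  apply: (@le_trans _ _ (2 * (16 * 16) * k%:R * (2 * X))).
    by rewrite ler_pM2l // mulr_gt0.
  rewrite (_ : _ * (2 * X) = (4 * (16 * 16)) * (k%:R * X)); last by ring.
  rewrite -CE (_ : _ * _ = eps ^+ 2 * (eta ^+ 2 * (C * k%:R * X))); last by ring.
  by rewrite ler_pM2l // ler_pM2l.
pose s := Num.truncn y.
have /andP[s1 s2] := truncn_itv y0; rewrite -/s -natr1 in s1 s2.
have eyy : eps ^+ 2 * y <= y by rewrite ler_piMl // expr_le1 // ltW.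
have y2 : 4 * k%:R <= y by apply: le_trans eyy; apply: le_trans yk; rewrite ler_pM2r // -!natrM ler_nat.
have sy : y <= 2 * s%:R by lra.
have sp : 1 <= s%:R :> R.
  by rewrite ler1n -(ltr0n R); lra.
have sp0 : 0 < s%:R :> R by lra.
pose D := (Num.truncn (s%:R / eps)).+1.
have se0 : 0 <= s%:R / eps by rewrite divr_ge0 // ltW.
have /andP[D1 D2] := truncn_itv se0.
exists s, D.
have Dle : D%:R <= 2 / eps * s%:R.
  rewrite /D -natr1.
  have : 1 <= s%:R / eps by rewrite ler_pdivlMr // mul1r; lra.
  rewrite (_ : 2 / eps * s%:R = s%:R / eps + s%:R / eps); last by ring.
  by move=> h; apply: lerD.
split.
- split => //.
  + rewrite -(ltr0n R) sp0 /= -(ler_nat R); apply: le_trans s1 _.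
    apply: (@le_trans _ _ (eta ^+ 2 * m%:R)).
      by rewrite /y ler_pdivrMr // ler_peMr // mulr_ge0 // ltW.
    apply: (@le_trans _ _ (eta ^+ 2 * (4 * n%:R))).
      rewrite ler_pM2l //; apply: le_trans men _; rewrite ler_pM2r //; exact: expR1_le4.
    rewrite mulrA ler_piMl ?ltW //.
    have : eta ^+ 2 <= eta * 1 by rewrite expr2 ler_pM2l //; lra.
    lra.
  + rewrite -(ler_nat R) natrM; lra.
- rewrite -(ler_pXn2r (n := 2)) ?nnegrE ?mulr_ge0 ?sqrtr_ge0 ?(ltW e0) //.
  rewrite !exprMn !sqr_sqrtr ?ler0n //.
  have : eps ^+ 2 * y <= eps ^+ 2 * (2 * s%:R) by rewrite ler_pM2l.
  move=> h; rewrite (_ : 4 ^+ 2 * 4 ^+ 2 = 16 * 16 :> R); last by ring.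
  lra.
- rewrite mulrC -ler_pdivrMr //; exact: ltW.
- rewrite -yE (_ : 2 * ell * s%:R = 2 * s%:R * ell); last by ring.
  by rewrite ler_pM2r.
- have lns : ln (n%:R / s%:R) <= 1 + 2 / eta + 2 * ell.
    have b : n%:R / s%:R <= 2 * (eta^-1 * eta^-1 * (n%:R / m%:R * ell)).
      rewrite ler_pdivrMr // (_ : _ * s%:R = n%:R * (2 * s%:R * ell / (eta ^+ 2 * m%:R))); last first.
        by field; rewrite !lt0r_neq0.
      by rewrite ler_peMr ?ler_pdivlMr ?mulr_gt0 // ?mul1r -?yE ?ler_pM2r // ltW.
    have ei : 0 < eta^-1 by rewrite invr_gt0.
    have nm : 0 < n%:R / m%:R :> R by rewrite divr_gt0.
    apply: (@le_trans _ _ (ln (2 * (eta^-1 * eta^-1 * (n%:R / m%:R * ell))))).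
      have rp : 0 < 2 * (eta^-1 * eta^-1 * (n%:R / m%:R * ell)) by rewrite !mulr_gt0 ?invr_gt0.
      by rewrite ler_ln ?posrE // divr_gt0.
    apply: le_trans (ln_prod_le ei nm ellp) _; rewrite /ell; lra.
  apply: (@le_trans _ _ (s%:R * (5 + 2 / eta + 2 * ell + 2 / eps))).
    rewrite (_ : s%:R * (5 + _ + _ + _) = s%:R * (1 + 2 / eta + 2 * ell + 4) + 2 / eps * s%:R); last by ring.
    by apply: lerD => //; rewrite ler_pM2l // lerD2r.
  have ei : 0 <= 2 / eta by rewrite divr_ge0 // ltW.
  have ep : 0 <= 2 / eps by rewrite divr_ge0 // ltW.
  apply: (@le_trans _ _ (y * (ell * (7 + 2 / eta + 2 / eps)))).
    apply: ler_pM => //.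
      by rewrite !addr_ge0 // mulr_ge0 // ltW.
    rewrite -subr_ge0 (_ : _ - _ = (5 + 2 / eta + 2 / eps) * (ell - 1)); last by ring.
    by rewrite mulr_ge0 ?subr_ge0 // !addr_ge0.
  rewrite mulrA yE (_ : _ * (7 + _ + _) = m%:R * (eta * (eta * (7 + 2 / eps) + 2))); last first.
    by field; rewrite !lt0r_neq0.
  rewrite mulrC ler_pM2r //; apply: le_trans etac; rewrite ler_pM2l //.
  have : eta * (7 + 2 / eps) <= 1 * (7 + 2 / eps) by rewrite ler_wpM2r //; lra.
  lra.
Qed.

(** Weight s / n in [card_net] gives the usual entropy: the inverse power is exp(s ln(n/s)), and by
    [exp_1D2] the product over coordinates costs only exp(O(s)). *)
Lemma exp_pow_ratio (R : realType) (n s : nat) : (0 < n)%N -> (0 < s)%N ->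
  ((s%:R / n%:R)^-1 : R) ^+ s = expR (s%:R * ln (n%:R / s%:R)).
Proof.
by move=> n0 s0; rewrite invf_div expRM_natl lnK // posrE divr_gt0 // ltr0n.
Qed.

Lemma exp_1D2 (R : realType) (n s c : nat) : (0 < n)%N ->
  (1 + 2 * (s%:R / n%:R) : R) ^+ (c * n) <= expR (2 * c%:R * s%:R).
Proof.
move=> n0; have np : 0 < n%:R :> R by rewrite ltr0n.
have h : 0 <= s%:R / n%:R :> R by rewrite divr_ge0.
have -> : 2 * c%:R * s%:R = (c * n)%:R * (2 * (s%:R / n%:R)) :> R.
  by rewrite natrM; field; rewrite gt_eqF.
rewrite expRM_natl lerXn2r ?nnegrE ?expR_ge0 ?addr_ge0 ?mulr_ge0 //.
exact: expR_ge1Dx.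
Qed.

Section QuotientExact.
Context d (T : measurableType d) (R : realType) (P : probability T R).
Variables (K N : finType) (G : K * N -> T -> R) (v : K * N -> R).
Hypothesis gG : gfam P G v.
Hypothesis v2 : forall q, 2^-1 <= v q.
Hypothesis K0 : (0 < #|K|)%N.

(** [quotient_event] is applied with [rho] the fourth root of the aspect ratio and [a = 72], whose
    square 5184 just exceeds 16 * 16 * 20 = 5120. The bound [expR (40 * 80)] provides
    [2 * ln rho >= 80 ^ 2]. *)
Lemma quotient_exact (r0 : R) : 16 * (8 * 9 + 4) <= r0 -> expR (40 * 80) <= r0 ->
  r0 ^+ 4 * #|K|%:R <= #|N|%:R ->
  exists (lam : R) (E : set T), [/\ 0 < lam, lam ^+ 2 = 2^-1 * ln (#|N|%:R / #|K|%:R), 3 <= lam,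
    measurable E /\ Pr P (~` E) <= 2 * expR (- #|K|%:R) &
    forall w, E w -> forall e, exists u : N -> R,
      (forall k, mv (Mat G w) u k = e k) /\ l1 u <= 3 * 32 / lam * l2 e].
Proof.
move=> h1 h2 h3.
have kp : 0 < #|K|%:R :> R by rewrite ltr0n.
have rp : 0 < r0 by apply: lt_le_trans h2; exact: expR_gt0.
set t := #|N|%:R / #|K|%:R.
have t4 : r0 ^+ 4 <= t by rewrite /t ler_pdivlMr.
have t0 : 0 <= t by apply: le_trans t4; rewrite exprn_ge0 // ltW.
pose rho := Num.sqrt (Num.sqrt t).
have rho4 : rho ^+ 4 = t by rewrite (exprM rho 2 2) sqr_sqrtr ?sqrtr_ge0 // sqr_sqrtr.
have rr : r0 <= rho.
  by rewrite -(ler_pXn2r (n := 4)) ?nnegrE ?sqrtr_ge0 ?(ltW rp) // rho4.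
have rhop : 0 < rho by apply: lt_le_trans rr.
have lnr : 40 * 80 <= ln rho.
  rewrite -[leLHS]expRK ler_ln ?posrE ?expR_gt0 //; exact: le_trans h2 rr.
have l80 : 80 ^+ 2 <= 2 * ln rho.
  rewrite (_ : 80 ^+ 2 = 2 * (40 * 80)); last by ring.
  by rewrite ler_pM2l.
have a0 : 0 < 8 * 9 :> R by rewrite mulr_gt0.
have a2 : 16 * (16 * 20) < (8 * 9) ^+ 2 :> R.
  rewrite (_ : (8 * 9) ^+ 2 = 16 * (16 * 20 + 4)); last by ring.
  by rewrite ltr_pM2l // ltrDl.
have rn : rho ^+ 4 * #|K|%:R = #|N|%:R by rewrite rho4 /t divfK // gt_eqF.
have [E [mE PE HE]] := quotient_event gG v2 K0 a0 a2 (le_trans h1 rr) l80 rn.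
set lam := Num.sqrt (2 * ln rho) in HE.
have lam2 : lam ^+ 2 = 2 * ln rho.
  by rewrite sqr_sqrtr //; apply: le_trans l80; exact: sqr_ge0.
have lam80 : 80 <= lam by rewrite -(ler_pXn2r (n := 2)) ?nnegrE ?sqrtr_ge0 // lam2.
have lam0 : 0 < lam by apply: lt_le_trans lam80.
exists lam, E; split => //.
- have l4 : ln t = 4 * ln rho by rewrite -rho4 lnXn // mulr_natl.
  by rewrite lam2 l4; field.
- by apply: le_trans lam80; rewrite ler_nat.
- move=> w Ew e.
  have c0 : 0 < lam / 32 by rewrite divr_gt0.
  have [u [u1 u2]] := pursuit c0 (HE w Ew) e.
  exists u; split => //; apply: le_trans u2 _.
  by rewrite le_eqVlt; apply/orP; left; apply/eqP; field; rewrite gt_eqF.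
Qed.

End QuotientExact.

Section Events.
Context d (T : measurableType d) (R : realType) (P : probability T R).
Variables (isR : bool) (M N : finType) (G : M * N * bool -> T -> R).
Hypothesis gG : gfam P G (fun q => vF R isR q.2).
Hypothesis G0 : isR -> forall i j w, G (i, j, false) w = 0.
Hypothesis M0 : (0 < #|M|)%N.

Definition half (b : bool) : M * N -> T -> R := fun q => G (q, b).
Definition part (b : bool) (x : N * bool -> R) : N -> R := fun j => x (j, b).

Lemma half_gfam b : gfam P (half b) (fun _ => vF R isR b).
Proof. by apply: (gfam_sub (f := fun q => (q, b)) _ gG) => q1 q2 []. Qed.

Lemma reA_mv w x i : reA G w x i =
  mv (Mat (half true) w) (part true x) i - mv (Mat (half false) w) (part false x) i.
Proof.
rewrite /reA /lin.
transitivity (\sum_q (if q.1.1 == i then (if q.2 then x (q.1.2, true) else - x (q.1.2, false)) * G q w else 0)).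
  by apply: eq_bigr => q _; rewrite /cre; case: ifP => //; rewrite mul0r.
rewrite (@sum_row R M N (fun q => (if q.2 then x (q.1.2, true) else - x (q.1.2, false)) * G q w) i).
rewrite sum_bool /mv -sumrB; apply: eq_bigr => j _ /=.
by rewrite /part /Mat /half /=; ring.
Qed.

Lemma reA_D w x y i : reA G w (fun p => x p + y p) i = reA G w x i + reA G w y i.
Proof. by rewrite !reA_mv /part !mvD; ring. Qed.

Lemma reA_Z w a x i : reA G w (fun p => a * x p) i = a * reA G w x i.
Proof. by rewrite !reA_mv /part !mvZ; ring. Qed.

Lemma l2_part b x : l2 (part b x) <= l2 x.
Proof.
rewrite -(ler_pXn2r (n := 2)) ?nnegrE ?l2_ge0 // !sqr_l2 sum_bool; apply: ler_sum => j _.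
by case: b; rewrite /part ?lerDl ?lerDr sqr_ge0.
Qed.

Lemma supp_part b x (s : nat) : (#|supp x| <= s)%N -> (#|supp (part b x)| <= s)%N.
Proof.
apply: leq_trans; rewrite -(card_imset (f := fun j => (j, b))); last by move=> j1 j2 [].
apply: subset_leq_card; apply/fintype.subsetP => _ /imsetP[j jx ->].
by move: jx; rewrite !inE.
Qed.

Lemma l2_img_parts w x (c : R) : (forall b b', l2 (mv (Mat (half b) w) (part b' x)) <= c) ->
  l2 (img (reA G w) x) <= 4 * c.
Proof.
move=> h; have c0 : 0 <= c by apply: le_trans (h true true); exact: l2_ge0.
have re2 : l2 (reA G w x) <= 2 * c.
  rewrite (eq_l2 (reA_mv w x)); apply: le_trans (l2B _ _) _.
  by rewrite mulr_natl mulr2n lerD.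
have im2 : l2 (reA G w (rot x)) <= 2 * c.
  rewrite (eq_l2 (reA_mv w (rot x))); apply: le_trans (l2B _ _) _.
  rewrite mulr_natl mulr2n lerD //; first exact: (h true false).
  apply: le_trans (h false true); rewrite -l2N le_eqVlt; apply/orP; left; apply/eqP/eq_l2 => k.
  by rewrite -sumrN; apply: eq_bigr => j _; rewrite /part /rot /=; ring.
apply: l2_le; first by rewrite mulr_ge0.
rewrite sum_bool big_split /= -!sqr_l2 -/(reA G w x) -/(reA G w (rot x)).
have := l2_ge0 (reA G w x); have := l2_ge0 (reA G w (rot x)); nra.
Qed.

(** Six bad events: sparse vectors for the real and the imaginary part of the matrix, and each of
    these parts on the two real parts of the fixed vector [w0]. *)
Lemma sparse_event (s : nat) (t th b : R) (w0 : N * bool -> R) : 0 <= t -> 0 < th <= 1 ->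
  th^-1 ^+ s * 2 ^+ (2 * s) * (1 + 2 * th) ^+ #|N| * (12 ^+ #|M| * expR (- (t ^+ 2 / 2))) <= b ->
  12 ^+ #|M| * expR (- (t ^+ 2 / 2)) <= b ->
  exists E : set T, [/\ measurable E, Pr P (~` E) <= 6 * b &
    forall w, E w -> (forall x, (#|supp x| <= s)%N -> l2 (img (reA G w) x) <= 16 * t * l2 x) /\
      l2 (img (reA G w) w0) <= 16 * t * l2 w0].
Proof.
move=> t0 th01 b1 b2.
pose x b' : N -> R := fun j => (l2 w0)^-1 * part b' w0 j.
have x1 b' : l2 (x b') <= 1.
  rewrite /x l2Z ger0_norm ?invr_ge0 ?l2_ge0 //.
  have [->|w1] := eqVneq (l2 w0) 0; first by rewrite invr0 mul0r.
  have wp : 0 < l2 w0 by rewrite lt_neqAle eq_sym w1 l2_ge0.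
  by rewrite mulrC ler_pdivrMr // mul1r l2_part.
pose U a := badU (half a) s t.
pose V a b' := badV (half a) t (x b').
have mU a : measurable (U a) by exact: measurable_badU (half_gfam a) _ _.
have mV a b' : measurable (V a b') by exact: measurable_badV (half_gfam a) _ _.
have PU a : Pr P (U a) <= b by apply: le_trans b1; exact: (Pr_badU (half_gfam a)).
have PV a b' : Pr P (V a b') <= b by apply: le_trans b2; exact: (Pr_badV (half_gfam a)).
pose B := U true `|` U false `|` (V true true `|` V true false) `|` (V false true `|` V false false).
have mB : measurable B by do ! apply: measurableU.
exists (~` B); split; first exact: measurableC.
- rewrite setCK.
  have h1 := PU true; have h2 := PU false; have h3 := PV true true; have h4 := PV true false.
  have h5 := PV false true; have h6 := PV false false.
  have k1 := PrU P (mV true true) (mV true false).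
  have k2 := PrU P (mV false true) (mV false false).
  have k3 := PrU P (mU true) (mU false).
  have k4 := PrU P (measurableU _ _ (mU true) (mU false)) (measurableU _ _ (mV true true) (mV true false)).
  have k5 := PrU P (measurableU _ _ (measurableU _ _ (mU true) (mU false))
     (measurableU _ _ (mV true true) (mV true false))) (measurableU _ _ (mV false true) (mV false false)).
  by rewrite /B; lra.
- move=> w nB.
  have nU a : (~` U a) w by move=> h; apply: nB; do 2 left; case: a h; [left|right].
  have nV a b' : (~` V a b') w.
    move=> h; apply: nB; case: a h => h; [left; right|right]; case: b' h => h; [left|right|left|right] => //.
  split.
    move=> y ys; rewrite (_ : 16 * t * l2 y = 4 * (4 * t * l2 y)); last by ring.
    apply: l2_img_parts => a b'.
    apply: le_trans (not_badU M0 t0 (nU a) (supp_part b' ys)) _.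
    by rewrite ler_wpM2l ?mulr_ge0 // l2_part.
  rewrite (_ : 16 * t * l2 w0 = 4 * (4 * t * l2 w0)); last by ring.
  apply: l2_img_parts => a b'.
  have h := not_badV M0 t0 (nV a b').
  have -> : l2 (mv (Mat (half a) w) (part b' w0)) = l2 w0 * l2 (mv (Mat (half a) w) (x b')).
    rewrite -[X in _ = X * _](ger0_norm (l2_ge0 w0)) -l2Z.
    apply: eq_l2 => k; rewrite -mvZ; apply: eq_bigr => j _; congr (_ * _).
    rewrite /x mulrA; have [w1|w1] := eqVneq (l2 w0) 0; last by rewrite mulfV // mul1r.
    by rewrite /part (l2_0E w1) mulr0.
  rewrite mulrC ler_wpM2r ?l2_ge0 //; apply: le_trans h _; rewrite ler_wpM2r // ler_nat //.
Qed.

(** A preimage with real coefficients suffices. Over the complex numbers the matrix then acts as a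
    real one with [2 * #|M|] independent rows, which explains the factor 2 in the aspect ratio; over
    the reals only the real half is used. *)
Lemma quotient_lift (r0 : R) : 16 * (8 * 9 + 4) <= r0 -> expR (40 * 80) <= r0 ->
  2 * r0 ^+ 4 * #|M|%:R <= #|N|%:R ->
  exists (lam : R) (E : set T), [/\ 0 < lam, 2^-1 * ln (#|N|%:R / (2 * #|M|%:R)) <= lam ^+ 2,
    3 <= lam, measurable E /\ Pr P (~` E) <= 2 * expR (- #|M|%:R) &
    forall w, E w -> forall y, act isR y -> exists uq : N * bool -> R,
      [/\ act isR uq, forall p, img (reA G w) uq p = img (reA G w) y p &
        cl1 uq <= 3 * 32 / lam * l2 (img (reA G w) y)]].
Proof.
move=> h1 h2 h3.
have mp : 0 < #|M|%:R :> R by rewrite ltr0n.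
have rp : 0 < r0 by apply: lt_le_trans h2; exact: expR_gt0.
have r4 : 0 < r0 ^+ 4 by rewrite exprn_gt0.
have np : 0 < #|N|%:R :> R by apply: lt_le_trans h3; rewrite !mulr_gt0.
pose lift (u : N -> R) : N * bool -> R := fun p => if p.2 then u p.1 else 0.
have lift_act u : act isR (lift u) by [].
have lift_cl1 u : cl1 (lift u) = l1 u.
  apply: eq_bigr => j _; rewrite /ca /l2 big_bool /lift /= expr0n addr0; exact: sqrtr_sqr.
have lift_img u w i b : img (reA G w) (lift u) (i, b) = mv (Mat (half b) w) u i.
  case: b; rewrite /img /= reA_mv.
    rewrite [X in _ - X](_ : _ = 0) ?subr0 //.
    by rewrite /mv big1 // => j _; rewrite /part /lift /= mulr0.
  rewrite [X in X - _](_ : _ = 0) ?sub0r; last first.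
    by rewrite /mv big1 // => j _; rewrite /part /rot /lift /= mulr0.
  by rewrite /mv -sumrN; apply: eq_bigr => j _; rewrite /part /rot /lift /=; ring.
have [hR|hR] := boolP isR.
  have v2 (q : M * N) : 2^-1 <= vF R isR true.
    by rewrite /vF hR invf_le1 // ler1n.
  have h3' : r0 ^+ 4 * #|M|%:R <= #|N|%:R.
    by apply: le_trans h3; rewrite -mulrA ler_peMl ?ler1n // mulr_ge0 ?ltW.
  have [lam [E [l0 l2E l3 [mE PE] HE]]] := quotient_exact (half_gfam true) v2 M0 h1 h2 h3'.
  exists lam, E; split => //.
    rewrite l2E ler_pM2l ?invr_gt0 // ler_ln ?posrE ?divr_gt0 ?mulr_gt0 //.
    by rewrite ler_pM2l // lef_pV2 ?posrE ?mulr_gt0 // ler_peMl ?ler1n // ltW.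
  move=> w Ew y ay.
  have F0 x i : mv (Mat (half false) w) x i = 0.
    by rewrite /mv big1 // => j _; rewrite /Mat /half G0 ?mul0r.
  have [u [u1 u2]] := HE w Ew (reA G w y).
  exists (lift u); split => //.
    move=> [i []]; rewrite lift_img; first exact: u1.
    rewrite F0 /img /= reA_mv F0 subr0 /mv big1 // => j _.
    by rewrite /part /rot /= ay // mulr0.
  rewrite lift_cl1; apply: le_trans u2 _; rewrite ler_wpM2l ?divr_ge0 ?mulr_ge0 ?(ltW l0) //.
  rewrite -(ler_pXn2r (n := 2)) ?nnegrE ?l2_ge0 // !sqr_l2 sum_bool; apply: ler_sum => i _.
  by rewrite /img /= lerDl sqr_ge0.
pose f (q : M * bool * N) : M * N * bool := (q.1.1, q.2, q.1.2).
have fi : injective f by move=> [[i b] j] [[i' b'] j'] [-> -> ->].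
have gf := gfam_sub fi gG.
have v2 (q : M * bool * N) : 2^-1 <= vF R isR (f q).2 by rewrite /vF (negPf hR).
have cK : #|{: M * bool}| = (#|M| * 2)%N by rewrite card_prod card_bool.
have K0 : (0 < #|{: M * bool}|)%N by rewrite cK muln_gt0 M0.
have h3' : r0 ^+ 4 * #|{: M * bool}|%:R <= #|N|%:R.
  by apply: le_trans h3; rewrite cK natrM le_eqVlt; apply/orP; left; apply/eqP; ring.
have [lam [E [l0 l2E l3 [mE PE] HE]]] := quotient_exact gf v2 K0 h1 h2 h3'.
exists lam, E; split => //.
- by rewrite l2E cK natrM (mulrC 2).
- split => //; apply: le_trans PE _; rewrite ler_pM2l // ler_expR lerN2 cK natrM.
  by rewrite ler_peMr ?ler1n // ltW.
- move=> w Ew y ay; have [u [u1 u2]] := HE w Ew (img (reA G w) y).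
  exists (lift u); split => //; last by rewrite lift_cl1.
  by move=> [i b]; rewrite lift_img -u1.
Qed.

End Events.

(** * Constants and assembly of the events *)

Section Constants.
Variable R : realType.
(* Chosen so that [9 * kap ^ 2 * cone_eps = lev / 2] for
   [kap ^ 2 = 16 * 16 * 12 * m] and [lev = p0 * m / 4]. *)
Definition cone_eps : R := p0 / (8 * (9 * (16 * 16 * 12))).
(** Equality in the condition of [sparsity_choice] with entropy budget [c = p0 / 16]: a union bound
    over pairs then uses half of the exponent [p0 * m / 4]. *)
Definition sparse_eta : R := (p0 / 16) / (9 + 2 / cone_eps).
Definition wide_r0 : R := 16 * (8 * 9 + 4) + expR (40 * 80).
(* Ratio [n / m] above which columns correlate well with every vector; below
   it, [w] itself serves as the short preimage of [A w]. *)
Definition wide : R := 2 * wide_r0 ^+ 4.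
(** The second summand serves the regime where n / m is bounded, the third the wide regime; adding 1
    permits [sqrt_bound], which replaces a square root of the constant by the constant itself. *)
Definition quot_const : R := 1 + 2 * wide * (1 + wide) / sparse_eta ^+ 2 +
  (3 * 32 * 16) ^+ 2 * (12 * 6) / sparse_eta ^+ 2.
Definition sample_const : R := 4 * (16 * 16) / (cone_eps ^+ 2 * sparse_eta ^+ 2).
(** The constant of [recovery] after inserting [kap] and [lev], in which [m] cancels. *)
Definition error_const : R := 8 * quot_const / cone_eps + 6 * (4 * (16 * 16 * 12)) / p0 + 1.

Lemma p0_gt0 : 0 < p0 :> R.
Proof. by rewrite /p0 mulr_gt0 ?invr_gt0 ?expR_gt0. Qed.

Lemma p0_le4 : p0 <= 4^-1 :> R.
Proof.
rewrite /p0 ler_piMr ?invr_ge0 // -expR0 ler_expR oppr_le0 mulr_ge0 ?sqr_ge0 //.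
Qed.

Let den1 : 0 < 8 * (9 * (16 * 16 * 12)) :> R.
Proof. by rewrite !mulr_gt0. Qed.

Lemma cone_epsE : 9 * (16 * 16 * 12) * cone_eps = p0 / 8.
Proof. by rewrite /cone_eps; field. Qed.

Lemma cone_eps_gt0 : 0 < cone_eps.
Proof. by rewrite divr_gt0 ?p0_gt0. Qed.

Lemma cone_eps_le : 24 * cone_eps <= 1.
Proof.
have h : 1 * cone_eps <= 16 * 12 * cone_eps.
  by rewrite ler_pM2r ?cone_eps_gt0 // -natrM ler1n.
have := cone_epsE; have := p0_le4; have := cone_eps_gt0.
rewrite (_ : 9 * (16 * 16 * 12) * cone_eps = 9 * 16 * (16 * 12 * cone_eps)); last by ring.
lra.
Qed.

Lemma sparse_eta_gt0 : 0 < sparse_eta.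
Proof.
by rewrite !divr_gt0 ?p0_gt0 // addr_gt0 // divr_gt0 // cone_eps_gt0.
Qed.

Lemma sparse_etaE : sparse_eta * (9 + 2 / cone_eps) = p0 / 16.
Proof.
by rewrite /sparse_eta divfK // gt_eqF // addr_gt0 // divr_gt0 // cone_eps_gt0.
Qed.

Lemma wide_ge1 : 1 <= wide.
Proof.
have h : 1 <= wide_r0.
  rewrite /wide_r0; have := expR_gt0 (40 * 80 : R); set e := expR _; lra.
rewrite /wide; have : 1 <= wide_r0 ^+ 4 by rewrite exprn_ege1.
lra.
Qed.

Lemma quot_const_ge1 : 1 <= quot_const.
Proof.
have w1 := wide_ge1; have e2 : 0 < sparse_eta ^+ 2 by rewrite exprn_gt0 // sparse_eta_gt0.
rewrite /quot_const -addrA lerDl addr_ge0 // divr_ge0 ?(ltW e2) //.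
  by rewrite !mulr_ge0 ?addr_ge0 // (le_trans _ w1).
Qed.

Lemma sample_const_gt0 : 0 < sample_const.
Proof.
have h1 : 0 < cone_eps ^+ 2 by rewrite exprn_gt0 // cone_eps_gt0.
have h2 : 0 < sparse_eta ^+ 2 by rewrite exprn_gt0 // sparse_eta_gt0.
by apply: divr_gt0; [rewrite !mulr_gt0|exact: mulr_gt0].
Qed.

Lemma error_const_gt0 : 0 < error_const.
Proof.
have q1 := quot_const_ge1; have e1 := cone_eps_gt0; have e2 := p0_gt0.
rewrite /error_const; apply: addr_gt0 => //; apply: addr_gt0; rewrite divr_gt0 // !mulr_gt0 //.
by apply: lt_le_trans q1.
Qed.

Lemma sqrt_bound (a b c x : R) : 0 <= x -> 1 <= c -> 0 <= a -> 0 <= b -> a ^+ 2 <= c * b ->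
  a * x <= c * Num.sqrt b * x.
Proof.
move=> x0 c1 a0 b0 h; rewrite ler_wpM2r //.
rewrite -(ler_pXn2r (n := 2)) ?nnegrE ?mulr_ge0 ?sqrtr_ge0 ?(le_trans _ c1) //.
rewrite exprMn sqr_sqrtr //; apply: le_trans h _; rewrite ler_wpM2r //.
by rewrite expr2 ler_peMr // (le_trans _ c1).
Qed.

Lemma ler_pM3 (a b c a' b' c' : R) : 0 <= a -> 0 <= b -> 0 <= c ->
  a <= a' -> b <= b' -> c <= c' -> a * b * c <= a' * b' * c'.
Proof. by move=> a0 b0 c0 ha hb hc; apply: ler_pM => //; [exact: mulr_ge0|exact: ler_pM]. Qed.

End Constants.

Section Master.
Context d (T : measurableType d) (R : realType) (P : probability T R).
Variables (isR : bool) (M N : finType) (G : M * N * bool -> T -> R).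
Hypothesis gG : gfam P G (fun q => vF R isR q.2).
Hypothesis G0 : isR -> forall i j w, G (i, j, false) w = 0.
Let m : R := #|M|%:R.
Let n : R := #|N|%:R.

Lemma quotient_case (s : nat) (w : N * bool -> R) : (0 < #|M|)%N -> (0 < #|N|)%N -> act isR w ->
  1 <= 2 + ln (n / m) ->
  sparse_eta R ^+ 2 * m <= 2 * (2 + ln (n / m)) * s%:R ->
  exists E : set T, [/\ measurable E, Pr P (~` E) <= 2 * expR (- m) &
    forall om, E om -> l2 (img (reA G om) w) <= 16 * Num.sqrt (12 * m) * l2 w ->
      exists uq, [/\ act isR uq, forall p, img (reA G om) uq p = img (reA G om) w p &
        cl1 uq <= quot_const R * Num.sqrt s%:R * l2 w]].
Proof.
move=> M0 N0 aw; set ell := 2 + _ => ell1 hs.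
have mp : 0 < m by rewrite ltr0n.
have np : 0 < n by rewrite ltr0n.
have e2 : 0 < sparse_eta R ^+ 2 by rewrite exprn_gt0 // sparse_eta_gt0.
have w1 := wide_ge1 R.
have q1 := quot_const_ge1 R.
set de := sparse_eta R ^+ 2 in hs e2.
have A0 : 0 <= 2 * wide R * (1 + wide R) / de.
  by rewrite divr_ge0 ?(ltW e2) // !mulr_ge0 ?addr_ge0 // (le_trans _ w1).
have B0 : 0 <= (3 * 32 * 16) ^+ 2 * (12 * 6) / de by rewrite divr_ge0 ?(ltW e2) // !mulr_ge0 ?sqr_ge0.
have s0 : 0 <= s%:R :> R by [].
have hm : m <= 2 * ell * s%:R / de by rewrite ler_pdivlMr // mulrC.
(* When n / m is bounded, so is [ell], and n is at most a constant times [s]; Cauchy-Schwarz then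
   bounds [cl1 w] itself. *)
have [nm|nm] := leP n (wide R * m).
  exists setT; split => //.
    by rewrite setCT /Pr measure0 mulr_ge0 ?expR_ge0.
  move=> om _ _; exists w; split => //.
  have W0 : 0 < wide R by apply: lt_le_trans w1.
  have ellw : ell <= 1 + wide R.
    have h : n / m <= wide R by rewrite ler_pdivrMr.
    have : ln (n / m) <= wide R - 1.
      apply: le_trans (ln_le_id (divr_gt0 np mp)) _; lra.
    rewrite /ell; lra.
  have xA : forall (j : N) (b : bool), j \notin [set: N]%SET -> w (j, b) = 0 by move=> j b; rewrite inE.
  apply: le_trans (cl1_le xA) _; rewrite cardsT.
  apply: sqrt_bound; rewrite ?l2_ge0 ?sqrtr_ge0 //.
  rewrite sqr_sqrtr ?ler0n //; apply: le_trans nm _.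
  apply: (@le_trans _ _ (wide R * (2 * ell * s%:R / de))); first by rewrite ler_pM2l.
  apply: (@le_trans _ _ (2 * wide R * (1 + wide R) / de * s%:R)); last first.
    by rewrite ler_wpM2r // /quot_const -/de; lra.
  rewrite (_ : wide R * _ = (2 * wide R / de * s%:R) * ell); last by ring.
  rewrite (_ : 2 * wide R * (1 + wide R) / de * s%:R = (2 * wide R / de * s%:R) * (1 + wide R)); last by ring.
  by rewrite ler_wpM2l // mulr_ge0 // divr_ge0 ?(ltW e2) // mulr_ge0 // ltW.
have r1 : 16 * (8 * 9 + 4) <= wide_r0 R by rewrite /wide_r0 lerDl expR_ge0.
have r2 : expR (40 * 80) <= wide_r0 R.
  by rewrite /wide_r0 lerDr mulr_ge0 // addr_ge0 // mulr_ge0.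
have r3 : 2 * wide_r0 R ^+ 4 * #|M|%:R <= #|N|%:R by apply: ltW.
have [lam [E [l0 lE l3 [mE PE] HE]]] := quotient_lift gG G0 M0 r1 r2 r3.
exists E; split => // om Eom hw.
have [uq [auq iuq cuq]] := HE om Eom w aw.
exists uq; split => //; apply: le_trans cuq _.
have li : 0 <= lam^-1 by rewrite invr_ge0 ltW.
have t0 : 0 <= 3 * 32 / lam by rewrite divr_ge0 ?(ltW l0) // mulr_ge0.
apply: le_trans (ler_wpM2l t0 hw) _; rewrite mulrA.
apply: sqrt_bound; rewrite ?l2_ge0 // ?mulr_ge0 ?sqrtr_ge0 //.
have l2p : 0 < lam ^+ 2 by rewrite exprn_gt0.
have l9 : 9 <= lam ^+ 2.
  by rewrite (_ : 9 = 3 ^+ 2); [rewrite lerXn2r ?nnegrE // ltW|ring].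
(* [ell] is at most 3 plus [ln (n / (2 * m))], hence at most [3 + 2 * lam ^ 2], and [l9] absorbs the
   3. *)
have elam : ell <= 3 * lam ^+ 2.
  have : ln (n / m) = ln 2 + ln (n / (2 * m)).
    rewrite -lnM ?posrE ?divr_gt0 ?mulr_gt0 //; congr ln; by field; rewrite gt_eqF.
  have := ln_le_id (ltr0Sn R 1); rewrite -/n -/m in lE; rewrite /ell => h1 ->.
  move: lE; set z := ln (n / (2 * m)); lra.
rewrite !exprMn sqr_sqrtr ?mulr_ge0 ?(ltW mp) // exprVn.
apply: (@le_trans _ _ ((3 * 32 * 16) ^+ 2 * (12 * 6) / de * s%:R)); last first.
  by rewrite ler_wpM2r // /quot_const -/de; lra.
have hm2 : m / lam ^+ 2 <= 6 / de * s%:R.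
  rewrite ler_pdivrMr //; apply: le_trans hm _.
  rewrite (_ : 2 * ell * s%:R / de = (2 / de * s%:R) * ell); last by ring.
  rewrite (_ : 6 / de * s%:R * lam ^+ 2 = (2 / de * s%:R) * (3 * lam ^+ 2)); last by ring.
  by rewrite ler_wpM2l // mulr_ge0 // divr_ge0 // ltW.
rewrite [leLHS](_ : _ = (3 * 32 * 16) ^+ 2 * 12 * (m / lam ^+ 2)); last by ring.
rewrite [leRHS](_ : _ = (3 * 32 * 16) ^+ 2 * 12 * (6 / de * s%:R)); last by ring.
by rewrite ler_wpM2l // mulr_ge0 // sqr_ge0.
Qed.

Variables (k : nat) (S : {set N}) (x0 xT w : N * bool -> R).
Hypothesis x0E : forall p, x0 p = xT p + w p.
Hypothesis axT : act isR xT.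
Hypothesis aw : act isR w.
Hypothesis Sk : (#|S| <= k)%N.
Hypothesis xTS : forall j b, j \notin S -> xT (j, b) = 0.
Hypothesis k1 : (0 < k <= #|N|)%N.
Hypothesis mk : sample_const R * k%:R * ln (expR 1 * n / k%:R) <= m.
Hypothesis mn : m <= expR 1 * n.

Lemma recovery_event : exists E : set T,
  [/\ measurable E, Pr P (~` E) <= 9 * expR (- (p0 / 8 * m)) &
    forall om, E om -> forall z, act isR z ->
      (forall i, crs (reA G om) z z i = crs (reA G om) x0 x0 i) ->
      (forall y, act isR y -> (forall i, crs (reA G om) y y i = crs (reA G om) x0 x0 i) ->
         cl1 z <= cl1 y) ->
      exists al be, [/\ al ^+ 2 + be ^+ 2 = 1, isR -> be = 0 &
        l2 (fun p => phase al be z p - x0 p) <= error_const R * l2 w]].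
Proof.
have pp := p0_gt0 R; have p4 := p0_le4 R.
have ep := cone_eps_gt0 R; have e24 := cone_eps_le R.
have c01 : 0 < (p0 / 16 : R) <= 1 by rewrite divr_gt0 //=; lra.
have e01 : 0 < cone_eps R <= 1 by rewrite ep /=; lra.
have etale : sparse_eta R * (9 + 2 / cone_eps R) <= p0 / 16 by rewrite sparse_etaE.
have [s [D [[M0 /andP[s0 sn] sk ell1] ks sD dm ent]]] :=
  sparsity_choice c01 e01 (sparse_eta_gt0 R) etale k1 mk mn.
rewrite -/m -/n in ell1 dm ent.
have mp : 0 < m by rewrite ltr0n.
have N0 : (0 < #|N|)%N by apply: leq_trans sn.
have np : 0 < n by rewrite ltr0n.
have sp : 0 < s%:R :> R by rewrite ltr0n.
set c : R := p0 / 16 in c01 ent.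
pose th : R := s%:R / n.
have th01 : 0 < th <= 1.
  by rewrite divr_gt0 //= ler_pdivrMr // mul1r ler_nat.
(* The exponent [6 m] beats [4 m] from the net in the image and at most [m] of entropy, leaving
   [- m]. *)
pose t := Num.sqrt (12 * m).
have t0 : 0 <= t by exact: sqrtr_ge0.
have t2 : t ^+ 2 = 12 * m by rewrite sqr_sqrtr // mulr_ge0 // ltW.
have D0 : 0 <= D%:R :> R by [].
have cm : c * m <= m by rewrite ler_piMl ?(ltW mp) //; case/andP: c01.
have h12 : (12 ^+ #|M| : R) <= expR (4 * m) by exact: (@le_expR_nat R 12 4).
have b2 : 12 ^+ #|M| * expR (- (t ^+ 2 / 2)) <= expR (- m).
  apply: (@le_trans _ _ (expR (4 * m) * expR (- (t ^+ 2 / 2)))).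
    by rewrite ler_pM2r ?expR_gt0.
  rewrite -expRD ler_expR t2; lra.
have ratio := exp_pow_ratio R N0 s0.
have th0 : 0 <= th by case/andP: th01 => /ltW.
have ti0 : 0 <= th^-1 ^+ s by rewrite exprn_ge0 // invr_ge0.
have two0 j : 0 <= 2 ^+ j :> R by exact: exprn_ge0.
have tn0 j : 0 <= (1 + 2 * th) ^+ j by rewrite exprn_ge0 // addr_ge0 // mulr_ge0.
have b1 : th^-1 ^+ s * 2 ^+ (2 * s) * (1 + 2 * th) ^+ #|N| * (12 ^+ #|M| * expR (- (t ^+ 2 / 2)))
    <= expR (- m).
  apply: (@le_trans _ _ (expR (s%:R * ln (n / s%:R)) * expR (1 * (2 * s)%:R) * expR (2 * 1 * s%:R) *
      (expR (4 * m) * expR (- (t ^+ 2 / 2))))).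
    apply: ler_pM.
    - by rewrite !mulr_ge0.
    - by rewrite mulr_ge0 ?expR_ge0 ?exprn_ge0.
    - apply: ler_pM3 => //; first by rewrite /th ratio.
        exact: (@le_expR_nat R 2 1).
      by have := exp_1D2 R s 1 N0; rewrite mul1n.
    - by rewrite ler_pM2r ?expR_gt0.
  rewrite -!expRD ler_expR t2 natrM; lra.
have [E1 [mE1 PE1 HE1]] := sparse_event gG M0 w t0 th01 b1 b2.
have cB : #|net (N * bool)%type s D|%:R <= expR (c * m).
  have /andP[th0' th1] := th01.
  apply: le_trans (card_net _ _ _ th0' th1) _.
  apply: (@le_trans _ _ (expR (s%:R * ln (n / s%:R)) * expR (1 * D%:R) * expR (2 * 2 * s%:R))).
    apply: ler_pM3 => //; first by rewrite /th ratio.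
    - exact: (@le_expR_nat R 2 1).
    - by rewrite card_prod card_bool mulnC; exact: exp_1D2.
  rewrite -!expRD ler_expR; lra.
have [E2 [mE2 PE2 HE2]] := pair_event gG (cone_eps R / Num.sqrt s%:R) cB.
have [E3 [mE3 PE3 HE3]] := quotient_case M0 N0 aw ell1 dm.
exists (E1 `&` E2 `&` E3); split.
- by apply: measurableI => //; exact: measurableI.
(* The 9 is 6 for the operator norms, 1 for the pairs and 2 for the preimage of the tail. *)
- rewrite !setCI.
  have mm : expR (- m) <= expR (- (p0 / 8 * m)).
    rewrite ler_expR lerN2 ler_piMl ?(ltW mp) //; lra.
  have PE2' : Pr P (~` E2) <= expR (- (p0 / 8 * m)).
    apply: le_trans PE2 _; rewrite -expRM_natl -expRD ler_expR -/m /c; lra.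
  have u1 := PrU P (measurableC mE1) (measurableC mE2).
  have u2 := PrU P (measurableU _ _ (measurableC mE1) (measurableC mE2)) (measurableC mE3).
  move: u1 u2 PE1 PE2' PE3 mm; set ex := expR (- m); set ey := expR _; lra.
- move=> om [[ev1 ev2] ev3] z az zx zmin.
  have [kapS wk] := HE1 om ev1.
  have [uq [auq iuq cuq]] := HE3 om ev3 wk.
  have lev0 : 0 < p0 * m / 4 by rewrite divr_gt0 // mulr_gt0.
  have kap0 : 0 <= 16 * t by rewrite mulr_ge0.
  have kap2 : (16 * t) ^+ 2 = 16 * 16 * 12 * m by rewrite exprMn t2; ring.
  have kl : 9 * (16 * t) ^+ 2 * cone_eps R <= p0 * m / 4 / 2.
    rewrite kap2 (_ : 9 * _ * cone_eps R = (9 * (16 * 16 * 12) * cone_eps R) * m); last by ring.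
    by rewrite cone_epsE le_eqVlt; apply/orP; left; apply/eqP; field.
  have [al [be [h1 h2 h3]]] := @recovery R isR M N (reA G om) (reA_D G om) (reA_Z G om) s D
    (cone_eps R) (16 * t) (p0 * m / 4) s0 ep e24 sD kap0 lev0 kl kapS (HE2 om ev2)
    k (quot_const R) S x0 xT w uq z x0E axT auq az Sk sk ks xTS iuq (quot_const_ge1 R) cuq wk zx zmin.
  exists al, be; split => //; apply: le_trans h3 _.
  rewrite ler_wpM2r ?l2_ge0 // /error_const lerD2r lerD2l kap2.
  by rewrite le_eqVlt; apply/orP; left; apply/eqP; field; rewrite !gt_eqF.
Qed.

End Master.

(** * Complex vectors in real coordinates *)

Section Coordinates.
Variables (R : realType) (isR : bool).

Definition coords n (x : 'cV[R[i]]_n) : 'I_n * bool -> R :=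
  fun p => if p.2 then complex.Re (x p.1 0) else complex.Im (x p.1 0).
Definition uncoords n (y : 'I_n * bool -> R) : 'cV[R[i]]_n :=
  \col_j (y (j, true) +i* y (j, false))%C.

Lemma uncoordsK n (y : 'I_n * bool -> R) : coords (uncoords y) = y.
Proof. by apply/funext => -[j []]; rewrite /coords /uncoords mxE. Qed.

Lemma cmodE (z : R[i]) : cmod z = Num.sqrt (complex.Re z ^+ 2 + complex.Im z ^+ 2).
Proof. by case: z. Qed.

Lemma cmod_ca n (x : 'cV[R[i]]_n) j : cmod (x j 0) = ca (coords x) j.
Proof. by rewrite cmodE /ca /l2 big_bool. Qed.

Lemma norm1E n (x : 'cV[R[i]]_n) : norm1 x = cl1 (coords x).
Proof. by apply: eq_bigr => j _; exact: cmod_ca. Qed.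

Lemma norm2E n (x : 'cV[R[i]]_n) : norm2 x = l2 (coords x).
Proof.
by rewrite -l2_ca /norm2 /l2; congr Num.sqrt; apply: eq_bigr => j _; rewrite cmod_ca.
Qed.

Lemma inF_im (z : R[i]) : inF isR z <-> (isR -> complex.Im z = 0).
Proof.
rewrite /inF; split=> h /h; first by rewrite -complexIm => -[].
by rewrite -complexIm => ->.
Qed.

Lemma vecF_act n (x : 'cV[R[i]]_n) : vecF isR x -> act isR (coords x).
Proof. by move=> h hR j; exact: (inF_im _).1 (h j) hR. Qed.

Lemma act_vecF n (y : 'I_n * bool -> R) : act isR y -> vecF isR (uncoords y).
Proof. by move=> h j; apply/inF_im => hR; rewrite mxE; exact: (h hR). Qed.

Lemma coordsB n (x y : 'cV[R[i]]_n) p : coords (x - y) p = coords x p - coords y p.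
Proof. by case: p => j []; rewrite /coords /= !mxE; case: (x j 0) => ? ?; case: (y j 0). Qed.

Lemma coordsZ n (al be : R) (x : 'cV[R[i]]_n) p :
  coords ((al +i* be)%C *: x) p = phase al (- be) (coords x) p.
Proof.
case: p => j b; rewrite /coords /phase /rot /= !mxE.
by case: (x j 0) => u v; case: b => /=; ring.
Qed.

(** Multiplying by the conjugate scalar, which is [phase al be], preserves the norm and moves the
    phase from [x] to [z]. *)
Lemma phase_unit_dist n (al be : R) (x z : 'cV[R[i]]_n) : al ^+ 2 + be ^+ 2 = 1 ->
  norm2 (z - (al +i* be)%C *: x) = l2 (fun p => phase al be (coords z) p - coords x p).
Proof.
move=> ab; rewrite norm2E.
set y := coords (z - _).
have -> : l2 y = l2 (phase al be y).
  by rewrite -(l2_ca y) -(l2_ca (phase al be y)); apply: eq_l2 => j; rewrite ca_phase.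
apply: eq_l2 => p.
have yE q : y q = coords z q - phase al (- be) (coords x) q by rewrite /y coordsB coordsZ.
case: p => j b; rewrite {1}/phase /rot !yE /phase /rot.
rewrite [X in _ = _ - X](_ : _ = (al ^+ 2 + be ^+ 2) * coords x (j, b)); last by rewrite ab mul1r.
by case: b => /=; ring.
Qed.

Lemma norm0E n (x : 'cV[R[i]]_n) : norm0 x = #|supp (ca (coords x))|.
Proof.
apply: eq_card => j; rewrite [RHS]inE -cmod_ca.
have -> : (cmod (x j 0) != 0) = (x j 0 != 0).
  congr (~~ _); apply/eqP/eqP => [/Normc.eq0_normc //|->].
  by rewrite cmodE /= expr0n addr0 sqrtr0.
by apply/idP/idP => [|h]; rewrite inE.
Qed.

Lemma dist_le n (c : R[i]) (x y : 'cV[R[i]]_n) : inF isR c -> cmod c = 1 ->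
  dist isR x y <= norm2 (x - c *: y).
Proof.
move=> cF c1; apply: ge_inf; last by exists c.
by exists 0 => _ [c' _ <-]; rewrite norm2E l2_ge0.
Qed.

(** The unimodular scalar in [dist] is absorbed into the sparse competitor, whose support does not
    grow; the witnesses show that both infima are over nonempty sets. *)
Lemma sigma_k_ge n k (x : 'cV[R[i]]_n) (b : R) :
  (forall y, (#|supp (ca y)| <= k)%N -> b <= l2 (fun p => coords x p - y p)) ->
  b <= sigma_k isR k x.
Proof.
move=> h; apply: lb_le_inf.
  exists (dist isR x 0); exists 0 => //; split; first by move=> i; apply/inF_im; rewrite mxE.
  rewrite norm0E eq_card0 // => j; rewrite inE -cmod_ca mxE cmodE /= expr0n addr0 sqrtr0.
  by rewrite eqxx.
move=> _ [z [_ zk] <-]; apply: lb_le_inf.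
  exists (norm2 (x - 1 *: z)); exists 1 => //; split; first exact/inF_im.
  by rewrite cmodE /= expr1n expr0n addr0 sqrtr1.
move=> _ [c _ <-]; rewrite norm2E.
rewrite (@eq_l2 _ _ _ (fun p => coords x p - coords (c *: z) p)); last by move=> p; exact: coordsB.
rewrite norm0E in zk; apply: h; apply: leq_trans zk; apply: subset_leq_card; apply/fintype.subsetP => j.
rewrite !inE; apply: contra => /eqP z0.
rewrite -cmod_ca in z0; have {}z0 := Normc.eq0_normc z0.
by rewrite -cmod_ca mxE z0 mulr0 cmodE /= expr0n addr0 sqrtr0.
Qed.

End Coordinates.

(** A support carrying maximal squared mass is optimal: any competitor costs at least the mass
    outside its own support. *)
Lemma best_support (R : realType) (N : finType) (k : nat) (x : N * bool -> R) :
  exists S : {set N}, (#|S| <= k)%N /\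
    let xS : N * bool -> R := fun p => if p.1 \in S then x p else 0 in
    forall y : N * bool -> R, (#|supp (ca y)| <= k)%N ->
      l2 (fun p => x p - xS p) <= l2 (fun p => x p - y p).
Proof.
pose F (S : {set N}) : R := \sum_(j in S) ca x j ^+ 2.
have S0 : (#|(finset.set0 : {set N})| <= k)%N by rewrite cards0.
case: (@Order.TotalTheory.arg_maxP _ R {set N} finset.set0 (fun S => #|S| <= k)%N F S0) => S Sk Smax.
exists S; split => // xS y yk.
have dE (U : {set N}) : \sum_(j | j \notin U) ca x j ^+ 2 = l2 x ^+ 2 - F U.
  by rewrite -(l2_ca x) sqr_l2 [X in X - _](bigID (fun j => j \in U)) /= addrC addrK.
rewrite -(ler_pXn2r (n := 2)) ?nnegrE ?l2_ge0 //.
have -> : l2 (fun p => x p - xS p) ^+ 2 = \sum_(j | j \notin S) ca x j ^+ 2.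
  rewrite -(l2_ca (fun p => _)) sqr_l2 [RHS]big_mkcond; apply: eq_bigr => j _.
  rewrite !sqr_ca /xS /=; case: (j \in S) => /=; last by rewrite !subr0.
  by rewrite !subrr expr0n addr0.
apply: (@le_trans _ _ (\sum_(j | j \notin supp (ca y)) ca x j ^+ 2)).
  by rewrite !dE lerD2l lerN2; exact: Smax.
rewrite -(l2_ca (fun p => x p - y p)) sqr_l2 big_mkcond; apply: ler_sum => j _.
case: ifP => [|_]; last exact: sqr_ge0.
rewrite inE negbK => /eqP yj; have := sqr_ca y j; rewrite yj expr0n /= => /esym/eqP.
rewrite paddr_eq0 ?sqr_ge0 // !sqrf_eq0 => /andP[/eqP y1 /eqP y2].
by rewrite !sqr_ca y1 y2 !subr0.
Qed.

Lemma complex_sum (R : realType) (I : finType) (F : I -> R[i]) :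
  \sum_i F i = ((\sum_i complex.Re (F i)) +i* (\sum_i complex.Im (F i)))%C.
Proof.
elim/big_rec3: _ => //= i a b c _ ->; by case: (F i).
Qed.

Section Measurements.
Context d (T : measurableType d) (R : realType).
Variables (m n : nat) (Are Aim : 'I_m -> 'I_n -> T -> R).

Lemma gauss_mx_reA w (x : 'cV[R[i]]_n) i :
  (gauss_mx Are Aim w *m x) i 0 =
  (reA (entries Are Aim) w (coords x) i +i* reA (entries Are Aim) w (rot (coords x)) i)%C.
Proof.
rewrite mxE complex_sum !reA_mv /mv -!sumrB.
congr (_ +i* _)%C; apply: eq_bigr => j _;
  rewrite /gauss_mx mxE /part /rot /coords /Mat /half /entries /=;
  case: (x j 0) => u v /=; ring.
Qed.

Lemma absv_crs w (x y : 'cV[R[i]]_n) :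
  absv (gauss_mx Are Aim w *m x) = absv (gauss_mx Are Aim w *m y) <->
  forall i, crs (reA (entries Are Aim) w) (coords x) (coords x) i =
            crs (reA (entries Are Aim) w) (coords y) (coords y) i.
Proof.
have E z i : absv (gauss_mx Are Aim w *m z) i 0 =
    Num.sqrt (crs (reA (entries Are Aim) w) (coords z) (coords z) i).
  by rewrite /absv mxE gauss_mx_reA cmodE /= /crs -!expr2.
have ge0 z i : 0 <= crs (reA (entries Are Aim) w) (coords z) (coords z) i.
  by rewrite /crs -!expr2 addr_ge0 ?sqr_ge0.
split=> [h i|h]; last by apply/colP => i; rewrite !E h.
have := congr1 (fun u : 'cV[R]_m => u i 0) h; rewrite !E => /eqP.
by rewrite eqr_sqrt // => /eqP.
Qed.

End Measurements.

Theorem theorem2p11 (R : realType) :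
  exists (C c1 c2 c3 C' : R),
    0 < C /\ 0 < c1 /\ 0 < c2 /\ 0 < c3 /\ 0 < C' /\
    forall (isR : bool) (m n : nat) (x0 : 'cV[R[i]]_n)
      (d : measure_display) (T : measurableType d) (P : probability T R)
      (Are Aim : 'I_m -> 'I_n -> T -> R),
      vecF isR x0 ->
      std_gaussian P isR Are Aim ->
      forall k : nat, (1 <= k <= n)%N ->
        C * k%:R * ln (expR 1 * n%:R / k%:R) <= m%:R ->
        exists E : set T, measurable E /\
          E `<=` [set w | forall xs, Delta1 isR (gauss_mx Are Aim w)
                                         (absv (gauss_mx Are Aim w *m x0)) xs ->
                          dist isR xs x0 <= C' * sigma_k isR k x0] /\
          ((1 - c3 * expR (- (c2 * m%:R)) - expR (- Num.sqrt (m%:R * n%:R))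
              - 2 * m%:R * expR (- (c1 * m%:R / ln (expR 1 * n%:R / m%:R))))%:E
           <= P E)%E.
Proof.
exists (sample_const R), 1, (p0 / 8), 9, (error_const R).
have C0 := sample_const_gt0 R; have C'0 := error_const_gt0 R; have pp := p0_gt0 R.
split; first exact: C0.
split; first exact: ltr01.
split; first by rewrite divr_gt0.
split; first by [].
split; first exact: C'0.
move=> isR m n x0 d T P Are Aim x0F gauss k k1 mk.
have kp : 0 < k%:R :> R by case/andP: k1 => k0 _; rewrite ltr0n.
have np : 0 < n%:R :> R.
  by case/andP: k1 => _ kn; apply: lt_le_trans kp _; rewrite ler_nat.
have m0 : 0 < m%:R :> R.
  apply: lt_le_trans mk; apply: mulr_gt0; first exact: mulr_gt0.
  rewrite ln_gt0 // ltr_pdivlMr // mul1r.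
  apply: (@le_lt_trans _ _ n%:R); first by case/andP: k1 => _; rewrite ler_nat.
  by rewrite ltr_pMl // expR_gt1.
(* If [m > e * n] the logarithm is negative and the claimed probability is at
   most 0. *)
have [mn|mn] := leP m%:R (expR 1 * n%:R : R); last first.
  exists set0; split; first exact: measurable0.
  split; first by move=> ?.
  rewrite measure0 lee_fin mul1r.
  have L0 : ln (expR 1 * n%:R / m%:R) < 0 :> R.
    by rewrite ln_lt0 // divr_gt0 ?mulr_gt0 ?expR_gt0 //= ltr_pdivrMr // mul1r.
  have e1 : 1 <= expR (- (m%:R / ln (expR 1 * n%:R / m%:R))) :> R.
    by rewrite -[leLHS]expR0 ler_expR oppr_ge0 mulr_ge0_le0 ?(ltW m0) // invr_le0 ltW.
  have m1 : 1 <= m%:R :> R by rewrite ler1n -(ltr0n R).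
  have h1 := expR_ge0 (- (p0 / 8 * m%:R) : R); have h2 := expR_ge0 (- Num.sqrt (m%:R * n%:R) : R).
  set ez := expR _ in e1 *; nra.
have gG := entries_gfam gauss.
have G0 : isR -> forall i j w, entries Are Aim (i, j, false) w = 0.
  by move=> hR i j w; move: gauss; rewrite /std_gaussian hR => -[_ [h _]]; exact: h.
have ax0 := vecF_act x0F.
have [S [Sk Sbest]] := best_support k (coords x0).
set xS := (fun p => _) in Sbest.
pose w p := coords x0 p - xS p.
have x0E p : coords x0 p = xS p + w p by rewrite /w addrC subrK.
have axS : act isR xS by move=> hR j; rewrite /xS /=; case: ifP => // _; exact: ax0.
have aw : act isR w by move=> hR j; rewrite /w axS // ax0 // subr0.
have xSS j b : j \notin S -> xS (j, b) = 0 by move=> jS; rewrite /xS /= (negPf jS).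
have k1' : (0 < k <= #|'I_n|)%N by rewrite card_ord.
have mk' : sample_const R * k%:R * ln (expR 1 * #|'I_n|%:R / k%:R) <= #|'I_m|%:R by rewrite !card_ord.
have mn' : #|'I_m|%:R <= expR 1 * #|'I_n|%:R :> R by rewrite !card_ord.
have [E [mE PE HE]] := recovery_event gG G0 x0E axS aw Sk xSS k1' mk' mn'.
exists E; split=> //; split.
- move=> om Eom xs [xsF [xsA xsmin]].
  have zx0 := (absv_crs Are Aim om xs x0).1 xsA.
  have zmin y : act isR y ->
      (forall i, crs (reA (entries Are Aim) om) y y i =
        crs (reA (entries Are Aim) om) (coords x0) (coords x0) i) ->
      cl1 (coords xs) <= cl1 y.
    move=> ay hy; rewrite -norm1E -[y]uncoordsK -norm1E; apply: xsmin.
      exact: act_vecF.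
    by apply/absv_crs => i; rewrite uncoordsK.
  have [al [be [ab beR hd]]] := HE om Eom _ (vecF_act xsF) zx0 zmin.
  have cF : inF isR (al +i* be)%C by apply/inF_im.
  have c1 : cmod (al +i* be)%C = 1 by rewrite cmodE /= ab sqrtr1.
  apply: le_trans (dist_le xs x0 cF c1) _.
  rewrite phase_unit_dist //; apply: le_trans hd _.
  rewrite ler_pM2l //; apply: sigma_k_ge; exact: Sbest.
- rewrite PrE // lee_fin.
  have := PrC P mE; move: PE; rewrite card_ord => PE h.
  have h2 := expR_ge0 (- Num.sqrt (m%:R * n%:R) : R).
  have h3 : 0 <= 2 * m%:R * expR (- (1 * m%:R / ln (expR 1 * n%:R / m%:R))) :> R.
    by rewrite mulr_ge0 ?expR_ge0 // mulr_ge0 // ltW.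
  lra.
Qed.
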